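(* Let $\varphi:=\sum_{\boldsymbol\alpha\in\mathbb F_{n_1}^+\times\cdots\times\mathbb F_{n_k}^+}A_{(\boldsymbol\alpha)}\otimes\mathbf Z_{\boldsymbol\alpha}$ be a formal power series with $A_{(\boldsymbol\alpha)}\in B(\mathcal K)$, $\mathcal K$ a Hilbert space, and let $\mathbf r=(r_1,\dots,r_k)$ with $r_i>0$. Put $$\mathcal A:=\left\{\left\|r_1^{2p_1}\cdots r_k^{2p_k}\sum_{\boldsymbol\alpha\in\Lambda_{\mathbf p}}\frac1{b_{1,\alpha_1}\cdots b_{k,\alpha_k}}A_{(\boldsymbol\alpha)}^*A_{(\boldsymbol\alpha)}\right\|:\ \mathbf p=(p_1,\dots,p_k)\in\mathbb Z_+^k\right\}.$$ (i) If the set $\mathcal A$ is bounded, then (for every Hilbert space $\mathcal H$) the series $$\sum_{\mathbf p\in\mathbb Z_+^k}\left\|\sum_{\boldsymbol\alpha\in\Lambda_{\mathbf p}}A_{(\boldsymbol\alpha)}\otimes\mathbf X_{\boldsymbol\alpha}\right\|$$ is convergent for $\mathbf X\in\mathbf r\mathbf D_{\mathbf q}(\mathcal H)$, and uniformly convergent on $\mathbf s\mathbf D_{\mathbf q}(\mathcal H)^-$ for any $\mathbf s=(s_1,\dots,s_k)$ with $0\le s_i<r_i$. (ii) If the set $\mathcal A$ is unbounded, then the series $$\sum_{\mathbf p\in\mathbb Z_+^k}\left\|\sum_{\boldsymbol\alpha\in\Lambda_{\mathbf p}}A_{(\boldsymbol\alpha)}\otimes\mathbf X_{\boldsymbol\alpha}\right\|\quad\text{and}\quad\sum_{\mathbf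 p\in\mathbb Z_+^k}\sum_{\boldsymbol\alpha\in\Lambda_{\mathbf p}}A_{(\boldsymbol\alpha)}\otimes\mathbf X_{\boldsymbol\alpha}$$ are divergent (the second in the operator norm) for some $\mathbf X\in\mathbf r\mathbf D_{\mathbf q}(\mathcal H)^-$ and some Hilbert space $\mathcal H$.
   Context: Polydomains. Fix $k\in\mathbb N=\{1,2,\dots\}$ and $n_1,\dots,n_k\in\mathbb N$. Hilbert spaces are complex; $A>0$ means that the operator $A$ is positive and invertible. $\mathbb F_{n_i}^+$ is the unital free semigroup on generators $g^i_1,\dots,g^i_{n_i}$ with identity $g^i_0$, and $|\alpha|$ is the length of $\alpha$. For $X_i=(X_{i,1},\dots,X_{i,n_i})\in B(\mathcal H)^{n_i}$ put $X_{i,\alpha}:=X_{i,j_1}\cdots X_{i,j_p}$ if $\alpha=g^i_{j_1}\cdots g^i_{j_p}$, and $X_{i,g_0^i}:=I$. Fix $\mathbf q=(q_1,\dots,q_k)$, where each $q_i=\sum_{\alpha\in\mathbb F_{n_i}^+}a_{i,\alpha}Z_\alpha$ is a positive regular polynomial in $n_i$ noncommuting indeterminates: a finite sum with $a_{i,\alpha}\ge0$, $a_{i,g_0^i}=0$ and $a_{i,g_j^i}>0$ for $j=1,\dots,n_i$. Define $\Phi_{q_i,X_i}(Y):=\sum_\alpha a_{i,\alpha}X_{i,\alpha}YX_{i,\alpha}^*$ for $Y\in B(\mathcal H)$. $B(\mathcal H)^{n_1}\times_c\cdots\times_cB(\mathcal H)^{n_k}$ is the set of $\mathbf X=(X_1,\dots,X_k)\in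 B(\mathcal H)^{n_1}\times\cdots\times B(\mathcal H)^{n_k}$ such that, for $s\ne t$, every entry of $X_s$ commutes with every entry of $X_t$. For $\mathbf p\in\{0,1\}^k$ let $\mathbf\Delta^{\mathbf p}_{\mathbf q,\mathbf X}:=(\mathrm{id}-\Phi_{q_1,X_1})^{p_1}\circ\cdots\circ(\mathrm{id}-\Phi_{q_k,X_k})^{p_k}$ and $\mathbf\Delta_{\mathbf q,\mathbf X}:=\mathbf\Delta^{(1,\dots,1)}_{\mathbf q,\mathbf X}$. Set $\mathbf D^-_{\mathbf q}(\mathcal H):=\{\mathbf X\in B(\mathcal H)^{n_1}\times_c\cdots\times_cB(\mathcal H)^{n_k}:\mathbf\Delta^{\mathbf p}_{\mathbf q,\mathbf X}(I)\ge0\text{ for all }\mathbf p\in\{0,1\}^k\}$ and $\mathbf D_{\mathbf q}(\mathcal H):=\{\mathbf X\in\mathbf D^-_{\mathbf q}(\mathcal H):\mathbf\Delta_{\mathbf q,\mathbf X}(I)>0\}$; $\mathbf D_{\mathbf q}(\mathcal H)^-$ is the operator norm closure of $\mathbf D_{\mathbf q}(\mathcal H)$. For $\mathbf r=(r_1,\dots,r_k)$ with $r_i\ge0$, $\mathbf r\mathbf X:=(r_1X_1,\dots,r_kX_k)$ and $\mathbf rG:=\{\mathbf r\mathbf X:\mathbf X\in G\}$. Coefficients and notation. $b_{i,g_0^i}:=1$ and, for $|\alpha|\ge1$, $b_{i,\alpha}:=\sum_{p=1}^{|\alpha|}\sum a_{i,\gamma_1}\cdots a_{i,\gamma_p}$,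 the inner sum over $\gamma_1,\dots,\gamma_p\in\mathbb F_{n_i}^+$ with $\gamma_1\cdots\gamma_p=\alpha$ and all $|\gamma_l|\ge1$. For $\boldsymbol\alpha=(\alpha_1,\dots,\alpha_k)$, $\mathbf X_{\boldsymbol\alpha}:=X_{1,\alpha_1}\cdots X_{k,\alpha_k}$; $\mathbf Z_{\boldsymbol\alpha}$ is defined likewise from indeterminates $Z_{i,j}$ ($Z_{s,j}$ and $Z_{t,l}$ commuting when $s\neq t$). $\mathbb Z_+$ is the set of nonnegative integers and $\Lambda_{\mathbf p}:=\{\boldsymbol\alpha\in\mathbb F_{n_1}^+\times\cdots\times\mathbb F_{n_k}^+:|\alpha_i|=p_i,\ i=1,\dots,k\}$. Series indexed by $\mathbb Z_+^k$ are understood as unordered sums (limits of the net of finite partial sums). *)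

(* Defs.v *)
From HB Require Import structures.
From mathcomp Require Import all_boot all_order all_algebra.
From mathcomp Require Import finmap complex.
From mathcomp Require Import all_classical all_reals all_analysis.
From mathcomp.analysis.showcase Require Export summability.

Set Implicit Arguments.
Unset Strict Implicit.
Unset Printing Implicit Defensive.

Import Order.TTheory GRing.Theory Num.Theory.
Import numFieldNormedType.Exports.

Local Open Scope classical_set_scope.
Local Open Scope complex_scope.
Local Open Scope ring_scope.

(* A complex Hilbert space.  The inner product is linear in its first argument
   and conjugate-linear in its second one; norms of vectors are elements of
   R[i], real and nonnegative for the partial order of R[i]. *)
HB.mixin Record CompleteNormedModule_isHilbert (R : realType) H
    & CompleteNormedModule R[i] H := {
  hdot : {dot H for (@Num.conj R[i])} ;
  hdot_norm : forall x : H, `|x| ^+ 2 = hdot x x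
}.

#[short(type="hilbertType")]
HB.structure Definition Hilbert (R : realType) :=
  {H of CompleteNormedModule_isHilbert R H & CompleteNormedModule R[i] H}.

Arguments hdot {R s}.

Section Operators.
Variables (R : realType) (H : hilbertType R).
Implicit Types S T : H -> H.

(* Membership in B(H).  Operators are plain functions, so that the vector space
   structure of H -> H applies; the notions below are used on bounded operators
   only. *)
Definition bounded_op T :=
  linear T /\ exists M : R[i], forall x, `|T x| <= M * `|x|.

Definition opnorm T : R :=
  sup [set complex.Re `|T x| | x in [set x : H | `|x| <= 1]].

(* The adjoint of a bounded operator, which exists and is unique. *)
Definition adj T : H -> H :=
  xget 0 [set S | bounded_op S /\ forall x y, hdot (T x) y = hdot x (S y)].

Definition op_ge0 T := forall x, 0 <= hdot (T x) x.

Definition op_gt0 T :=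
  op_ge0 T /\ exists S, [/\ bounded_op S, T \o S = id & S \o T = id].

(* Convergence in the operator norm of the net of finite partial sums. *)
Definition op_summable (I : choiceType) (u : I -> H -> H) :=
  exists2 S, bounded_op S &
    opnorm (partial_sum u J - S) @[J --> totally] --> (0 : R).

End Operators.

(* The Hilbert space tensor product, given by its characterization up to a
   unitary: a Hilbert space with a bilinear map whose values span a dense
   subspace and have the inner products of elementary tensors. *)
Record hilbertTensor (R : realType) (K H : hilbertType R) := HilbertTensor {
  tensor_space :> hilbertType R ;
  tens : K -> H -> tensor_space ;
  tens_linearl : forall y, linear (tens^~ y) ;
  tens_linearr : forall x, linear (tens x) ;
  tens_dot : forall x x' y y',
    hdot (tens x y) (tens x' y') = hdot x x' * hdot y y' ;
  tens_dense : dense [set \sum_(z <- s) tens z.1 z.2 | s in [set: seq (K * H)]]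
}.

(* The bounded operator A \otimes X, which exists and is unique for bounded
   A and X. *)
Definition tensop (R : realType) (K H : hilbertType R) (T : hilbertTensor K H)
    (A : K -> K) (X : H -> H) : T -> T :=
  xget 0 [set S | bounded_op S /\
                  forall x y, S (tens T x y) = tens T (A x) (X y)].

Arguments tensop {R K H} T A X.

Section Polynomials.
Variables (R : realType) (n : nat).

(* Coefficients of a positive regular polynomial; words of the free semigroup
   are sequences of generators, and the finiteness of the sum is that of the
   support of a. *)
Definition positive_regular (a : {fsfun seq 'I_n -> R with 0}) :=
  [/\ forall w, 0 <= a w, a [::] = 0 & forall j, 0 < a [:: j]].

(* The factors gamma_l of a word w have length at most size w, hence the
   bounded sequences. *)
Definition bcoef (a : seq 'I_n -> R) (w : seq 'I_n) : R :=
  if w is [::] then 1 else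
  \sum_(1 <= p < (size w).+1)
    \sum_(g : p.-tuple ((size w).-bseq 'I_n) |
        (flatten [seq val v | v <- g] == w) &&
        all (fun v => 0 < size (val v))%N g)
      \prod_(v <- g) a (val v).

Variable H : hilbertType R.

Definition word_op (X : 'I_n -> H -> H) (w : seq 'I_n) : H -> H :=
  \big[comp/idfun]_(j <- w) X j.

Definition Phi (a : {fsfun seq 'I_n -> R with 0}) (X : 'I_n -> H -> H)
    (Y : H -> H) : H -> H :=
  \sum_(w <- finsupp a) (a w)%:C *: (word_op X w \o Y \o adj (word_op X w)).

End Polynomials.

Section Polydomains.
Variables (R : realType) (k : nat) (n : 'I_k -> nat).
Variable q : forall i, {fsfun seq 'I_(n i) -> R with 0}.
Variable H : hilbertType R.

Definition optuple := forall i : 'I_k, 'I_(n i) -> H -> H.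
Implicit Types (X : optuple) (G : set optuple).

Definition commuting_tuple X :=
  (forall i j, bounded_op (X i j)) /\
  (forall s t, s != t -> forall j l, X s j \o X t l = X t l \o X s j).

Definition Delta (p : 'I_k -> bool) X : (H -> H) -> (H -> H) :=
  \big[comp/idfun]_(i < k) iter (p i) (fun S => S - Phi (q i) (X i) S).

Definition Dminus : set optuple :=
  [set X | commuting_tuple X /\ forall p, op_ge0 (Delta p X idfun)].

Definition Dopen : set optuple :=
  [set X | Dminus X /\ op_gt0 (Delta (fun=> true) X idfun)].

(* The norm topology of the finite product of the spaces B(H)^{n_i} is that of
   entrywise convergence in operator norm. *)
Definition opclosure G : set optuple :=
  [set X | (forall i j, bounded_op (X i j)) /\
     forall e : R, 0 < e ->
       exists2 Y, G Y & forall i j, opnorm (X i j - Y i j) < e].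

Definition scale_tuple (r : 'I_k -> R) X : optuple :=
  fun i j => (r i)%:C *: X i j.

(* X_{1,alpha_1} ... X_{k,alpha_k} *)
Definition multi_op X (w : forall i, seq 'I_(n i)) : H -> H :=
  \big[comp/idfun]_(i < k) word_op (X i) (w i).

End Polydomains.

Arguments optuple {R k} n H.
Arguments Dminus {R k n} q H.
Arguments Dopen {R k n} q H.

Section Series.
Variables (R : realType) (k : nat) (n : 'I_k -> nat).
Variable q : forall i, {fsfun seq 'I_(n i) -> R with 0}.
Variable K : hilbertType R.
Variable A : (forall i, seq 'I_(n i)) -> K -> K.

Definition Lambda (p : {ffun 'I_k -> nat}) :=
  {dffun forall i : 'I_k, (p i).-tuple 'I_(n i)}.

Definition words p (w : Lambda p) : forall i, seq 'I_(n i) := fun i => w i.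

Definition coef_norms (r : 'I_k -> R) : set R :=
  [set opnorm ((\prod_(i < k) r i ^+ (2 * p i))%:C *:
         (\sum_(w : Lambda p)
            ((\prod_(i < k) bcoef (q i) (words w i))^-1)%:C *:
              (adj (A (words w)) \o A (words w))))
     | p in [set: {ffun 'I_k -> nat}]].

(* The homogeneous part of multidegree p of the series, evaluated at X. *)
Definition hom_part (H : hilbertType R) (T : hilbertTensor K H)
    (X : optuple n H) (p : {ffun 'I_k -> nat}) : T -> T :=
  \sum_(w : Lambda p) tensop T (A (words w)) (multi_op X (words w)).

End Series.

Arguments hom_part {R k n K} A {H} T X p.

(* Main.v *)
Require Import Defs.
From HB Require Import structures.
From mathcomp Require Import all_boot all_order all_algebra.
From mathcomp Require Import finmap complex.
From mathcomp Require Import all_classical all_reals all_analysis.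
From mathcomp Require Import ring lra zify.

Set Implicit Arguments.
Unset Strict Implicit.
Unset Printing Implicit Defensive.

Import Order.TTheory GRing.Theory Num.Theory.
Import numFieldNormedType.Exports.

Local Open Scope classical_set_scope.
Local Open Scope complex_scope.
Local Open Scope ring_scope.

(** Write [b_w] for the product of the coefficients [b_(i, w_i)] of a multiword
    [w]. The homogeneous part of multidegree [p] factors as the row of the
    operators [1 (x) b_w^(1/2) X_w] times the column of the operators
    [b_w^(-1/2) A_w (x) 1], where [w] runs over the multiwords with lengths [p].
    Its squared norm is therefore at most the product of the norms of the sums
    of [b_w X_w X_w^*] and of [b_w^(-1) A_w^* A_w] ([tens_sum_bound]). Boundedness
    of the given set says that the second factor is at most
    [M r_1^(-2 p_1) ... r_k^(-2 p_k)] ([coef_bound]).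

    The first factor is controlled one tuple at a time. The coefficients satisfy
    [b_w = sum a_u b_v] over the factorizations [w = u v] with [u] nonempty
    ([bcoef_prefix]). If [Phi_i(1) <= rho] and [rho <= tau^N], where [N] bounds
    the lengths of the words in [q_i], this recursion shows by induction that the
    sum of [b_w X_w X_w^*] over the words of length [p] is at most [tau^p]
    ([word_row]); rows of rows give the product bound for several tuples
    ([multi_row]). In the open polydomain, [1 - Phi_i(1)] is at least the full
    defect operator, which is bounded below, and so [rho < 1] ([Dopen_row]). On
    the closure, [rho = 1] is still available ([closure_row]), and the dilation by
    [s_i < r_i] supplies the decay. In both cases the norms of the homogeneous
    parts have a geometric majorant, uniform in the second case: this is
    part (i).

    For part (ii) let [H] be the tensor product of the full Fock spaces, realized
    as the square-summable families indexed by multiwords, and let [W] be the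
    tuple of weighted shifts [e_v |-> (b_v / b_(jv))^(1/2) e_(jv)]. For [t < 1] all
    defect operators of [t W] are diagonal with entries between [(1 - t^2)^k] and
    1, so that [W] is in the closure of the polydomain ([dilated_Dopen],
    [shifts_closure]). At [X = r W] the homogeneous part of multidegree [p] maps
    [x (x) e_0] to an orthogonal sum whose squared norm is
    [r_1^(2 p_1) ... r_k^(2 p_k)] times the sum of [b_w^(-1) |A_w x|^2]
    ([hom_part_vacuum]). If the homogeneous parts were bounded in norm, so would
    be the given set ([coef_norms_bounded]); but the terms of a convergent series
    are bounded. *)

(** * Real parts of complex scalars *)

Section ComplexParts.
Variable R : rcfType.
Implicit Types (a b : R[i]) (c : R).
Lemma ReD a b : complex.Re (a + b) = complex.Re a + complex.Re b.
Proof. by case: a b => [? ?] [? ?]. Qed.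
Lemma ImD a b : complex.Im (a + b) = complex.Im a + complex.Im b.
Proof. by case: a b => [? ?] [? ?]. Qed.
Lemma ReN a : complex.Re (- a) = - complex.Re a.
Proof. by case: a. Qed.
Lemma ImN a : complex.Im (- a) = - complex.Im a.
Proof. by case: a. Qed.
Lemma ReZ c a : complex.Re (c%:C * a) = c * complex.Re a.
Proof. by case: a => u v /=; rewrite mul0r subr0. Qed.
Lemma ReJ a : complex.Re (a^*) = complex.Re a.
Proof. by case: a. Qed.
Lemma Re_iM a : complex.Re ('i * a) = - complex.Im a.
Proof. by case: a => u v /=; rewrite mul0r mul1r sub0r. Qed.
Lemma Re_sum I (s : seq I) (P : pred I) (F : I -> R[i]) :
  complex.Re (\sum_(i <- s | P i) F i) = \sum_(i <- s | P i) complex.Re (F i).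
Proof. by apply: (big_morph _ ReD). Qed.
Lemma normcR c : `|c%:C| = (`|c|)%:C :> R[i].
Proof. by rewrite normc_def /= expr0n /= addr0 sqrtr_sqr. Qed.
End ComplexParts.

(** A quadratic polynomial without negative value: at its vertex when [c > 0],
    and otherwise it has to be constant. The Cauchy-Schwarz inequalities below
    all come from here, those of degenerate forms included. *)
Lemma quad_discr (R : realFieldType) (a b c : R) :
  (forall t, 0 <= a + 2 * b * t + c * t ^+ 2) -> b ^+ 2 <= a * c.
Proof.
move=> h.
have a0 : 0 <= a by have := h 0; rewrite mulr0 addr0 expr0n mulr0 addr0.
have [c0|c0|c0] := ltrgtP c 0.
- exfalso; set m := a + `|b| + 1.
  have m0 : 1 <= m by rewrite /m; have := normr_ge0 b; lra.
  (* at -t the linear term is at most |2bt|, and -ct = 2m - c beats it *)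
  have := h (- (m * 2 / (- c) + 1)); set t := m * 2 / - c + 1.
  have ct : - (c * t) = 2 * m - c by rewrite /t; field; lra.
  have t1 : 1 <= t.
    rewrite /t lerDr; apply: divr_ge0; lra.
  have : c * t ^+ 2 = - (2 * m - c) * t by rewrite -ct; ring.
  have am : a + 1 <= m by rewrite /m; have := normr_ge0 b; lra.
  have bm : - b <= m by rewrite /m; have := ler_norm (- b); rewrite normrN; lra.
  nra.
- have := h (- b / c).
  have -> : a + 2 * b * (- b / c) + c * (- b / c) ^+ 2 = (a * c - b ^+ 2) / c by field; lra.
  by rewrite pmulr_lge0 ?invr_gt0// subr_ge0.
- subst c; rewrite mulr0.
  have [->|b0] := eqVneq b 0; first by rewrite expr0n.
  exfalso; have := h (- (a + 1) / (2 * b)).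
  rewrite mul0r addr0 [X in _ + X](_ : _ = - (a + 1)); first lra.
  by field.
Qed.

(** * The norm and the inner product as real numbers *)

Section HilbertBasics.
Variables (R : realType) (H : hilbertType R).
Implicit Types (x y z : H) (a : R[i]) (c : R).

(** Norms of vectors are elements of [R[i]], whose order is partial. Their real
    parts carry the same information and live in an ordered field, where all
    the estimates take place. *)
Definition hn x : R := complex.Re `|x|.
Definition rdot x y : R := complex.Re (hdot x y).

Lemma normE x : `|x| = (hn x)%:C.
Proof. by rewrite /hn RRe_real// ger0_real. Qed.

Lemma hn_ge0 x : 0 <= hn x.
Proof. by rewrite -ler0c -normE. Qed.
Hint Resolve hn_ge0 : core.

Lemma hdotxx x : hdot x x = (hn x ^+ 2)%:C.
Proof. by rewrite -hdot_norm normE rmorphXn. Qed.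

Lemma rdotxx x : rdot x x = hn x ^+ 2.
Proof. by rewrite /rdot hdotxx. Qed.

Lemma dotDl x y z : hdot (x + y) z = hdot x z + hdot y z.
Proof. exact: linearDl. Qed.
Lemma dotDr x y z : hdot z (x + y) = hdot z x + hdot z y.
Proof. exact: linearD. Qed.
Lemma dotZl a x z : hdot (a *: x) z = a * hdot x z.
Proof. exact: linearZl_LR. Qed.
Lemma dotZr a x z : hdot z (a *: x) = a^* * hdot z x.
Proof. exact: linearZr_LR. Qed.
Lemma dotC x y : hdot x y = (hdot y x)^*.
Proof. by rewrite (@hermitian_subproof _ _ _ _ hdot) expr0 mul1r. Qed.
Lemma dot0l x : hdot 0 x = 0. Proof. by rewrite -(scale0r 0) dotZl mul0r. Qed.
Lemma dot0r x : hdot x 0 = 0. Proof. by rewrite dotC dot0l rmorph0. Qed.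
Lemma dotNl x y : hdot (- x) y = - hdot x y.
Proof. by rewrite -scaleN1r dotZl mulN1r. Qed.
Lemma dotNr x y : hdot x (- y) = - hdot x y.
Proof. by rewrite dotC dotNl rmorphN/= -dotC. Qed.
Lemma dot_suml I (s : seq I) (P : pred I) (F : I -> H) y :
  hdot (\sum_(i <- s | P i) F i) y = \sum_(i <- s | P i) hdot (F i) y.
Proof. by apply: (big_morph (hdot^~ y)) => [u v|]; rewrite ?dotDl ?dot0l. Qed.
Lemma dot_sumr I (s : seq I) (P : pred I) (F : I -> H) y :
  hdot y (\sum_(i <- s | P i) F i) = \sum_(i <- s | P i) hdot y (F i).
Proof. by apply: (big_morph (hdot y)) => [u v|]; rewrite ?dotDr ?dot0r. Qed.

Lemma rdotC x y : rdot x y = rdot y x.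
Proof. by rewrite /rdot dotC ReJ. Qed.
Lemma rdotDl x y z : rdot (x + y) z = rdot x z + rdot y z.
Proof. by rewrite /rdot dotDl ReD. Qed.
Lemma rdotDr x y z : rdot z (x + y) = rdot z x + rdot z y.
Proof. by rewrite /rdot dotDr ReD. Qed.
Lemma rdotZl c x y : rdot (c%:C *: x) y = c * rdot x y.
Proof. by rewrite /rdot dotZl ReZ. Qed.
Lemma rdotZr c x y : rdot x (c%:C *: y) = c * rdot x y.
Proof. by rewrite rdotC rdotZl rdotC. Qed.
Lemma rdotNl x y : rdot (- x) y = - rdot x y.
Proof. by rewrite /rdot dotNl ReN. Qed.
Lemma rdotNr x y : rdot x (- y) = - rdot x y.
Proof. by rewrite /rdot dotNr ReN. Qed.
Lemma rdot_suml I (s : seq I) (P : pred I) (F : I -> H) y :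
  rdot (\sum_(i <- s | P i) F i) y = \sum_(i <- s | P i) rdot (F i) y.
Proof. by rewrite /rdot dot_suml Re_sum. Qed.
Lemma rdot_sumr I (s : seq I) (P : pred I) (F : I -> H) y :
  rdot y (\sum_(i <- s | P i) F i) = \sum_(i <- s | P i) rdot y (F i).
Proof. by rewrite /rdot dot_sumr Re_sum. Qed.

Lemma hn2D x y : hn (x + y) ^+ 2 = hn x ^+ 2 + 2 * rdot x y + hn y ^+ 2.
Proof. by rewrite -!rdotxx rdotDl !rdotDr (rdotC y x); ring. Qed.
Lemma hn2B x y : hn (x - y) ^+ 2 = hn x ^+ 2 - 2 * rdot x y + hn y ^+ 2.
Proof. by rewrite -!rdotxx rdotDl !rdotDr !(rdotNl, rdotNr) (rdotC y x); ring. Qed.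

Lemma hn0 : hn 0 = 0. Proof. by rewrite /hn normr0. Qed.
Lemma hn_eq0 x : hn x = 0 -> x = 0.
Proof. by move=> h; apply/eqP; rewrite -normr_eq0 normE h. Qed.
Lemma hnN x : hn (- x) = hn x. Proof. by rewrite /hn normrN. Qed.
Lemma hnBC x y : hn (x - y) = hn (y - x). Proof. by rewrite /hn distrC. Qed.
Lemma hnD x y : hn (x + y) <= hn x + hn y.
Proof. by rewrite -lecR rmorphD /= -!normE ler_normD. Qed.
Lemma hnB x y z : hn (x - z) <= hn (x - y) + hn (y - z).
Proof. by rewrite (le_trans _ (hnD _ _))// addrA subrK. Qed.
Lemma hnZ a x : hn (a *: x) = complex.Re `|a| * hn x.
Proof.
rewrite {1}/hn normrZ normE.
have /RRe_real {1}<- : `|a| \is Num.real by rewrite ger0_real.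
by rewrite ReZ.
Qed.
Lemma hnZr c x : hn (c%:C *: x) = `|c| * hn x.
Proof. by rewrite hnZ normcR. Qed.
Lemma hn_sqr_le x c : 0 <= c -> hn x ^+ 2 <= c ^+ 2 -> hn x <= c.
Proof. by move=> c0; rewrite ler_pXn2r ?nnegrE. Qed.

Lemma rdot_le x y : rdot x y <= hn x * hn y.
Proof.
have h : rdot x y ^+ 2 <= hn x ^+ 2 * hn y ^+ 2.
  apply: quad_discr => t; have := sqr_ge0 (hn (x + t%:C *: y)).
  by rewrite hn2D rdotZr hnZr exprMn real_normK ?num_real//; lra.
rewrite (le_trans (ler_norm _))//.
by rewrite -(@ler_pXn2r _ 2) ?nnegrE ?mulr_ge0// exprMn real_normK ?num_real.
Qed.

Lemma dot_inj x y : (forall z, rdot z x = rdot z y) -> x = y.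
Proof.
move=> h; apply/eqP; rewrite -subr_eq0; apply/eqP/hn_eq0/eqP.
by rewrite -sqrf_eq0 -rdotxx rdotDr rdotNr h subrr.
Qed.

(** The imaginary part of the inner product is the real inner product with
    ['i *: y]; complex identities thus reduce to real ones. *)
Lemma hdotE x y : hdot x y = (rdot x y) +i* (rdot x ('i *: y)).
Proof.
rewrite /rdot dotZr; case: (hdot x y) => u v /=.
by rewrite mul0r sub0r mulNr mul1r opprK.
Qed.

Lemma hn_complete (u : nat -> H) :
  (forall e : R, 0 < e -> exists N, forall n m, (N <= n)%N -> (N <= m)%N ->
     hn (u n - u m) < e) ->
  exists l, forall e : R, 0 < e -> exists N, forall n, (N <= n)%N -> hn (u n - l) < e.
Proof.
move=> hu.
have : cvg (u @ \oo).
  apply: cauchy_cvg; apply/cauchy_exP => e e0.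
  have re0 : 0 < complex.Re e by move: e0; rewrite ltcE /= => /andP[].
  have [N hN] := hu _ re0.
  exists (u N); exists N => // n /= Nn.
  rewrite -ball_normE /= normE; move: e0; rewrite !ltcE /= => /andP[/eqP -> _].
  by rewrite eqxx hN.
move=> /cvgrPdist_lt h; exists (lim (u @ \oo)) => e e0.
have /h[N _ hN] : 0 < e%:C by rewrite ltcR.
by exists N => n Nn; have := hN n Nn; rewrite /= normE ltcR hnBC.
Qed.

End HilbertBasics.
#[global] Hint Extern 0 (is_true (0 <= hn _)) => exact: hn_ge0 : core.

(** * Bounded operators, the Riesz theorem and adjoints *)

Section LinearMaps.
Variables (R : realType) (V W : lmodType R[i]) (T : V -> W).
Hypothesis linT : linear T.
Lemma lin0 : T 0 = 0.
Proof. by have := linT (-1) 0 0; rewrite !scaleN1r addNr addNr. Qed.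
Lemma linD x y : T (x + y) = T x + T y.
Proof. by have := linT 1 x y; rewrite !scale1r. Qed.
Lemma linZ a x : T (a *: x) = a *: T x.
Proof. by have := linT a x 0; rewrite lin0 !addr0. Qed.
Lemma linN x : T (- x) = - T x.
Proof. by rewrite -scaleN1r linZ scaleN1r. Qed.
Lemma linB x y : T (x - y) = T x - T y.
Proof. by rewrite linD linN. Qed.
Lemma lin_sum I (s : seq I) (P : pred I) (F : I -> V) :
  T (\sum_(i <- s | P i) F i) = \sum_(i <- s | P i) T (F i).
Proof. by apply: (big_morph T linD lin0). Qed.
End LinearMaps.

Lemma lin_comp (R : realType) (U V W : lmodType R[i]) (S : V -> W) (T : U -> V) :
  linear S -> linear T -> linear (S \o T).
Proof. by move=> hS hT a x y; rewrite /= hT hS. Qed.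

Lemma ffunS (U : Type) (V : zmodType) I (s : seq I) (P : pred I) (F : I -> U -> V) x :
  (\sum_(i <- s | P i) F i) x = \sum_(i <- s | P i) F i x.
Proof. by rewrite fct_sumE. Qed.

Section BoundedOps.
Variables (R : realType) (H : hilbertType R).
Implicit Types (S T : H -> H).

Lemma bounded_opP T :
  bounded_op T <-> linear T /\ exists2 c : R, 0 <= c & forall x, hn (T x) <= c * hn x.
Proof.
split=> [[lT [M hM]]|[lT [c c0 hc]]]; split=> //.
- exists `|complex.Re M| => // x; have := hM x; rewrite !normE lecE => /andP[_].
  rewrite mulrC ReZ /= mulrC => /le_trans; apply; apply: ler_wpM2r => //.
  exact: ler_norm.
- by exists c%:C => x; rewrite !normE -rmorphM lecR.
Qed.

Lemma bounded_lin T : bounded_op T -> linear T. Proof. by case. Qed.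

Lemma opnorm_has_sup T : bounded_op T ->
  has_sup [set complex.Re `|T x| | x in [set x : H | `|x| <= 1]].
Proof.
move=> /bounded_opP[lT [c c0 hc]]; split.
  by exists (complex.Re `|T 0|); exists 0 => //=; rewrite normr0.
exists c => _ [x /= x1 <-]; rewrite (le_trans (hc x))//.
by rewrite ler_piMr// -lecR -normE.
Qed.

Lemma opnorm_le T c : 0 <= c -> (forall x, hn (T x) <= c * hn x) -> opnorm T <= c.
Proof.
move=> c0 hc; apply: ge_sup.
  by exists (complex.Re `|T 0|); exists 0 => //=; rewrite normr0.
move=> _ [x /= x1 <-]; rewrite (le_trans (hc x))//.
by rewrite ler_piMr// -lecR -normE.
Qed.

Lemma opnorm_ge T x : bounded_op T -> hn x <= 1 -> hn (T x) <= opnorm T.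
Proof.
move=> bT x1; apply: ub_le_sup; first by case: (opnorm_has_sup bT).
by exists x => //=; rewrite normE lecR.
Qed.

Lemma opnorm_ge0 T : bounded_op T -> 0 <= opnorm T.
Proof.
by move=> bT; rewrite (le_trans _ (@opnorm_ge T 0 bT _))// hn0.
Qed.

Lemma opnormP T x : bounded_op T -> hn (T x) <= opnorm T * hn x.
Proof.
move=> bT; have [x0|x0] := eqVneq (hn x) 0.
  by rewrite (hn_eq0 x0) (lin0 (bounded_lin bT)) hn0 mulr0.
have xp : 0 < hn x by rewrite lt_def x0 hn_ge0.
rewrite -ler_pdivrMr//.
have := @opnorm_ge T ((hn x)^-1%:C *: x) bT.
rewrite (linZ (bounded_lin bT)) !hnZr ger0_norm ?invr_ge0// mulVf// => /(_ (lexx _)).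
by rewrite mulrC.
Qed.

Lemma bounded_op0 : bounded_op (0 : H -> H).
Proof.
apply/bounded_opP; split; first by move=> a x y; rewrite /= scaler0 addr0.
by exists 0 => // x; rewrite hn0 mul0r.
Qed.

Lemma bounded_id : bounded_op (idfun : H -> H).
Proof. by apply/bounded_opP; split=> //; exists 1 => // x; rewrite mul1r. Qed.

Lemma bounded_comp S T : bounded_op S -> bounded_op T -> bounded_op (S \o T).
Proof.
move=> /bounded_opP[lS [c c0 hc]] /bounded_opP[lT [d d0 hd]]; apply/bounded_opP.
split; first exact: lin_comp.
exists (c * d); first exact: mulr_ge0.
by move=> x; rewrite (le_trans (hc _))//= -mulrA ler_wpM2l.
Qed.

Lemma bounded_add S T : bounded_op S -> bounded_op T -> bounded_op (S + T).
Proof.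
move=> /bounded_opP[lS [c c0 hc]] /bounded_opP[lT [d d0 hd]]; apply/bounded_opP.
split; first by move=> a x y; rewrite !fctE lS lT scalerDr addrACA.
exists (c + d); first exact: addr_ge0.
by move=> x; rewrite (le_trans (hnD _ _))// mulrDl lerD.
Qed.

Lemma bounded_scale (a : R[i]) T : bounded_op T -> bounded_op (a *: T).
Proof.
move=> /bounded_opP[lT [d d0 hd]]; apply/bounded_opP.
split; first by move=> b x y; rewrite !fctE lT scalerDr !scalerA (mulrC a).
have a0 : 0 <= complex.Re `|a| by rewrite -ler0c RRe_real ?ger0_real.
exists (complex.Re `|a| * d); first exact: mulr_ge0.
by move=> x; rewrite fctE hnZ -mulrA ler_wpM2l.
Qed.

Lemma bounded_opp T : bounded_op T -> bounded_op (- T).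
Proof.
by move=> /(bounded_scale (-1)); rewrite scaleN1r.
Qed.

Lemma bounded_sum I (s : seq I) (P : pred I) (F : I -> H -> H) :
  (forall i, bounded_op (F i)) -> bounded_op (\sum_(i <- s | P i) F i).
Proof.
by move=> h; elim/big_rec : _ => [|i u _ hu]; [exact: bounded_op0|by apply: bounded_add].
Qed.

Lemma opnormD S T : bounded_op S -> bounded_op T ->
  opnorm (S + T) <= opnorm S + opnorm T.
Proof.
move=> bS bT; apply: opnorm_le; first by rewrite addr_ge0 ?opnorm_ge0.
by move=> x; rewrite (le_trans (hnD _ _))// mulrDl lerD ?opnormP.
Qed.

Lemma opnormN T : opnorm (- T) = opnorm T.
Proof.
by rewrite /opnorm; congr (sup _); apply: eq_imagel => x _; rewrite fctE normrN.
Qed.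

(** Completing the square: the minimizer of [|x|^2 - 2 Re (f x)] represents [f];
    by the parallelogram identity every minimizing sequence is Cauchy. *)
Lemma riesz (f : H -> R[i]) (c : R) : linear_for *%R f ->
  (forall x, complex.Re (f x) <= c * hn x) -> exists z, forall x, f x = hdot x z.
Proof.
move=> lf hf.
pose g x := complex.Re (f x).
have f0 : f 0 = 0.
  by have := lf (-1) 0 0; rewrite scaleN1r addNr mulN1r addNr.
have gD x y : g (x + y) = g x + g y.
  by rewrite /g -ReD; have := lf 1 x y; rewrite scale1r mul1r => ->.
have fZ (a : R[i]) x : f (a *: x) = a * f x.
  by have := lf a x 0; rewrite f0 !addr0.
have gZ (t : R) x : g (t%:C *: x) = t * g x by rewrite /g fZ ReZ.
pose J x := hn x ^+ 2 - 2 * g x.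
have Jlb x : - c ^+ 2 <= J x.
  rewrite /J; have := hf x; rewrite -/(g x); have := hn_ge0 x.
  have := sqr_ge0 (hn x - c); nra.
pose E := [set J x | x in [set: H]].
have infE : has_inf E.
  by split; [exists (J 0); exists 0|exists (- c ^+ 2) => _ [x _ <-]].
have Jge x : inf E <= J x by apply: ge_inf; [case: infE|exists x].
have Jpar x y : hn (x - y) ^+ 2 <= 2 * (J x - inf E) + 2 * (J y - inf E).
  have := Jge ((2^-1)%:C *: (x + y)).
  rewrite /J hnZr gZ gD exprMn hn2B hn2D.
  rewrite (@ger0_norm _ (2^-1)) ?invr_ge0//; lra.
have /choice[u hu] : forall n, exists x, J x < inf E + n.+1%:R^-1 => [n|].
  have [_ [x _ <-] hx] := @inf_adherent _ E n.+1%:R^-1 ltac:(by rewrite invr_gt0) infE.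
  by exists x.
have inv_small (e : R) : 0 < e -> exists N, forall n, (N <= n)%N -> n.+1%:R^-1 < e :> R.
  move=> e0; exists (Num.truncn e^-1) => n Nn.
  rewrite invf_plt ?posrE//; apply: (@lt_le_trans _ _ (Num.truncn e^-1).+1%:R).
    exact: truncnS_gt.
  by rewrite ler_nat.
have [z hz] : exists z, forall e : R, 0 < e -> exists N, forall n, (N <= n)%N -> hn (u n - z) < e.
  apply: hn_complete => e e0.
  have [|N hN] := inv_small (e ^+ 2 / 4); first by rewrite divr_gt0 ?exprn_gt0.
  exists N => n m Nn Nm.
  rewrite -(@ltr_pXn2r _ 2) ?nnegrE//; last exact: ltW.
  have := Jpar (u n) (u m); have := hu n; have := hu m; have := hN _ Nn; have := hN _ Nm.
  move: (m.+1%:R^-1) (n.+1%:R^-1) (hn (u n - u m) ^+ 2) (J (u m)) (J (u n)) (inf E) (e ^+ 2) => a b d1 d2 d3 d4 d5; lra.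
(* the minimum property, in the limit: no direction [y] decreases the functional *)
have key t y : 0 <= 2 * (rdot z y - g y) * t + hn y ^+ 2 * t ^+ 2.
  apply/ler_addgt0Pr => e e0.
  (* compare J (u n + t y) with J (u n), for n so large that both the defect
     J (u n) - inf E and the error of replacing u n by z are below e / 2 *)
  have [] := hz (e / (2 * (1 + 2 * `|t| * hn y))).
    by rewrite divr_gt0// mulr_gt0// ltr_wpDr// !mulr_ge0.
  move=> N1 hN1.
  have [|N2 hN2] := inv_small (e / 2); first by rewrite divr_gt0.
  pose n := maxn N1 N2.
  have := Jge (u n + t%:C *: y); rewrite /J hn2D gD gZ rdotZr hnZr exprMn real_normK ?num_real//.
  have := hu n; rewrite /J.
  have /hN2 := leq_maxr N1 N2; rewrite -/n => h2.
  have /hN1 := leq_maxl N1 N2; rewrite -/n => h1 h3 h4.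
  have h5 : t * (rdot (u n) y - rdot z y) * 2 <= e / 2.
    rewrite (_ : rdot (u n) y - _ = rdot (u n - z) y); last by rewrite rdotDl rdotNl.
    have h6 : t * rdot (u n - z) y <= `|t| * (hn (u n - z) * hn y).
      rewrite (le_trans (ler_norm _))// normrM ler_wpM2l//.
      by rewrite ler_norml rdot_le andbT lerNl -rdotNl -(hnN (u n - z)) rdot_le.
    move: h1; set d := hn (u n - z) in h6 *; have d0 : 0 <= d by exact: hn_ge0.
    set k := `|t| * hn y; have k0 : 0 <= k by rewrite mulr_ge0.
    have -> : 1 + 2 * `|t| * hn y = 1 + 2 * k by rewrite /k; ring.
    rewrite ltr_pdivlMr; last by lra.
    have : `|t| * (d * hn y) = d * k by rewrite /k; ring.
    nra.
  move: h2 h3 h4 h5; move: (n.+1%:R^-1) (hn (u n)) (g (u n)) (rdot (u n) y) (inf E) (hn y) => a b d1 d2 d3 d4; nra.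
have rz y : rdot z y = g y.
  have := @quad_discr R 0 (rdot z y - g y) (hn y ^+ 2).
  rewrite mul0r => h; apply/eqP; rewrite -subr_eq0 -sqrf_eq0 eq_le sqr_ge0 andbT.
  by apply: h => t; rewrite add0r.
exists z => x; rewrite hdotE rdotC rz.
have -> : rdot x ('i *: z) = complex.Im (f x).
  have -> : rdot x ('i *: z) = - rdot z ('i *: x).
    rewrite /rdot !dotZr (dotC z x); case: (hdot x z) => p q /=.
    by ring.
  by rewrite rz /g fZ Re_iM opprK.
by rewrite /g; case: (f x).
Qed.

(** [riesz] represents [x |-> <T x, y>] by a vector, so that the choice made in
    the definition of [adj] is a choice among existing operators. *)
Lemma adjP T : bounded_op T ->
  bounded_op (adj T) /\ forall x y, hdot (T x) y = hdot x (adj T y).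
Proof.
move=> /bounded_opP[lT [c c0 hc]].
suff ex : exists S, bounded_op S /\ forall x y, hdot (T x) y = hdot x (S y).
  exact: (@xgetPex _ 0 [set S | bounded_op S /\ forall x y, hdot (T x) y = hdot x (S y)]).
have /choice[S hS] : forall y, exists z, forall x, hdot (T x) y = hdot x z => [y|].
  apply: (@riesz _ (c * hn y)) => [a u v|x]; first by rewrite lT dotDl dotZl.
  rewrite (le_trans (rdot_le _ _))//.
  by rewrite mulrAC ler_wpM2r.
exists S; split=> //; apply/bounded_opP; split.
  move=> a x y; apply: dot_inj => z.
  by rewrite /rdot -hS !(dotDr, dotZr) -!hS.
exists c => // x.
have := rdot_le (T (S x)) x; rewrite /rdot hS -/(rdot _ _) rdotxx.
have h1 := hc (S x); have h2 := hn_ge0 x; have h3 := hn_ge0 (S x).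
have [->|x0] := eqVneq (hn (S x)) 0; first by move=> _; rewrite mulr_ge0.
have xp : 0 < hn (S x) by rewrite lt_def x0.
move=> h4; rewrite -(ler_pM2l xp) -expr2 (le_trans h4)//.
by rewrite mulrCA mulrA ler_wpM2r.
Qed.

Lemma bounded_adj T : bounded_op T -> bounded_op (adj T).
Proof. by case/adjP. Qed.

Lemma rdot_adj T x y : bounded_op T -> rdot (T x) y = rdot x (adj T y).
Proof. by rewrite /rdot => /adjP[_ ->]. Qed.

Lemma adj_comp S T : bounded_op S -> bounded_op T ->
  adj (S \o T) = adj T \o adj S.
Proof.
move=> bS bT; apply/funext => x; apply: dot_inj => z /=.
by rewrite -!rdot_adj//; apply: bounded_comp.
Qed.

(** An invertible positive operator is bounded below: with [x = D (S x)], the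
    Cauchy-Schwarz inequality of the form [<D u, v>] gives
    [|x|^4 <= <D x, x> <x, S x>], and a bound of the inverse [S] is left. *)
Lemma op_gt0_lower (D : H -> H) : op_gt0 D ->
  exists2 c : R, 0 < c & forall x, c * hn x ^+ 2 <= rdot (D x) x.
Proof.
move=> [D0 [S [/bounded_opP[lS [M M0 hM]] DS SD]]].
have DSx x : D (S x) = x by rewrite -[LHS]/((D \o S) x) DS.
have SDx x : S (D x) = x by rewrite -[LHS]/((S \o D) x) SD.
have lD : linear D.
  by move=> a x y; rewrite -{1}(SDx x) -{1}(SDx y) -lS DSx.
have Dre x : complex.Im (hdot (D x) x) = 0.
  by have := D0 x; rewrite lecE => /andP[/eqP->].
have Dge x : 0 <= rdot (D x) x.
  by have := D0 x; rewrite lecE => /andP[].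
have Dsym x y : rdot (D x) y = rdot (D y) x.
  have := Dre (x + 'i *: y).
  rewrite (linD lD) (linZ lD) !(dotDl, dotDr, dotZl, dotZr) !ImD Dre.
  have := Dre y; rewrite /rdot; case: (hdot (D y) y) => p q /= ->.
  case: (hdot (D x) y) => p1 q1; case: (hdot (D y) x) => p2 q2 /=; lra.
exists (M + 1)^-1 => [|x]; first by rewrite invr_gt0; lra.
have CS : (hn x ^+ 2) ^+ 2 <= rdot (D x) x * rdot x (S x).
  apply: quad_discr => t; have := Dge (x + t%:C *: S x).
  rewrite (linD lD) (linZ lD) !(rdotDl, rdotDr, rdotZl, rdotZr) DSx.
  by rewrite (Dsym x (S x)) DSx rdotxx; lra.
have h1 : rdot x (S x) <= M * hn x ^+ 2.
  by rewrite (le_trans (rdot_le _ _))// expr2 mulrCA ler_wpM2l.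
rewrite mulrC ler_pdivrMr; last by lra.
have [->|x0] := eqVneq (hn x) 0; first by rewrite expr0n/= mulr_ge0//; lra.
have xp : 0 < hn x ^+ 2 by rewrite exprn_gt0// lt_def x0 hn_ge0.
rewrite -(ler_pM2l xp) -expr2 (le_trans CS)//.
by have := Dge x; nra.
Qed.

End BoundedOps.

(** * Operators on Hilbert tensor products *)

Section Orthogonal.
Variables (R : realType) (H : hilbertType R).

Lemma hn_pyth (I : finType) (v : I -> H) :
  (forall i j, i != j -> hdot (v i) (v j) = 0) ->
  hn (\sum_i v i) ^+ 2 = \sum_i hn (v i) ^+ 2.
Proof.
move=> h; rewrite -rdotxx rdot_suml; apply: eq_bigr => i _.
rewrite rdot_sumr (bigD1 i)//= rdotxx big1 ?addr0// => j ji.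
by rewrite /rdot h// eq_sym.
Qed.

Definition orthonormal_upto m (e : nat -> H) :=
  forall i j, (i < m)%N -> (j < m)%N -> hdot (e i) (e j) = (i == j)%:R.

(** Membership in the span of an orthonormal family, with the coefficients made
    explicit. *)
Definition in_span m (e : nat -> H) y := y = \sum_(l < m) hdot y (e l) *: e l.

Lemma gram_schmidt (ys : seq H) : exists m (e : nat -> H),
  orthonormal_upto m e /\ forall y, y \in ys -> in_span m e y.
Proof.
elim: ys => [|y ys [m [e [oe he]]]]; first by exists 0%N, (fun=> 0); split.
pose y' := y - \sum_(l < m) hdot y (e l) *: e l.
have y'e l : (l < m)%N -> hdot y' (e l) = 0.
  move=> lm; rewrite /y' dotDl dotNl dot_suml (bigD1 (Ordinal lm))//= dotZl oe// eqxx.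
  rewrite mulr1 big1 ?addr0 ?subrr// => j jl.
  by rewrite dotZl oe// (_ : (_ == _) = false) ?mulr0//; apply/negbTE.
have [y0|y0] := eqVneq (hn y') 0.
  exists m, e; split=> // z; rewrite inE => /orP[/eqP->|/he//].
  by apply/eqP; rewrite -subr_eq0 -/y' (hn_eq0 y0).
have yp : 0 < hn y' by rewrite lt_def y0 hn_ge0.
pose f := ((hn y')^-1)%:C *: y'.
have ff : hdot f f = 1.
  by rewrite hdotxx hnZr ger0_norm ?invr_ge0// mulVf// expr1n.
have fe l : (l < m)%N -> hdot f (e l) = 0.
  by move=> lm; rewrite dotZl y'e// mulr0.
have ef l : (l < m)%N -> hdot (e l) f = 0.
  by move=> lm; rewrite dotC fe// rmorph0.
exists m.+1, (fun l => if l == m then f else e l); split.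
  move=> i j; rewrite !ltnS => im jm.
  rewrite /=; case: (altP (i =P m)) => [->|ni]; case: (altP (j =P m)) => [->|nj].
  - by rewrite eqxx.
  - by rewrite fe ?ltn_neqAle ?nj// eq_sym (negbTE nj).
  - by rewrite ef ?ltn_neqAle ?ni// (negbTE ni).
  - by rewrite oe ?ltn_neqAle ?ni ?nj.
move=> z; rewrite inE /in_span big_ord_recr /= eqxx.
under eq_bigr => l _ do rewrite (ltn_eqF (ltn_ord l)).
case/orP=> [/eqP->|/he zs]; last first.
  suff -> : hdot z f = 0 by rewrite scale0r addr0.
  by rewrite zs dot_suml big1// => l _; rewrite dotZl ef// mulr0.
have -> : hdot y f *: f = y'.
  rewrite -[in hdot y f](subrK (\sum_(l < m) hdot y (e l) *: e l) y) -/y' dotDl dot_suml [X in _ + X]big1 ?addr0; last first.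
    by move=> l _; rewrite dotZl ef// mulr0.
  have -> : y' = (hn y')%:C *: f.
    by rewrite scalerA -rmorphM divff// scale1r.
  by rewrite dotZl ff mulr1.
by rewrite addrC subrK.
Qed.

End Orthogonal.

(** The rearrangement is the same for every bilinear map; it is used both for the
    tensors themselves and for their images under operators. *)
Lemma bilinear_span (R : realType) (K H : hilbertType R) (V : lmodType R[i])
    (b : K -> H -> V) (s : seq (K * H)) m (e : nat -> H) :
  (forall y, linear (b^~ y)) -> (forall x, linear (b x)) ->
  (forall z, z \in s -> in_span m e z.2) ->
  \sum_(z <- s) b z.1 z.2 =
  \sum_(l < m) b (\sum_(z <- s) hdot z.2 (e l) *: z.1) (e l).
Proof.
move=> bl br hs.
under [RHS]eq_bigr do rewrite (lin_sum (bl _)).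
rewrite exchange_big /= big_seq [RHS]big_seq; apply: eq_bigr => z /hs hz.
rewrite {1}hz (lin_sum (br _)); apply: eq_bigr => l _.
by rewrite (linZ (br _)) (linZ (bl _)).
Qed.

Section TensorRow.
Variables (R : realType) (K H : hilbertType R) (T : hilbertTensor K H).

Definition alg_tens (s : seq (K * H)) : T := \sum_(z <- s) tens T z.1 z.2.

Lemma hn_tens x y : hn (tens T x y) = hn x * hn y.
Proof.
apply/eqP; rewrite -(@eqrXn2 _ 2) ?mulr_ge0// -rdotxx /rdot tens_dot !hdotxx.
by rewrite -rmorphM /= exprMn.
Qed.

Lemma hn_tensr m (e : nat -> H) (x : 'I_m -> K) : orthonormal_upto m e ->
  hn (\sum_(l < m) tens T (x l) (e l)) ^+ 2 = \sum_(l < m) hn (x l) ^+ 2.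
Proof.
move=> oe; rewrite hn_pyth => [|i j ij]; last by rewrite tens_dot oe// val_eqE (negbTE ij) mulr0.
apply: eq_bigr => l _; rewrite hn_tens exprMn.
by rewrite -(rdotxx (e l)) /rdot oe// eqxx mulr1.
Qed.

Lemma hn_tensl m (e : nat -> K) (x : 'I_m -> H) : orthonormal_upto m e ->
  hn (\sum_(l < m) tens T (e l) (x l)) ^+ 2 = \sum_(l < m) hn (x l) ^+ 2.
Proof.
move=> oe; rewrite hn_pyth => [|i j ij]; last by rewrite tens_dot oe// val_eqE (negbTE ij) mul0r.
apply: eq_bigr => l _; rewrite hn_tens exprMn.
by rewrite -(rdotxx (e l)) /rdot oe// eqxx mul1r.
Qed.

(** Expand the second components in an orthonormal family: the tensor becomes
    an orthogonal sum, and the column bound [M] applies to each coefficient.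
    Then expand the images in an orthonormal family of the first space: the row
    bound [N] applies to each coefficient of that second orthogonal sum. *)
Lemma tens_row_bound (W : finType) (B : W -> K -> K) (Y : W -> H -> H) (M N : R) :
  0 <= N -> (forall w, linear (B w)) -> (forall w, linear (Y w)) ->
  (forall x, \sum_w hn (B w x) ^+ 2 <= M * hn x ^+ 2) ->
  (forall h : W -> H, hn (\sum_w Y w (h w)) ^+ 2 <= N * \sum_w hn (h w) ^+ 2) ->
  forall s, hn (\sum_w \sum_(z <- s) tens T (B w z.1) (Y w z.2)) ^+ 2 <=
            M * N * hn (alg_tens s) ^+ 2.
Proof.
move=> N0 lB lY hB hY s.
have [m [e [oe he]]] := gram_schmidt [seq z.2 | z <- s].
have {}he z : z \in s -> in_span m e z.2 by move=> zs; apply: he; apply: map_f.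
pose x l := \sum_(z <- s) hdot z.2 (e l) *: z.1.
have -> : alg_tens s = \sum_(l < m) tens T (x l) (e l).
  by apply: bilinear_span => // *; [exact: tens_linearl|exact: tens_linearr].
under eq_bigr => w _.
  rewrite (@bilinear_span _ _ _ _ (fun u v => tens T (B w u) (Y w v)) s m e) => [|y|u|//].
  - over.
  - by move=> a u v; rewrite lB (@tens_linearl _ _ _ T).
  - by move=> a v v'; rewrite lY (@tens_linearr _ _ _ T).
rewrite -/x hn_tensr//.
have [m' [f [of_ hf]]] := gram_schmidt [seq B p.1 (x p.2) | p : W * 'I_m].
have {}hf w l : in_span m' f (B w (x (l : 'I_m))).
  by apply: hf; apply/fintype.imageP; exists (w, l).
pose u w j := \sum_(l < m) hdot (B w (x l)) (f j) *: e l.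
have -> : \sum_w \sum_(l < m) tens T (B w (x l)) (Y w (e l)) =
          \sum_(j < m') tens T (f j) (\sum_w Y w (u w j)).
  under [RHS]eq_bigr do rewrite (lin_sum (tens_linearr T _)).
  rewrite [RHS]exchange_big /=; apply: eq_bigr => w _.
  under [RHS]eq_bigr do rewrite (lin_sum (lY w)) (lin_sum (tens_linearr T _)).
  rewrite [RHS]exchange_big /=; apply: eq_bigr => l _.
  rewrite {1}hf (lin_sum (tens_linearl T _)); apply: eq_bigr => j _.
  by rewrite (linZ (lY w)) (linZ (tens_linearl T _)) (linZ (tens_linearr T _)).
rewrite hn_tensl//.
apply: (@le_trans _ _ (N * \sum_(j < m') \sum_w hn (u w j) ^+ 2)).
  by rewrite mulr_sumr; apply: ler_sum => j _; exact: hY.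
rewrite (mulrC M) -mulrA ler_wpM2l// mulr_sumr exchange_big /=.
have -> : \sum_w \sum_(j < m') hn (u w j) ^+ 2 = \sum_w \sum_(l < m) hn (B w (x l)) ^+ 2.
  apply: eq_bigr => w _.
  under eq_bigr => j _.
    rewrite hn_pyth => [|a b ab]; last by rewrite dotZl dotZr oe// val_eqE (negbTE ab) !mulr0.
    under eq_bigr => l _ do rewrite hnZ exprMn -(rdotxx (e l)) /rdot oe// eqxx mulr1.
    over.
  rewrite exchange_big /=; apply: eq_bigr => l _.
  rewrite [in RHS]hf hn_pyth => [|a b ab]; last by rewrite dotZl dotZr of_// val_eqE (negbTE ab) !mulr0.
  by apply: eq_bigr => j _; rewrite hnZ exprMn -(rdotxx (f j)) /rdot of_// eqxx mulr1.
by rewrite exchange_big /=; apply: ler_sum => l _; exact: hB.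
Qed.

Lemma alg_tens_dense (x : T) (eps : R) : 0 < eps ->
  exists s, hn (x - alg_tens s) < eps.
Proof.
move=> e0; have ec : 0 < eps%:C by rewrite ltcR.
have [|y [bxy [s _ sy]]] := @tens_dense _ _ _ T (ball x eps%:C) _ (ball_open _ _).
  by exists x; exact: ballxx.
by exists s; move: bxy; rewrite -ball_normE /= -sy normE ltcR.
Qed.

End TensorRow.

(** A map that multiplies norms by at most [c] on a dense linear family of
    vectors extends to the whole space: the value at [x] is the limit along any
    approximating sequence. *)
Lemma dense_extension (R : realType) (V W : hilbertType R) (D : Type)
    (f : D -> V) (g : D -> W) (c : R) :
  (forall a s t, exists u, f u = a *: f s + f t /\ g u = a *: g s + g t) ->
  (forall s, hn (g s) <= c * hn (f s)) ->
  (forall x (eps : R), 0 < eps -> exists s, hn (x - f s) < eps) ->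
  exists S : V -> W, [/\ linear S, forall s, S (f s) = g s &
                         forall x, hn (S x) <= c * hn x].
Proof.
move=> fgD fg_le f_dense.
have small (x : V) (y : W) k : (forall eps : R, 0 < eps -> hn y <= k * eps) -> y = 0.
  move=> h; apply: hn_eq0; apply/eqP; rewrite eq_le hn_ge0 andbT.
  apply/ler_addgt0Pr => e e0; rewrite add0r.
  have k1 : 0 < `|k| + 1 by rewrite ltr_wpDl.
  have := h (e / (`|k| + 1)) ltac:(by rewrite divr_gt0).
  move=> /le_trans; apply; rewrite mulrA ler_pdivrMr//; have := ler_norm k; nra.
have fgB s t : hn (g s - g t) <= c * hn (f s - f t).
  have [u [fu gu]] := fgD (-1) t s; have := fg_le u.
  by rewrite fu gu !scaleN1r ![- _ + _]addrC.
have [c0|c0] := ltP c 0.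
  (* then every vector of V vanishes *)
  have V0 (x : V) : x = 0.
    have f0 s : f s = 0.
      apply: hn_eq0; apply/eqP; rewrite eq_le hn_ge0 andbT -(ler_nM2l c0) mulr0.
      exact: le_trans (hn_ge0 _) (fg_le s).
    have h eps : 0 < eps -> hn x <= eps.
      by move=> /(f_dense x)[s]; rewrite f0 subr0 => /ltW.
    by apply: hn_eq0; apply/eqP; rewrite eq_le hn_ge0 andbT; apply/ler_addgt0Pr => e e0; rewrite add0r h.
  exists (fun=> 0); split=> [a x y|s|x]; first by rewrite scaler0 addr0.
    apply/esym/hn_eq0; apply/eqP; rewrite eq_le hn_ge0 andbT.
    by rewrite (le_trans (fg_le s))// (V0 (f s)) hn0 mulr0.
  by rewrite (V0 x) !hn0 mulr0.
have /choice[S hS] : forall x, exists y, forall s, hn (y - g s) <= c * hn (x - f s).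
  move=> x.
  have /choice[u hu] : forall n, exists s, hn (x - f s) < n.+1%:R^-1.
    by move=> n; apply: f_dense; rewrite invr_gt0.
  have [|y hy] := @hn_complete _ _ (g \o u).
    move=> e e0; have k0 : 0 < 2 * (c + 1) by rewrite mulr_gt0// ltr_wpDl.
    exists (Num.truncn (e / (2 * (c + 1)))^-1) => n m Nn Nm.
    have inv_small i : (Num.truncn (e / (2 * (c + 1)))^-1 <= i)%N -> i.+1%:R^-1 < e / (2 * (c + 1)).
      move=> Ni; rewrite invf_plt ?posrE ?divr_gt0//.
      by apply: (lt_le_trans (truncnS_gt _)); rewrite ler_nat.
    have h1 := lt_trans (hu n) (inv_small _ Nn); have h2 := lt_trans (hu m) (inv_small _ Nm).
    have h3 := hnB (f (u n)) x (f (u m)); rewrite (hnBC (f (u n)) x) in h3.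
    move: h1 h2; rewrite !ltr_pdivlMr// => h1 h2.
    have h4 := fgB (u n) (u m).
    have h5 := ler_wpM2l c0 h3; have p0 := hn_ge0 (x - f (u n)); have q0 := hn_ge0 (x - f (u m)).
    by apply: (le_lt_trans h4); apply: (le_lt_trans h5); lra.
  exists y => s; apply/ler_addgt0Pr => e e0.
  have k0 : 0 < 2 * (c + 1) by rewrite mulr_gt0// ltr_wpDl.
  have [N hN] := hy (e / 2) ltac:(by rewrite divr_gt0).
  pose n := maxn N (Num.truncn (e / (2 * (c + 1)))^-1).
  have h1 : hn (g (u n) - y) < e / 2 by apply: hN; exact: leq_maxl.
  have h2 : hn (x - f (u n)) < e / (2 * (c + 1)).
    apply: (lt_trans (hu n)); rewrite invf_plt ?posrE ?divr_gt0//.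
    by apply: (lt_le_trans (truncnS_gt _)); rewrite ler_nat; exact: leq_maxr.
  have h3 := hnB y (g (u n)) (g s); have h4 := fgB (u n) s.
  have h5 := hnB (f (u n)) x (f s).
  move: h2; rewrite ltr_pdivlMr// => h2; rewrite (hnBC y (g (u n))) in h3; rewrite (hnBC (f (u n)) x) in h5.
  have h6 := ler_wpM2l c0 h5; have p0 := hn_ge0 (x - f (u n)); lra.
have Sf s : S (f s) = g s.
  have := hS (f s) s; rewrite subrr hn0 mulr0 => h; apply/eqP; rewrite -subr_eq0; apply/eqP/hn_eq0/eqP.
  by rewrite eq_le h hn_ge0.
have [s0 _] := f_dense 0 1 ltr01.
have [z0 [fz gz]] := fgD (-1) s0 s0; rewrite !scaleN1r !addNr in fz gz.
(* [S] is linear up to the error of approximating both arguments within [e] *)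
exists S; split=> // [a x y|x]; last by have := hS x z0; rewrite fz gz !subr0.
apply/eqP; rewrite -subr_eq0; apply/eqP.
set ra := complex.Re `|a|.
have ra0 : 0 <= ra by rewrite -ler0c RRe_real ?ger0_real.
apply: (small 0 _ (2 * c * (ra + 1))) => e e0.
have [s hs] := f_dense x e e0; have [t ht] := f_dense y e e0.
have [u [fu gu]] := fgD a s t.
have h1 := hS (a *: x + y) u.
have h2 : hn (a *: x + y - f u) <= ra * hn (x - f s) + hn (y - f t).
  by rewrite fu opprD addrACA -scalerBr (le_trans (hnD _ _))// hnZ.
have h3 : hn (g u - (a *: S x + S y)) <= ra * hn (S x - g s) + hn (S y - g t).
  rewrite gu opprD addrACA -scalerBr (le_trans (hnD _ _))// hnZ.
  by rewrite hnBC (hnBC (g t)).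
have h4 := hS x s; have h5 := hS y t.
rewrite (le_trans (hnB _ (g u) _))//.
have h6 := ler_wpM2l c0 h2; have h7 := ler_wpM2l ra0 h4.
have h8 := ler_wpM2l ra0 (ltW hs); have h9 := ler_wpM2l c0 (lerD h8 (ltW ht)); lra.
Qed.

Section TensorOps.
Variables (R : realType) (K H : hilbertType R) (T : hilbertTensor K H).

Lemma alg_tens_comb (A : K -> K) (X : H -> H) : linear A ->
  forall (a : R[i]) (s t : seq (K * H)), exists u : seq (K * H),
    alg_tens T u = a *: alg_tens T s + alg_tens T t /\
    \sum_(z <- u) tens T (A z.1) (X z.2) =
      a *: (\sum_(z <- s) tens T (A z.1) (X z.2)) + \sum_(z <- t) tens T (A z.1) (X z.2).
Proof.
move=> lA a s t; exists ([seq (a *: z.1, z.2) | z <- s] ++ t).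
rewrite /alg_tens !big_cat /= !big_map /= !scaler_sumr; split; congr (_ + _).
  by apply: eq_bigr => z _; rewrite (linZ (tens_linearl T _)).
by apply: eq_bigr => z _; rewrite (linZ lA) (linZ (tens_linearl T _)).
Qed.

(** [tens_row_bound] with a single entry bounds [A (x) X] on sums of elementary
    tensors, and [dense_extension] does the rest. *)
Lemma tensopP (A : K -> K) (X : H -> H) : bounded_op A -> bounded_op X ->
  bounded_op (tensop T A X) /\
  forall x y, tensop T A X (tens T x y) = tens T (A x) (X y).
Proof.
move=> /bounded_opP[lA [M M0 hA]] /bounded_opP[lX [N N0 hX]].
suff ex : exists S : T -> T, bounded_op S /\ forall x y, S (tens T x y) = tens T (A x) (X y).
  exact: (@xgetPex _ 0 [set S : T -> T | bounded_op S /\ forall x y, S (tens T x y) = tens T (A x) (X y)]).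
have bound s : hn (\sum_(z <- s) tens T (A z.1) (X z.2)) <= (M * N) * hn (alg_tens T s).
  apply: hn_sqr_le; first by rewrite !mulr_ge0.
  have := @tens_row_bound _ _ _ T unit (fun=> A) (fun=> X) (M ^+ 2) (N ^+ 2)
    (sqr_ge0 _) (fun=> lA) (fun=> lX) _ _ s.
  have sumu (V : zmodType) (F : unit -> V) : \sum_w F w = F tt.
    by rewrite (bigD1 tt)//= big1 ?addr0// => -[].
  rewrite sumu !exprMn; apply => [x|h]; rewrite !sumu -exprMn ler_pXn2r ?nnegrE ?mulr_ge0//.
have [S [lS Sf hS]] := dense_extension (alg_tens_comb X lA) bound (@alg_tens_dense _ _ _ T).
exists S; split.
  by apply/bounded_opP; split=> //; exists (M * N); rewrite ?mulr_ge0.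
move=> x y; have := Sf [:: (x, y)].
by rewrite /alg_tens !big_seq1.
Qed.

Lemma dense_bound (S : T -> T) (c : R) : bounded_op S ->
  (forall s, hn (S (alg_tens T s)) <= c * hn (alg_tens T s)) ->
  forall x, hn (S x) <= c * hn x.
Proof.
move=> /bounded_opP[lS [d d0 hd]] h x; apply/ler_addgt0Pr => e e0.
have k0 : 0 < d + `|c| + 1 by rewrite ltr_wpDl// addr_ge0.
have [|s] := @alg_tens_dense _ _ _ T x (e / (d + `|c| + 1)); first by rewrite divr_gt0.
rewrite ltr_pdivlMr// => hs.
have h1 := hd (x - alg_tens T s); rewrite (linB lS) in h1.
have h2 := hnD (S x - S (alg_tens T s)) (S (alg_tens T s)); rewrite subrK in h2.
have h3 := h s.
have h4 : `|hn (alg_tens T s) - hn x| <= hn (x - alg_tens T s).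
  rewrite ler_norml; have := hnD (x - alg_tens T s) (alg_tens T s).
  have := hnD (alg_tens T s - x) x; rewrite !subrK (hnBC _ x); lra.
have h5 : c * (hn (alg_tens T s) - hn x) <= `|c| * hn (x - alg_tens T s).
  by rewrite (le_trans (ler_norm _))// normrM ler_wpM2l.
have := hn_ge0 (x - alg_tens T s); lra.
Qed.

(** The row-column estimate: the sum of the operators [B_w] (x) [X_w] factors as
    the row of the [b_w^(1/2) X_w] times the column of the [b_w^(-1/2) B_w]. *)
Lemma tens_sum_bound (W : finType) (b : W -> R) (B : W -> K -> K) (X : W -> H -> H) (M N : R) :
  (forall w, 0 < b w) -> 0 <= M -> 0 <= N ->
  (forall w, bounded_op (B w)) -> (forall w, bounded_op (X w)) ->
  (forall x, \sum_w (b w)^-1 * hn (B w x) ^+ 2 <= M * hn x ^+ 2) ->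
  (forall h : W -> H, hn (\sum_w (Num.sqrt (b w))%:C *: X w (h w)) ^+ 2 <=
                      N * \sum_w hn (h w) ^+ 2) ->
  opnorm (\sum_w tensop T (B w) (X w)) <= Num.sqrt (M * N).
Proof.
move=> b0 M0 N0 bB bX hB hX.
have bS : bounded_op (\sum_w tensop T (B w) (X w)).
  by apply: bounded_sum => w; case: (tensopP (bB w) (bX w)).
apply: opnorm_le; first exact: sqrtr_ge0.
apply: dense_bound => // s; apply: hn_sqr_le; first by rewrite mulr_ge0// sqrtr_ge0.
rewrite exprMn sqr_sqrtr ?mulr_ge0//.
have sb w : 0 < Num.sqrt (b w) by rewrite sqrtr_gt0.
have := @tens_row_bound _ _ _ T W (fun w => (Num.sqrt (b w))^-1%:C *: B w)
  (fun w => (Num.sqrt (b w))%:C *: X w) M N N0 _ _ _ _ s.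
rewrite (lin_sum (bounded_lin bS)).
have -> : \sum_w \sum_(z <- s)
    tens T (((Num.sqrt (b w))^-1%:C *: B w) z.1) (((Num.sqrt (b w))%:C *: X w) z.2) =
    \sum_(z <- s) (\sum_w tensop T (B w) (X w)) (tens T z.1 z.2).
  rewrite exchange_big /=; apply: eq_bigr => z _; rewrite ffunS; apply: eq_bigr => w _.
  rewrite !fctE (linZ (tens_linearl T _)) (linZ (tens_linearr T _)) scalerA -rmorphM.
  by rewrite mulVf ?gt_eqF// scale1r; case: (tensopP (bB w) (bX w)).
apply=> [w|w|x|h].
- exact: bounded_lin (bounded_scale _ (bB w)).
- exact: bounded_lin (bounded_scale _ (bX w)).
- rewrite (le_trans _ (hB x))//; apply: ler_sum => w _.
  by rewrite fctE hnZr exprMn real_normK ?num_real// exprVn sqr_sqrtr// ltW.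
- exact: hX.
Qed.

End TensorOps.

(** * The coefficients of the inverse of a positive regular polynomial *)

Lemma tupleS_sum (T : finType) (V : zmodType) p (F : seq T -> V) (P : pred (seq T)) :
  \sum_(g : p.+1.-tuple T | P g) F g =
  \sum_(x : T) \sum_(g : p.-tuple T | P (x :: g)) F (x :: g).
Proof.
rewrite pair_big_dep /=.
rewrite (reindex (fun z : T * p.-tuple T => [tuple of z.1 :: z.2])) /=; last first.
  exists (fun g => (thead g, [tuple of behead g])) => [[x g]|g] _ /=.
    by congr pair; apply/val_inj.
  by rewrite -tuple_eta.
by apply: eq_big => -[x g].
Qed.

Section Bcoef.
Variables (R : realType) (n : nat) (a : seq 'I_n -> R).

(** The contribution to [bcoef a w] of the factorizations of [w] into exactly
    [p] nonempty words, by recursion on the first factor. *)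
Fixpoint fac (p : nat) (w : seq 'I_n) : R :=
  if p is p'.+1 then \sum_(1 <= j < (size w).+1) a (take j w) * fac p' (drop j w)
  else (w == [::])%:R.

Lemma fac_gt p w : (size w < p)%N -> fac p w = 0.
Proof.
elim: p w => [//|p IH] w wp /=; rewrite big_nat big1// => j /andP[j0 jw].
by rewrite IH ?mulr0// size_drop; lia.
Qed.

(** A first factor of [w] is determined by its length. *)
Lemma bseq_prefix_sum M (w : seq 'I_n) (F : seq 'I_n -> R) : (size w <= M)%N ->
  \sum_(x : M.-bseq 'I_n | prefix x w && (0 < size x)%N) F x =
  \sum_(1 <= j < (size w).+1) F (take j w).
Proof.
move=> wM.
have tM (j : 'I_(size w)) : (size (take j.+1 w) <= M)%N.
  by rewrite (leq_trans _ wM)// size_take; case: ltnP => // /ltnW.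
rewrite big_add1 /= big_mkord.
case: (posnP (size w)) => [/size0nil ->|w0].
  rewrite big_ord0 big_pred0// => x.
  by rewrite prefixs0; case: (val x).
have [m mw] : exists m, size w = m.+1 by exists (size w).-1; rewrite prednK.
rewrite (partition_big (fun x : M.-bseq 'I_n => cast_ord (esym mw) (inord (size x).-1)) predT)//=.
apply: eq_bigr => j _; rewrite (big_pred1 (Bseq (tM j)))//= => x.
have jw := ltn_ord j.
apply/andP/eqP => [[/andP[/prefixP[t wt] x0] /eqP/(congr1 val)/=]|->/=].
  rewrite inordK => [xj|]; last by rewrite -mw wt size_cat; lia.
  apply/val_inj; rewrite /= (_ : (nat_of_ord j).+1 = size x) ?wt ?take_size_cat//.
  by rewrite -xj prednK.
split; first by rewrite prefix_take size_take_min /=; lia.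
by apply/eqP/val_inj; rewrite /= size_takel// inordK -?mw.
Qed.

(** The bound [M] on the lengths of the factors stays the same while the word
    gets shorter, which is what the induction requires. *)
Lemma facE p M w : (size w <= M)%N ->
  \sum_(g : p.-tuple (M.-bseq 'I_n) |
        (flatten [seq val v | v <- g] == w) && all (fun v => 0 < size (val v))%N g)
      \prod_(v <- g) a (val v) = fac p w.
Proof.
elim: p w => [|p IH] w wM.
  rewrite big_mkcond /= (bigD1 [tuple])//= [X in _ + X]big1 ?addr0 => [|g gn]; last by case/negP: gn; apply/eqP; exact: tuple0.
  by rewrite big_nil andbT eq_sym; case: eqVneq.
rewrite (@tupleS_sum _ _ _ (fun g : seq (M.-bseq 'I_n) => \prod_(v <- g) a (val v))
  (fun g => (flatten [seq val v | v <- g] == w) && all (fun v : M.-bseq 'I_n => 0 < size (val v))%N g)) /=.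
rewrite (bigID (fun x : M.-bseq 'I_n => prefix x w && (0 < size x)%N)) /= [X in _ + X]big1 ?addr0; last first.
  move=> x hx; rewrite big_pred0// => g; apply: contraNF hx => /andP[/eqP <- /andP[-> _]].
  by rewrite prefix_prefix.
transitivity (\sum_(1 <= j < (size w).+1)
    a (take j w) * fac p (drop (size (take j w)) w)); last first.
  by apply: eq_big_nat => j /andP[j0 jw]; rewrite size_takel.
rewrite -(@bseq_prefix_sum M w (fun x => a x * fac p (drop (size x) w)))//.
apply: eq_bigr => x /andP[/prefixP[t wt] x0].
have tM : (size t <= M)%N by move: wM; rewrite wt size_cat; lia.
rewrite wt drop_size_cat// -(IH _ tM) mulr_sumr; apply: eq_big => [g|g _].
  by rewrite x0 /= eqseq_cat// eqxx.
by rewrite big_cons.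
Qed.

Lemma bcoef_fac N w : (size w < N)%N -> bcoef a w = \sum_(p < N) fac p w.
Proof.
case: w => [|x w] wN.
  case: N wN => // N _; rewrite big_ord_recl /= big1 ?addr0// => p _.
  by rewrite big_geq.
rewrite /bcoef -(big_mkord predT (fun p => fac p (x :: w))) /=.
rewrite [RHS](big_cat_nat _ (n := (size w).+2)) //= [X in _ = _ + X]big_nat_cond [X in _ = _ + X]big1 ?addr0.
  rewrite [RHS]big_nat_recl//= add0r big_add1 /=.
  by apply: eq_bigr => p _; rewrite facE.
by move=> p /andP[/andP[wp _] _]; rewrite fac_gt.
Qed.

(** Group the factorizations of [w] by their first factor. *)
Lemma bcoef_rec w : w != [::] ->
  bcoef a w = \sum_(1 <= j < (size w).+1) a (take j w) * bcoef a (drop j w).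
Proof.
move=> w0; rewrite (@bcoef_fac (size w).+2)// big_ord_recl /= (negbTE w0) add0r.
rewrite exchange_big /=; apply: eq_big_nat => j /andP[j0 jw].
rewrite (@bcoef_fac (size w).+1); last by rewrite size_drop ltnS leq_subr.
by rewrite mulr_sumr.
Qed.

Lemma bcoef_nil : bcoef a [::] = 1. Proof. by []. Qed.

End Bcoef.

Section BcoefRegular.
Variables (R : realType) (n : nat) (a : {fsfun seq 'I_n -> R with 0}).
Hypothesis a_reg : positive_regular a.

(** The words of the support of [a] that begin [w] are nonempty, because
    [a [::] = 0], so that they correspond to the lengths from 1 on. *)
Lemma prefix_sum (w : seq 'I_n) (F : seq 'I_n -> R) :
  \sum_(u <- finsupp a | prefix u w) a u * F u =
  \sum_(1 <= j < (size w).+1) a (take j w) * F (take j w).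
Proof.
case: a_reg => a0 anil _.
pose Z := [seq take j w | j <- index_iota 0 (size w).+1].
have Zmem u : (u \in Z) = prefix u w.
  apply/mapP/prefixP => [[j]|[t ->]].
    by rewrite mem_index_iota => /andP[_ jw] ->; exists (drop j w); rewrite cat_take_drop.
  exists (size u); last by rewrite take_size_cat.
  by rewrite mem_index_iota size_cat ltnS leq0n leq_addr.
have Zu : uniq Z.
  rewrite map_inj_in_uniq ?iota_uniq// => i j; rewrite !mem_index_iota => /andP[_ iw] /andP[_ jw].
  by move=> /(congr1 size); rewrite !size_takel.
transitivity (\sum_(u <- Z) a u * F u).
  rewrite [RHS](bigID (mem (finsupp a))) /= [X in _ + X]big1 ?addr0 => [|u au]; last first.
    by rewrite fsfun_dflt ?mul0r.
  rewrite -big_filter -[RHS]big_filter; apply: perm_big; apply: uniq_perm.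
  - by rewrite filter_uniq ?fset_uniq.
  - by rewrite filter_uniq.
  - by move=> u; rewrite !mem_filter Zmem andbC.
by rewrite /Z big_map big_nat_recl// take0 anil mul0r add0r big_add1.
Qed.

Lemma bcoef_prefix w : w != [::] ->
  bcoef a w = \sum_(u <- finsupp a | prefix u w) a u * bcoef a (drop (size u) w).
Proof.
move=> w0; rewrite bcoef_rec// (@prefix_sum w (fun u => bcoef a (drop (size u) w))).
by apply: eq_big_nat => j /andP[j0 jw]; rewrite size_takel.
Qed.

Lemma bcoef_gt0 w : 0 < bcoef a w.
Proof.
case: a_reg => a0 _ a1.
have [m] := ubnP (size w); elim: m w => [//|m IH] [|x w] wm; first by rewrite ltr01.
rewrite bcoef_rec// big_ltn//= ltr_pwDl ?take0 ?drop0 ?mulr_gt0 ?IH//.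
rewrite big_nat sumr_ge0// => j /andP[j0 jw]; rewrite mulr_ge0// ltW// IH//.
by rewrite size_drop; case: j j0 jw => // j _ _; rewrite subSS (leq_ltn_trans (leq_subr _ _)).
Qed.

Lemma bcoef_cons x w : a [:: x] * bcoef a w <= bcoef a (x :: w).
Proof.
case: a_reg => a0 _ a1.
rewrite [leRHS]bcoef_rec// big_ltn//= take0 drop0 lerDl.
by rewrite sumr_ge0// => j _; rewrite mulr_ge0// ltW// bcoef_gt0.
Qed.
End BcoefRegular.

(** * Row bounds for the words in one tuple *)

Section WordOps.
Variables (R : realType) (n : nat) (H : hilbertType R).
Implicit Types (X Y : 'I_n -> H -> H).

Lemma word_nil X : word_op X [::] = idfun.
Proof. by rewrite /word_op big_nil. Qed.

Lemma word_cons X j u : word_op X (j :: u) = X j \o word_op X u.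
Proof. by rewrite /word_op big_cons. Qed.

Lemma word_cat X u v : word_op X (u ++ v) = word_op X u \o word_op X v.
Proof. by elim: u => [|j u IH]; rewrite ?word_nil// cat_cons !word_cons IH. Qed.

Lemma bounded_word X u : (forall j, bounded_op (X j)) -> bounded_op (word_op X u).
Proof.
move=> bX; elim: u => [|j u IH]; rewrite ?word_nil ?word_cons.
  exact: bounded_id.
exact: bounded_comp.
Qed.

Lemma word_scale (t : R) X u : (forall j, linear (X j)) ->
  word_op (fun j => t%:C *: X j) u = (t ^+ size u)%:C *: word_op X u.
Proof.
move=> lX; apply/funext => x; elim: u => [|j u IH]; first by rewrite !word_nil expr0 fctE scale1r.
by rewrite !word_cons /= !fctE IH (linZ (lX j)) scalerA exprS rmorphM.
Qed.

End WordOps.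

Lemma tuple_prefix_sum (T : finType) (V : zmodType) p (F : seq T -> V) (u : seq T) :
  (size u <= p)%N ->
  \sum_(w : p.-tuple T | prefix u w) F w = \sum_(v : (p - size u).-tuple T) F (u ++ v).
Proof.
elim: u p F => [|x u IH] p F up; first by rewrite subn0; apply: eq_bigl => w; rewrite prefix0s.
case: p up => [//|p] up.
rewrite (@tupleS_sum _ _ _ F (prefix (x :: u))) (bigD1 x)//= [X in _ + X]big1 ?addr0; last first.
  by move=> y yx; rewrite big_pred0// => g; rewrite eq_sym (negbTE yx).
rewrite -(IH p (fun v => F (x :: v)))//; apply: eq_bigl => g; by rewrite eqxx.
Qed.

Section Rows.
Variables (R : realType) (n : nat) (H : hilbertType R).
Variable a : {fsfun seq 'I_n -> R with 0}.
Hypothesis a_reg : positive_regular a.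
Variable X : 'I_n -> H -> H.
Hypothesis X_lin : forall u, linear (word_op X u).

(** [Phi a X 1 <= rho], stated as a bound for the row operator with entries
    [a_u^(1/2) X_u]; this form involves no adjoint and passes to limits. *)
Definition row_bound (rho : R) := forall h : seq 'I_n -> H,
  hn (\sum_(u <- finsupp a) (Num.sqrt (a u))%:C *: word_op X u (h u)) ^+ 2 <=
  rho * \sum_(u <- finsupp a) hn (h u) ^+ 2.

(** The recursion for the coefficients [b] says that the map
    [Psi_p(Y) = sum_(|w| = p) b_w X_w Y X_w^*] is the sum over the words [u] of
    the support of [a_u X_u Psi_(p - |u|)(Y) X_u^*]. Since [|u| <= N], induction
    gives [Psi_p(1) <= tau^(p - N) Phi(1) <= tau^p], here in the form of a bound
    for rows. *)
Lemma word_row (rho tau : R) N : row_bound rho -> 0 <= rho -> 0 < tau -> tau <= 1 ->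
  (forall u, u \in finsupp a -> (size u <= N)%N) -> rho <= tau ^+ N ->
  forall p (h : seq 'I_n -> H),
  hn (\sum_(w : p.-tuple 'I_n) (Num.sqrt (bcoef a w))%:C *: word_op X w (h w)) ^+ 2 <=
  tau ^+ p * \sum_(w : p.-tuple 'I_n) hn (h w) ^+ 2.
Proof.
move=> rb rho0 tau0 tau1 aN rhotau p.
have bpos := bcoef_gt0 a_reg; have [a0 anil _] := a_reg.
have [m] := ubnP p; elim: m p => [//|m IH] p pm h.
have [->|p0] := posnP p.
  rewrite expr0 mul1r; pose t0 : 0.-tuple 'I_n := [tuple].
  rewrite (bigD1 t0)//= [X in _ + X]big1 ?addr0 => [|w /eqP[]]; last exact: tuple0.
  rewrite [leRHS](bigD1 t0)//= [X in _ <= _ + X]big1 ?addr0 => [|w /eqP[]]; last exact: tuple0.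
  by rewrite sqrtr1 scale1r word_nil.
(* the entry [h w] is split over the prefixes [u] of [w], with the weights
   [a_u b_v / b_(uv)], whose sum is 1 *)
pose k u v := (Num.sqrt (a u * bcoef a v / bcoef a (u ++ v)))%:C *: h (u ++ v).
pose G u := if (size u <= p)%N then
  \sum_(v : (p - size u).-tuple 'I_n) (Num.sqrt (bcoef a v))%:C *: word_op X v (k u v) else 0.
have wn (w : p.-tuple 'I_n) : tval w != [::].
  by rewrite -size_eq0 size_tuple -lt0n.
have -> : \sum_(w : p.-tuple 'I_n) (Num.sqrt (bcoef a w))%:C *: word_op X w (h w) =
   \sum_(u <- finsupp a) (Num.sqrt (a u))%:C *: word_op X u (G u).
  have step (w : p.-tuple 'I_n) : (Num.sqrt (bcoef a w))%:C *: word_op X w (h w) =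
      \sum_(u <- finsupp a | prefix u w)
        ((Num.sqrt (bcoef a w))^-1 * (a u * bcoef a (drop (size u) w)))%:C *: word_op X w (h w).
    rewrite -scaler_suml -rmorph_sum -mulr_sumr -bcoef_prefix//.
    have sw : Num.sqrt (bcoef a w) != 0 by rewrite gt_eqF// sqrtr_gt0.
    congr (_%:C *: _); apply: (mulfI sw).
    by rewrite mulrA divff// mul1r -expr2 sqr_sqrtr// ltW.
  under eq_bigr do rewrite step.
  rewrite (exchange_big_dep predT)//= big_seq [RHS]big_seq; apply: eq_bigr => u ua.
  rewrite /G; case: ifP => up; last first.
    rewrite big_pred0 ?(lin0 (@X_lin _)) ?scaler0// => w.
    by apply/negP => /size_prefix; rewrite size_tuple up.
  rewrite (tuple_prefix_sum (fun w => ((Num.sqrt (bcoef a w))^-1 * (a u * bcoef a (drop (size u) w)))%:C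
     *: word_op X w (h w)) up).
  rewrite (lin_sum (@X_lin _)) scaler_sumr; apply: eq_bigr => v _.
  rewrite drop_size_cat// /k (linZ (@X_lin _)) (linZ (@X_lin _)) (linZ (@X_lin _)) word_cat /=.
  rewrite !scalerA -!rmorphM /=; congr (_%:C *: _).
  rewrite sqrtrM ?mulr_ge0// ?ltW// sqrtrM// sqrtrV ?ltW//.
  have sa : Num.sqrt (a u) * Num.sqrt (a u) = a u by rewrite -expr2 sqr_sqrtr.
  have sb : Num.sqrt (bcoef a v) * Num.sqrt (bcoef a v) = bcoef a v by rewrite -expr2 sqr_sqrtr// ltW.
  by rewrite -{1}sa -{1}sb; ring.
rewrite (le_trans (rb G))//.
have Gle u : u \in finsupp a -> rho * hn (G u) ^+ 2 <=
    tau ^+ p * \sum_(w : p.-tuple 'I_n | prefix u w) (a u * bcoef a (drop (size u) w) / bcoef a w) * hn (h w) ^+ 2.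
  move=> ua; have un : u != [::] by apply: contraTneq ua => ->; rewrite memNfinsupp anil.
  have sumge0 : 0 <= \sum_(w : p.-tuple 'I_n | prefix u w)
      (a u * bcoef a (drop (size u) w) / bcoef a w) * hn (h w) ^+ 2.
    by apply: sumr_ge0 => w _; rewrite mulr_ge0 ?sqr_ge0// divr_ge0 ?mulr_ge0// ltW.
  rewrite /G; case: ifP => up; last first.
    by rewrite hn0 expr0n/= mulr0 mulr_ge0// exprn_ge0// ltW.
  have u0 : (0 < size u)%N by rewrite lt0n size_eq0.
  have hIH := IH (p - size u)%N _ (k u); rewrite (le_trans (ler_wpM2l rho0 (hIH _)))//; first by lia.
  rewrite (tuple_prefix_sum (fun w => (a u * bcoef a (drop (size u) w) / bcoef a w) * hn (h w) ^+ 2) up).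
  rewrite mulrA ler_pM//.
  - by rewrite mulr_ge0// exprn_ge0// ltW.
  - by apply: sumr_ge0 => v _; exact: sqr_ge0.
  - have -> : tau ^+ p = tau ^+ size u * tau ^+ (p - size u) by rewrite -exprD subnKC.
    rewrite ler_wpM2r ?exprn_ge0 ?(ltW tau0)// (le_trans rhotau)//.
    by rewrite ler_wiXn2l ?aN// ltW.
  - apply: ler_sum => v _; rewrite /k hnZr exprMn real_normK ?num_real// drop_size_cat//.
    by rewrite sqr_sqrtr// divr_ge0 ?mulr_ge0// ltW.
rewrite mulr_sumr big_seq.
apply: le_trans; first by apply: ler_sum => u ua; exact: (Gle u ua).
rewrite -big_seq -mulr_sumr.
rewrite ler_wpM2l ?exprn_ge0 ?(ltW tau0)//.
rewrite (exchange_big_dep predT)//=; apply: ler_sum => w _.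
rewrite -mulr_suml -mulr_suml -bcoef_prefix// divff ?mul1r//.
by rewrite gt_eqF.
Qed.

End Rows.

(** * Sums over finite subsets *)

#[export] Existing Instance totally_filter.

Section PartialSums.
Variables (R : realType) (I : choiceType).
Implicit Types (u v c : I -> R) (J : {fset I}).

Lemma psumE (V : zmodType) (w : I -> V) J : partial_sum w J = \sum_(i <- J) w i.
Proof. by rewrite /partial_sum big_seq_fsetE. Qed.

Lemma psumD (V : zmodType) (w w' : I -> V) J :
  partial_sum (fun i => w i + w' i) J = partial_sum w J + partial_sum w' J.
Proof. by rewrite /partial_sum big_split. Qed.

Lemma psumN (V : zmodType) (w : I -> V) J :
  partial_sum (fun i => - w i) J = - partial_sum w J.
Proof. by rewrite /partial_sum sumrN. Qed.

Lemma psum1 (V : zmodType) (w : I -> V) i : partial_sum w [fset i]%fset = w i.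
Proof. by rewrite psumE big_seq_fset1. Qed.

Lemma psumU1 (V : zmodType) (w : I -> V) i J : i \notin J ->
  partial_sum w (i |` J)%fset = w i + partial_sum w J.
Proof. by move=> iJ; rewrite !psumE big_fsetU1. Qed.

Lemma psum_le u v J : (forall i, u i <= v i) -> partial_sum u J <= partial_sum v J.
Proof. by move=> h; rewrite /partial_sum ler_sum. Qed.

Lemma psum_ge0 u J : (forall i, 0 <= u i) -> 0 <= partial_sum u J.
Proof. by move=> h; rewrite /partial_sum sumr_ge0. Qed.

Lemma psum_subset u J J' : (forall i, 0 <= u i) -> (J `<=` J')%fset ->
  partial_sum u J <= partial_sum u J'.
Proof.
move=> u0 JJ'; rewrite !psumE.
have -> : \sum_(i <- J) u i = \sum_(i <- J) (if i \in J then u i else 0).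
  by rewrite big_seq [RHS]big_seq; apply: eq_bigr => i ->.
rewrite (big_fset_incl _ JJ') => [|i _ /negbTE->//].
by apply: ler_sum => i _; case: ifP.
Qed.

Lemma totally_ge J : \forall J' \near @totally I, (J `<=` J')%fset.
Proof. by exists J. Qed.

(** For bounded nonnegative families this is the limit along [totally]
    ([possum_cvg]). *)
Definition possum u : R := sup (range (partial_sum u)).

Definition summable_le u M := forall J, partial_sum u J <= M.

Lemma possum_has_sup u M : summable_le u M -> has_sup (range (partial_sum u)).
Proof.
by move=> h; split; [exists (partial_sum u fset0); exists fset0|exists M => _ [J _ <-]].
Qed.

Lemma possum_le u M : summable_le u M -> possum u <= M.
Proof.
move=> h; apply: ge_sup; first by case: (possum_has_sup h).
by move=> _ [J _ <-].
Qed.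

Lemma possum_ge u M J : summable_le u M -> partial_sum u J <= possum u.
Proof.
by move=> h; apply: ub_le_sup; [case: (possum_has_sup h)|exists J].
Qed.

Lemma possum_adh u M (e : R) : summable_le u M -> 0 < e ->
  exists J, possum u - e < partial_sum u J.
Proof.
by move=> h e0; have [_ [J _ <-]] := sup_adherent e0 (possum_has_sup h); exists J.
Qed.

Lemma possum_ge0 u : (forall i, 0 <= u i) -> 0 <= possum u.
Proof.
move=> u0; have [hs|nhs] := pselect (has_sup (range (partial_sum u))); last by rewrite /possum sup_out.
rewrite (le_trans (psum_ge0 fset0 u0))//; apply: ub_le_sup; first by case: hs.
by exists fset0.
Qed.

Lemma possum_cvg u M : (forall i, 0 <= u i) -> summable_le u M ->
  partial_sum u @ totally --> possum u.
Proof.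
move=> u0 h; apply/cvgrPdist_lt => e e0; have [J hJ] := possum_adh h e0.
near=> J'; have JJ' : (J `<=` J')%fset by near: J'; exact: totally_ge.
have h1 := psum_subset u0 JJ'; have h2 := possum_ge J' h.
by rewrite ger0_norm; lra.
Unshelve. all: by end_near. Qed.

(** The Weierstrass test: the tail of the sum of [u x] is below that of [c],
    because the partial sums of the nonnegative family [c - u x] increase. *)
Lemma uniform_psum (X : choiceType) (D : set X) (u : X -> I -> R) c M :
  (forall x i, D x -> 0 <= u x i <= c i) -> summable_le c M ->
  {uniform D, (fun J x => partial_sum (u x) J) @ totally --> (fun x => possum (u x))}.
Proof.
move=> uc hc; have hu x : D x -> summable_le (u x) M.
  by move=> Dx J; apply: le_trans (hc J); apply: psum_le => i; case/andP: (uc x i Dx).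
move=> P /uniform_nbhs[E [entE EP]].
have [e /= e0 eE] : exists2 e : R, 0 < e & forall a b, `|a - b| < e -> E (a, b).
  move: entE; rewrite -entourage_ballE => -[e /= e0 he]; exists e => // a b ab.
  exact: he.
have e20 : 0 < e / 2 by rewrite divr_gt0.
have [J0 hJ0] := possum_adh hc e20.
exists J0 => // J /= J0J; apply: EP => x Dx; apply: eE.
have ux0 i : 0 <= u x i by case/andP: (uc x i Dx).
have h1 := possum_ge J (hu x Dx).
suff h2 : possum (u x) <= partial_sum (u x) J + e / 2 by rewrite ger0_norm; lra.
apply: ge_sup; first by case: (possum_has_sup (hu x Dx)).
move=> _ [J' _ <-].
have JJ' : (J `<=` J `|` J')%fset by rewrite fsubsetUl.
have h3 := psum_subset ux0 (fsubsetUr J J').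
have cu0 i : 0 <= c i - u x i by rewrite subr_ge0; case/andP: (uc x i Dx).
have := psum_subset cu0 JJ'; rewrite !psumD !psumN => h4.
have c0 i : 0 <= c i by case/andP: (uc x i Dx) => a b; apply: le_trans b.
have h5 := psum_subset c0 J0J; have h6 := possum_ge (J `|` J')%fset hc.
by lra.
Qed.

Lemma cvg_psum_bounded u : (forall i, 0 <= u i) -> cvg (partial_sum u @ totally) ->
  exists M, forall i, u i <= M.
Proof.
move=> u0 /cvgrPdist_lt h; have [J _ hJ] := h 1 ltr01.
set l := lim _ in hJ.
exists (2 + partial_sum u J) => i.
have [iJ|iJ] := boolP (i \in J).
  have := @psum_subset u [fset i]%fset J u0; rewrite fsub1set psum1 => /(_ iJ); lra.
have := hJ J (fsubset_refl _); have := hJ (i |` J)%fset (fsubsetUr _ _).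
rewrite /= psumU1// !ltr_norml; have := psum_ge0 J u0; lra.
Qed.

End PartialSums.

(** A finite set of exponents lies in a cube, over which the sum is a product of
    geometric sums. *)
Lemma summable_geom (R : realType) k (x : 'I_k -> R) : (forall i, 0 <= x i < 1) ->
  summable_le (fun p : {ffun 'I_k -> nat} => \prod_i x i ^+ p i) (\prod_i (1 - x i)^-1).
Proof.
move=> x01 J.
have x0 i : 0 <= x i by case/andP: (x01 i).
pose m := (\max_(p : J) \max_i (val p : {ffun 'I_k -> nat}) i).+1.
have pm (p : {ffun 'I_k -> nat}) i : p \in J -> (p i < m)%N.
  move=> pJ; rewrite ltnS; apply: leq_trans (leq_bigmax (FSetSub pJ)) => /=.
  exact: (@leq_bigmax _ (fun i => p i)).
pose f_ (f : {ffun 'I_k -> 'I_m}) : {ffun 'I_k -> nat} := [ffun i => val (f i)].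
pose s := [seq f_ f | f <- enum {ffun 'I_k -> 'I_m}].
have su : uniq s.
  rewrite map_inj_uniq ?enum_uniq// => f g /ffunP fg.
  by apply/ffunP => i; apply/val_inj; have := fg i; rewrite !ffunE.
have JB : (J `<=` seq_fset tt s)%fset.
  apply/fsubsetP => p pJ; rewrite seq_fsetE; apply/mapP.
  exists [ffun i => Ordinal (pm p i pJ)]; first by rewrite mem_enum.
  by apply/ffunP => i; rewrite !ffunE.
rewrite (le_trans (psum_subset _ JB))//; first by move=> p; rewrite prodr_ge0// => i _; rewrite exprn_ge0.
rewrite psumE (perm_big _ (seq_fset_perm tt s)) undup_id// big_map big_enum /=.
under eq_bigr do under eq_bigr do rewrite ffunE.
rewrite -(bigA_distr_bigA (fun i (j : 'I_m) => x i ^+ j)).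
apply: ler_prod => i _; apply/andP; split; first by apply: sumr_ge0 => j _; rewrite exprn_ge0.
have x1 : 0 < 1 - x i by rewrite subr_gt0; case/andP: (x01 i).
rewrite -(ler_pM2l x1) divff ?gt_eqF//.
have -> : (1 - x i) * (\sum_(j < m) x i ^+ j) = 1 - x i ^+ m.
  rewrite -{2}(expr1n _ m) subrXX; congr (_ * _); apply: eq_bigr => j _.
  by rewrite expr1n mul1r.
by rewrite gerBl exprn_ge0.
Qed.

(** * From positivity of the defect operators to row bounds *)

Lemma cs_sum (R : realType) (H : hilbertType R) (I : eqType) (s : seq I) (f g : I -> H) :
  (\sum_(i <- s) rdot (f i) (g i)) ^+ 2 <=
  (\sum_(i <- s) hn (f i) ^+ 2) * (\sum_(i <- s) hn (g i) ^+ 2).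
Proof.
apply: quad_discr => t.
have -> : \sum_(i <- s) hn (f i) ^+ 2 + 2 * (\sum_(i <- s) rdot (f i) (g i)) * t +
   (\sum_(i <- s) hn (g i) ^+ 2) * t ^+ 2 = \sum_(i <- s) hn (f i + t%:C *: g i) ^+ 2.
  rewrite mulr_sumr !mulr_suml -!big_split /=; apply: eq_bigr => i _.
  by rewrite hn2D rdotZr hnZr exprMn real_normK ?num_real//; ring.
by apply: sumr_ge0 => i _; exact: sqr_ge0.
Qed.

Section Delta.
Variables (R : realType) (k : nat) (n : 'I_k -> nat).
Variable q : forall i, {fsfun seq 'I_(n i) -> R with 0}.
Hypothesis q_reg : forall i, positive_regular (q i).
Variable H : hilbertType R.
Variable X : optuple n H.
Arguments X : clear implicits.
Hypothesis X_bdd : forall i j, bounded_op (X i j).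

Let Wb i u : bounded_op (word_op (X i) u).
Proof. exact: bounded_word. Qed.

Lemma PhiE i (Y : H -> H) x : Phi (q i) (X i) Y x =
  \sum_(u <- finsupp (q i)) (q i u)%:C *: word_op (X i) u (Y (adj (word_op (X i) u) x)).
Proof. by rewrite /Phi ffunS; apply: eq_bigr. Qed.

Lemma rdot_Phi i (Y : H -> H) x : rdot (Phi (q i) (X i) Y x) x =
  \sum_(u <- finsupp (q i)) q i u * rdot (Y (adj (word_op (X i) u) x)) (adj (word_op (X i) u) x).
Proof.
rewrite PhiE rdot_suml; apply: eq_bigr => u _.
by rewrite rdotZl rdot_adj.
Qed.

Lemma PhiB i (Y Z : H -> H) : Phi (q i) (X i) (Y - Z) = Phi (q i) (X i) Y - Phi (q i) (X i) Z.
Proof.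
apply/funext => x; rewrite !fctE !PhiE -sumrB; apply: eq_bigr => u _.
by rewrite (linB (bounded_lin (Wb u))) scalerBr.
Qed.

Hypothesis X_comm : forall s t, s != t -> forall j l, X s j \o X t l = X t l \o X s j.

Lemma word_comm s t : s != t -> forall u v,
  word_op (X s) u \o word_op (X t) v = word_op (X t) v \o word_op (X s) u.
Proof.
move=> st u v; elim: u => [|j u IH]; first by rewrite !word_nil.
have hj : X s j \o word_op (X t) v = word_op (X t) v \o X s j.
  elim: v {IH} => [|l v IH]; first by rewrite !word_nil.
  by rewrite !word_cons compA (X_comm st) -compA IH compA.
by rewrite !word_cons -compA IH compA hj compA.
Qed.

Lemma Phi_comm s t (Y : H -> H) : s != t ->
  Phi (q s) (X s) (Phi (q t) (X t) Y) = Phi (q t) (X t) (Phi (q s) (X s) Y).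
Proof.
move=> st; apply/funext => x; rewrite !PhiE.
under eq_bigr => u _ do rewrite PhiE (lin_sum (bounded_lin (Wb u))) scaler_sumr.
under [RHS]eq_bigr => u _ do rewrite PhiE (lin_sum (bounded_lin (Wb u))) scaler_sumr.
rewrite exchange_big /=; apply: eq_bigr => v _; apply: eq_bigr => u _.
rewrite (linZ (bounded_lin (Wb u))) (linZ (bounded_lin (Wb v))) !scalerA mulrC.
have h : adj (word_op (X t) v) (adj (word_op (X s) u) x) =
         adj (word_op (X s) u) (adj (word_op (X t) v) x).
  transitivity ((adj (word_op (X t) v) \o adj (word_op (X s) u)) x) => //.
  by rewrite -adj_comp// word_comm// adj_comp.
rewrite h; congr (_ *: _).
set y := Y _.
transitivity ((word_op (X s) u \o word_op (X t) v) y) => //.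
by rewrite word_comm.
Qed.

Let F i (S : H -> H) := S - Phi (q i) (X i) S.

(** [Delta] composes its factors in a fixed order. That they commute allows any
    of them to come first. *)
Lemma Delta_step_comm s t Y : F s (F t Y) = F t (F s Y).
Proof.
have [->//|st] := eqVneq s t.
rewrite /F !PhiB Phi_comm// !opprB addrACA [RHS]addrACA; congr (_ + _); exact: addrC.
Qed.

Lemma comp_big_step (V : Type) (I : eqType) (G : I -> V -> V) (s : seq I) i (p : I -> bool) Y :
  (forall a b Z, G a (G b Z) = G b (G a Z)) -> uniq s -> i \in s -> p i ->
  (\big[comp/idfun]_(j <- s) iter (p j) (G j)) Y =
  G i ((\big[comp/idfun]_(j <- s) iter (p j && (j != i)) (G j)) Y).
Proof.
move=> Gc; elim: s => [//|j s IH] /= /andP[js us]; rewrite !big_cons inE.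
have [ij _ pi|ij /= si pi] := eqVneq i j.
  rewrite -ij in js *; rewrite pi /=; congr (G i _); congr (_ Y).
  rewrite big_seq [in RHS]big_seq.
  by apply: eq_bigr => l ls; rewrite (_ : l != i) ?andbT//; apply: contraNneq js => <-.
rewrite IH// andbT; case: (p j) => //=.
Qed.

Lemma Delta_step i (p : 'I_k -> bool) : p i ->
  Delta q p X idfun = F i (Delta q (fun j => p j && (j != i)) X idfun).
Proof.
move=> pi; rewrite /Delta.
by apply: comp_big_step => //; [exact: Delta_step_comm|rewrite index_enum_uniq].
Qed.

Hypothesis X_pos : forall p, op_ge0 (Delta q p X idfun).

Lemma op_ge0_rdot (D : H -> H) x : op_ge0 D -> 0 <= rdot (D x) x.
Proof. by move=> /(_ x); rewrite lecE => /andP[]. Qed.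

(** Where [p i] holds, [Delta p = D - Phi_i(D)] for the operator [D >= 0] obtained
    by leaving out the index [i]. *)
Lemma rdot_Delta_step i (p : pred 'I_k) (x : H) : p i ->
  rdot (Delta q p X idfun x) x <= rdot (Delta q (fun j => p j && (j != i)) X idfun x) x.
Proof.
move=> pi; rewrite (Delta_step pi) /F !fctE rdotDl rdotNl gerBl rdot_Phi.
have [q0 _ _] := q_reg i.
by apply: sumr_ge0 => u _; rewrite mulr_ge0// op_ge0_rdot.
Qed.

Lemma rdot_Delta_true (p : pred 'I_k) (x : H) :
  rdot (Delta q (fun=> true) X idfun x) x <= rdot (Delta q p X idfun x) x.
Proof.
suff h (s : seq 'I_k) : rdot (Delta q (fun j => p j || (j \in s)) X idfun x) x <= rdot (Delta q p X idfun x) x.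
  apply: le_trans (h (enum 'I_k)); rewrite le_eqVlt; apply/orP; left; apply/eqP.
  congr (rdot (Delta q _ X idfun x) x); apply/funext => j.
  by rewrite mem_enum orbT.
elim: s => [|i s IH].
  rewrite le_eqVlt; apply/orP; left; apply/eqP.
  by congr (rdot (Delta q _ X idfun x) x); apply/funext => j; rewrite orbF.
apply: le_trans IH; have [pi|pi] := boolP (p i || (i \in s)).
  rewrite le_eqVlt; apply/orP; left; apply/eqP.
  congr (rdot (Delta q _ X idfun x) x); apply/funext => j.
  by rewrite inE; case: eqVneq => //= ->; rewrite pi orbT.
have := @rdot_Delta_step i (fun j => p j || (j \in i :: s)) x; rewrite inE eqxx orbT => /(_ isT).
congr (_ <= rdot (Delta q _ X idfun x) x); apply/funext => j; rewrite inE.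
by have [->|ji] := eqVneq j i; rewrite ?andbT// andbF (negbTE pi).
Qed.

(** [1 - Phi_i(1)] dominates the full defect, since removing the other factors
    [id - Phi_j] only increases the quadratic form. A column bound for the
    [a_u^(1/2) X_u^*] is then the same as a row bound for the [a_u^(1/2) X_u]. *)
Lemma row_bound_Delta i (rho : R) : 0 <= rho ->
  (forall x, (1 - rho) * hn x ^+ 2 <= rdot (Delta q (fun=> true) X idfun x) x) ->
  row_bound (q i) (X i) rho.
Proof.
move=> rho0 hlow; have [q0 _ _] := q_reg i.
have hcol x : \sum_(u <- finsupp (q i)) q i u * hn (adj (word_op (X i) u) x) ^+ 2 <= rho * hn x ^+ 2.
  have := le_trans (hlow x) (@rdot_Delta_true (fun j => j == i) x).
  rewrite (@Delta_step i)//.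
  have -> : Delta q (fun j => (j == i) && (j != i)) X idfun = idfun.
    rewrite /Delta (eq_bigr (fun=> idfun)) => [|j _]; last by rewrite andbN.
    by elim/big_rec : _ => // j G _ ->.
  rewrite /F !fctE rdotDl rdotNl rdotxx rdot_Phi.
  under eq_bigr do rewrite rdotxx.
  by set S := \sum_(_ <- _) _; lra.
move=> h; set v := \sum_(u <- _) _; set S := \sum_(u <- _) _.
have S0 : 0 <= S by apply: sumr_ge0 => u _; exact: sqr_ge0.
pose g u := (Num.sqrt (q i u))%:C *: adj (word_op (X i) u) v.
have vv : hn v ^+ 2 = \sum_(u <- finsupp (q i)) rdot (h u) (g u).
  rewrite -rdotxx {1}/v rdot_suml; apply: eq_bigr => u _.
  by rewrite rdotZl rdot_adj// rdotZr.
have := cs_sum (finsupp (q i)) h g; rewrite -vv -/S.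
have -> : \sum_(u <- finsupp (q i)) hn (g u) ^+ 2 =
  \sum_(u <- finsupp (q i)) q i u * hn (adj (word_op (X i) u) v) ^+ 2.
  by apply: eq_bigr => u _; rewrite hnZr exprMn real_normK ?num_real// sqr_sqrtr.
move=> h1; have h2 := hcol v.
have [v0|v0] := eqVneq (hn v ^+ 2) 0; first by rewrite v0 mulr_ge0.
have vp : 0 < hn v ^+ 2 by rewrite lt_def v0 sqr_ge0.
rewrite -(ler_pM2l vp) -expr2 (le_trans h1)//.
have h3 := ler_wpM2l S0 h2; rewrite (le_trans h3)// le_eqVlt; apply/orP; left; apply/eqP; ring.
Qed.

End Delta.

Section DomainRows.
Variables (R : realType) (k : nat) (n : 'I_k -> nat).
Variable q : forall i, {fsfun seq 'I_(n i) -> R with 0}.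
Hypothesis q_reg : forall i, positive_regular (q i).
Variable H : hilbertType R.

Lemma Dminus_row (X : optuple n H) i : Dminus q H X -> row_bound (q i) (X i) 1.
Proof.
move=> [[bX cX] pX]; apply: row_bound_Delta => // x.
by rewrite subrr mul0r op_ge0_rdot.
Qed.

(** Invertibility of the defect keeps it above some [c > 0], hence
    [Phi_i(1) <= 1 - c]. The maximum with 0 covers [c > 1], which can occur on
    the zero space only. *)
Lemma Dopen_row (X : optuple n H) i : Dopen q H X ->
  exists2 rho, 0 <= rho < 1 & row_bound (q i) (X i) rho.
Proof.
move=> [[[bX cX] pX] /op_gt0_lower[c c0 hc]].
exists (Num.max 0 (1 - c)); first by rewrite le_max lexx gt_max ltr01 gtrBl.
apply: row_bound_Delta => // [|x]; first by rewrite le_max lexx.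
apply: le_trans (hc x); rewrite ler_wpM2r ?sqr_ge0//.
have : 1 - c <= Num.max 0 (1 - c) by rewrite le_max lexx orbT.
lra.
Qed.

(** Continuity, in the norm of tuples, of the maps [X |-> X_u x]. *)
Let cont i (X : 'I_(n i) -> H -> H) (f : ('I_(n i) -> H -> H) -> H) :=
  forall d : R, 0 < d -> exists2 e : R, 0 < e & forall Y : 'I_(n i) -> H -> H,
    (forall j, bounded_op (Y j)) -> (forall j, opnorm (X j - Y j) < e) -> hn (f X - f Y) < d.

Lemma cont_word i (X : 'I_(n i) -> H -> H) u x : (forall j, bounded_op (X j)) ->
  cont X (fun Y => word_op Y u x).
Proof.
move=> bX; elim: u => [|j u IH] d d0.
  by exists 1 => // Y _ _; rewrite !word_nil subrr hn0.
set z := word_op X u x; set M := opnorm (X j) + 1.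
have M0 : 0 < M by rewrite ltr_wpDl// opnorm_ge0.
have [e e0 he] := IH (d / 2 / M) ltac:(by rewrite !divr_gt0).
have z1 : 0 < hn z + 1 by rewrite ltr_wpDl.
exists (Num.min e (Num.min 1 (d / 2 / (hn z + 1)))).
  by rewrite !lt_min e0 ltr01 !divr_gt0.
move=> Y bY hY; rewrite !word_cons /= -/z; set y := word_op Y u x.
have h1 : hn (z - y) < d / 2 / M.
  by apply: he => // l; move: (hY l); rewrite lt_min => /andP[].
move: (hY j); rewrite !lt_min => /and3P[_ h2 h3].
have bXY : bounded_op (X j - Y j) by apply: bounded_add => //; exact: bounded_opp.
have -> : X j z - Y j y = (X j - Y j) z + Y j (z - y).
  by rewrite (linB (bounded_lin (bY j))) !fctE addrA subrK.
have h4 := opnormP z bXY; have h5 := opnormP (z - y) (bY j).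
have h6 : opnorm (Y j) <= M.
  have -> : Y j = X j - (X j - Y j) by rewrite opprB addrC subrK.
  rewrite (le_trans (opnormD _ _))//; first exact: bounded_opp.
  by rewrite opnormN lerD2l ltW.
have h7 : opnorm (X j - Y j) * hn z <= d / 2.
  move: h3; rewrite ltr_pdivlMr//; have := opnorm_ge0 bXY; have := hn_ge0 z; nra.
have h8 : opnorm (Y j) * hn (z - y) < d / 2.
  move: h1; rewrite ltr_pdivlMr//; have := hn_ge0 (z - y); nra.
by rewrite (le_lt_trans (hnD _ _))//; lra.
Qed.

(** For fixed entries [h], the row depends continuously on the tuple, as it
    involves only finitely many words. *)
Lemma closure_row (X : optuple n H) i : opclosure (Dopen q H) X -> row_bound (q i) (X i) 1.
Proof.
move=> [bX hX] h; rewrite mul1r.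
set S := \sum_(u <- _) hn _ ^+ 2.
have S0 : 0 <= S by apply: sumr_ge0 => u _; exact: sqr_ge0.
pose L s (Y : 'I_(n i) -> H -> H) := \sum_(u <- s) (Num.sqrt (q i u))%:C *: word_op Y u (h u).
have cL s : cont (X i) (L s).
  elim: s => [|u s IH] d d0; first by exists 1 => // Y _ _; rewrite /L !big_nil subrr hn0.
  set c := Num.sqrt (q i u); have c0 : 0 <= c by exact: sqrtr_ge0.
  have c1 : 0 < c + 1 by rewrite ltr_wpDl.
  have [e1 e10 he1] := IH (d / 2) ltac:(by rewrite divr_gt0).
  have [e2 e20 he2] := cont_word u (h u) (bX i) (ltac:(by rewrite !divr_gt0) : 0 < d / 2 / (c + 1)).
  exists (Num.min e1 e2) => [|Y bY hY]; first by rewrite lt_min e10.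
  have h1 : hn (L s (X i) - L s Y) < d / 2 by apply: he1 => // j; move: (hY j); rewrite lt_min => /andP[].
  have h2 : hn (word_op (X i) u (h u) - word_op Y u (h u)) < d / 2 / (c + 1).
    by apply: he2 => // j; move: (hY j); rewrite lt_min => /andP[].
  rewrite /L !big_cons -/(L s _) -/(L s _) opprD addrACA -scalerBr -/c.
  rewrite (le_lt_trans (hnD _ _))// hnZr ger0_norm//.
  move: h2; rewrite ltr_pdivlMr//; have := hn_ge0 (word_op (X i) u (h u) - word_op Y u (h u)); nra.
suff hL : hn (L (finsupp (q i)) (X i)) <= Num.sqrt S.
  by rewrite -[leRHS]sqr_sqrtr// ler_pXn2r ?nnegrE ?sqrtr_ge0.
apply/ler_addgt0Pr => d d0.
have [e e0 he] := cL (finsupp (q i)) d d0.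
have [Y DY hY] := hX e e0.
have bY : forall i j, bounded_op (Y i j) by case: DY => -[[bY _] _] _.
have h1 : hn (L (finsupp (q i)) (X i) - L (finsupp (q i)) (Y i)) < d by apply: he.
have h2 : hn (L (finsupp (q i)) (Y i)) <= Num.sqrt S.
  apply: hn_sqr_le; first exact: sqrtr_ge0.
  by rewrite sqr_sqrtr//; have := @Dminus_row Y i DY.1 h; rewrite mul1r.
have := hnD (L (finsupp (q i)) (X i) - L (finsupp (q i)) (Y i)) (L (finsupp (q i)) (Y i)).
by rewrite subrK; lra.
Qed.

End DomainRows.

(** * Row bounds for several commuting tuples *)

Section Updates.
Variables (I : finType) (T : I -> eqType).
Implicit Types v : {dffun forall i, T i}.

Definition upd v i (x : T i) : {dffun forall i, T i} := finfun (eqtype.dfwith v x).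

Lemma updE v i (x : T i) : upd v x i = x.
Proof. by rewrite /upd ffunE eqtype.dfwith_in. Qed.

Lemma updN v i (x : T i) j : i != j -> upd v x j = v j.
Proof. by move=> ij; rewrite /upd ffunE eqtype.dfwith_out. Qed.

Lemma upd_upd v i (x y : T i) : upd (upd v x) y = upd v y.
Proof.
apply/ffunP => j; have [<-|ij] := eqVneq i j; first by rewrite !updE.
by rewrite !updN.
Qed.

Lemma upd_id v i : upd v (v i) = v.
Proof.
apply/ffunP => j; have [<-|ij] := eqVneq i j; first by rewrite !updE.
by rewrite !updN.
Qed.

Lemma upd_comm v s t (x : T s) (y : T t) : s != t ->
  upd (upd v x) y = upd (upd v y) x.
Proof.
move=> st; apply/ffunP => j; have [<-|sj] := eqVneq s j.
  by rewrite updE updN 1?eq_sym// updE.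
have [<-|tj] := eqVneq t j; first by rewrite updE updN// updE.
by rewrite !updN.
Qed.

End Updates.

Section MultiRow.
Variables (R : realType) (k : nat) (n : 'I_k -> nat).
Variable b : forall i, seq 'I_(n i) -> R.
Hypothesis b_gt0 : forall i w, 0 < b (i := i) w.
Variable H : hilbertType R.
Variable X : optuple n H.
Arguments X : clear implicits.
Hypothesis X_lin : forall i w, linear (word_op (X i) w).
Variable tau : 'I_k -> R.
Hypothesis tau_ge0 : forall i, 0 <= tau i.
Hypothesis rows : forall i p (h : seq 'I_(n i) -> H),
  hn (\sum_(w : p.-tuple 'I_(n i)) (Num.sqrt (b w))%:C *: word_op (X i) w (h w)) ^+ 2 <=
  tau i ^+ p * \sum_(w : p.-tuple 'I_(n i)) hn (h w) ^+ 2.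

Let row_tuple i p (h : p.-tuple 'I_(n i) -> H) :
  hn (\sum_(w : p.-tuple 'I_(n i)) (Num.sqrt (b w))%:C *: word_op (X i) w (h w)) ^+ 2 <=
  tau i ^+ p * \sum_(w : p.-tuple 'I_(n i)) hn (h w) ^+ 2.
Proof.
pose h' (s : seq 'I_(n i)) := if insub s is Some w then h w else 0.
have h'E w : h' (tval w) = h w by rewrite /h' valK.
by have := @rows i p h'; under eq_bigr do rewrite h'E; under [X in _ * X]eq_bigr do rewrite h'E.
Qed.

Variable p : {ffun 'I_k -> nat}.

Let agree (s : seq 'I_k) (w w0 : Lambda n p) := [forall j, (j \in s) || (w j == w0 j)].

(** Induction on the set [s] of the tuples already combined. The words in the
    remaining tuples are frozen at those of [w0], so that the sum over the words
    in one more tuple is a row of rows. *)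
Lemma multi_row_seq s : uniq s -> forall w0 (h : Lambda n p -> H),
  hn (\sum_(w | agree s w w0) (Num.sqrt (\prod_(i <- s) b (w i)))%:C *:
        (\big[comp/idfun]_(i <- s) word_op (X i) (w i)) (h w)) ^+ 2 <=
  \prod_(i <- s) tau i ^+ p i * \sum_(w | agree s w w0) hn (h w) ^+ 2.
Proof.
elim: s => [_ w0 h|i s IH /= /andP[is_ us] w0 h].
  have ag w : agree [::] w w0 = (w == w0).
    apply/forallP/eqP => [e|-> j]; last by rewrite eqxx.
    by apply/ffunP => j; have /eqP := e j.
  rewrite (eq_bigl _ _ ag) [in leRHS](eq_bigl _ _ ag).
  by rewrite !big_pred1_eq !big_nil mul1r sqrtr1 scale1r.
have split_sum (V : zmodType) (G : Lambda n p -> V) :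
    \sum_(w | agree (i :: s) w w0) G w =
    \sum_(u : (p i).-tuple 'I_(n i)) \sum_(w | agree s w (upd w0 u)) G w.
  rewrite (partition_big (fun w : Lambda n p => w i) predT)//=; apply: eq_bigr => u _.
  apply: eq_bigl => w; apply/andP/forallP => [[/forallP h1 /eqP wu] j|h1].
    have [<-|ij] := eqVneq i j; first by rewrite updE wu eqxx orbT.
    by rewrite updN//; have := h1 j; rewrite inE eq_sym (negbTE ij).
  split; last by have := h1 i; rewrite (negbTE is_) updE.
  apply/forallP => j; rewrite inE; have [//|ij] := eqVneq j i.
  by have := h1 j; rewrite updN// eq_sym.
rewrite !split_sum.
pose G (u : (p i).-tuple 'I_(n i)) := \sum_(w | agree s w (upd w0 u)) (Num.sqrt (\prod_(j <- s) b (w j)))%:C *: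
        (\big[comp/idfun]_(j <- s) word_op (X j) (w j)) (h w).
have wi u w : agree s w (upd w0 u) -> w i = u.
  by move=> /forallP /(_ i); rewrite (negbTE is_) updE => /eqP.
have -> : \sum_(u : (p i).-tuple 'I_(n i)) \sum_(w | agree s w (upd w0 u))
     (Num.sqrt (\prod_(j <- i :: s) b (w j)))%:C *:
        (\big[comp/idfun]_(j <- i :: s) word_op (X j) (w j)) (h w) =
   \sum_(u : (p i).-tuple 'I_(n i)) (Num.sqrt (b u))%:C *: word_op (X i) u (G u).
  apply: eq_bigr => u _; rewrite (lin_sum (@X_lin i u)) scaler_sumr.
  apply: eq_bigr => w wu; rewrite !big_cons /= (wi _ _ wu) (linZ (@X_lin i u)).
  by rewrite sqrtrM ?ltW// rmorphM scalerA.
rewrite (le_trans (row_tuple G))// big_cons -mulrA ler_wpM2l ?exprn_ge0//.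
by rewrite mulr_sumr; apply: ler_sum => u _; exact: IH.
Qed.

Lemma multi_row (h : Lambda n p -> H) :
  hn (\sum_(w : Lambda n p) (Num.sqrt (\prod_i b (w i)))%:C *: multi_op X (words w) (h w)) ^+ 2 <=
  (\prod_i tau i ^+ p i) * \sum_w hn (h w) ^+ 2.
Proof.
case: (pickP (@predT (Lambda n p))) => [w0 _|none]; last first.
  by rewrite !(big_pred0 _ _ _ _ none) hn0 expr0n mulr0.
have := @multi_row_seq (index_enum 'I_k) (index_enum_uniq _) w0 h.
have ag w : agree (index_enum 'I_k) w w0 = true.
  by apply/forallP => j; rewrite mem_index_enum.
by rewrite (eq_bigl _ _ ag) [in leRHS](eq_bigl _ _ ag).
Qed.

End MultiRow.

(** * Convergence for bounded coefficients *)

Section PartOne.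
Variables (R : realType) (k : nat) (n : 'I_k -> nat).
Variable q : forall i, {fsfun seq 'I_(n i) -> R with 0}.
Hypothesis q_reg : forall i, positive_regular (q i).
Variables (K : hilbertType R) (A : (forall i, seq 'I_(n i)) -> K -> K).
Hypothesis A_bdd : forall w, bounded_op (A w).
Variable r : 'I_k -> R.
Hypothesis r_gt0 : forall i, 0 < r i.

Let b_gt0 i w : 0 < bcoef (q i) w.
Proof. exact: bcoef_gt0. Qed.

Definition coef_op (p : {ffun 'I_k -> nat}) : K -> K :=
  \sum_(w : Lambda n p) ((\prod_(i < k) bcoef (q i) (words w i))^-1)%:C *:
     (adj (A (words w)) \o A (words w)).

Lemma bounded_coef_op p : bounded_op (coef_op p).
Proof.
apply: bounded_sum => w; apply: bounded_scale; apply: bounded_comp => //.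
exact: bounded_adj.
Qed.

Lemma rdot_coef_op p x y : rdot (coef_op p x) y =
  \sum_(w : Lambda n p) (\prod_(i < k) bcoef (q i) (words w i))^-1 *
     rdot (A (words w) x) (A (words w) y).
Proof.
rewrite /coef_op ffunS rdot_suml; apply: eq_bigr => w _.
by rewrite rdotZl rdotC -rdot_adj// rdotC.
Qed.

(** The quadratic form of [coef_op p] is the squared norm of the column of the
    operators [b_w^(-1/2) A_w]. *)
Lemma coef_bound : bounded_set (coef_norms q A r) ->
  exists2 M, 0 <= M & forall (p : {ffun 'I_k -> nat}) x,
    \sum_(w : Lambda n p) (\prod_(i < k) bcoef (q i) (words w i))^-1 * hn (A (words w) x) ^+ 2
    <= M / (\prod_i r i ^+ (2 * p i)) * hn x ^+ 2.
Proof.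
move=> [M0 [_ hM]]; exists `|M0 + 1| => // p x.
have rp : 0 < \prod_i r i ^+ (2 * p i) by apply: prodr_gt0 => i _; rewrite exprn_gt0.
have bS : bounded_op ((\prod_(i < k) r i ^+ (2 * p i))%:C *: coef_op p).
  exact: bounded_scale (bounded_coef_op p).
have h1 : opnorm ((\prod_(i < k) r i ^+ (2 * p i))%:C *: coef_op p) <= `|M0 + 1|.
  rewrite (le_trans (ler_norm _))// (le_trans _ (ler_norm _))//.
  by apply: (hM (M0 + 1)); [rewrite ltrDl|exists p].
have rd : rdot (coef_op p x) x = \sum_(w : Lambda n p)
    (\prod_(i < k) bcoef (q i) (words w i))^-1 * hn (A (words w) x) ^+ 2.
  by rewrite rdot_coef_op; apply: eq_bigr => w _; rewrite rdotxx.
have := rdot_le (((\prod_(i < k) r i ^+ (2 * p i))%:C *: coef_op p) x) x.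
rewrite {1}fctE rdotZl rd.
move=> h2; rewrite mulrAC ler_pdivlMr// mulrC (le_trans h2)// expr2 mulrA ler_wpM2r//.
by rewrite (le_trans (opnormP x bS))// ler_wpM2r.
Qed.

Lemma multi_opW (H : hilbertType R) (X : optuple n H) w :
  (forall i j, bounded_op (X i j)) -> bounded_op (multi_op X w).
Proof.
move=> bX; rewrite /multi_op; elim/big_rec : _ => [|i T _ bT]; first exact: bounded_id.
by apply: bounded_comp => //; exact: bounded_word.
Qed.

(** The row-column estimate for the homogeneous part of multidegree [p]. The
    column contributes [sqrt M] and the powers of [1 / r_i]; the row contributes
    the powers of [t_i sqrt(tau_i)]. *)
Lemma hom_part_bound (H : hilbertType R) (T : hilbertTensor K H) (Y : optuple n H)
    (t tau : 'I_k -> R) M :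
  (forall i j, bounded_op (Y i j)) ->
  (forall i, 0 <= t i) -> (forall i, 0 <= tau i) -> 0 <= M ->
  (forall (p : {ffun 'I_k -> nat}) x,
    \sum_(w : Lambda n p) (\prod_(i < k) bcoef (q i) (words w i))^-1 * hn (A (words w) x) ^+ 2
    <= M / (\prod_i r i ^+ (2 * p i)) * hn x ^+ 2) ->
  (forall i p (h : seq 'I_(n i) -> H),
    hn (\sum_(w : p.-tuple 'I_(n i)) (Num.sqrt (bcoef (q i) w))%:C *: word_op (Y i) w (h w)) ^+ 2 <=
    tau i ^+ p * \sum_(w : p.-tuple 'I_(n i)) hn (h w) ^+ 2) ->
  forall p, opnorm (hom_part A T (scale_tuple t Y) p) <=
    Num.sqrt M * \prod_i (t i * Num.sqrt (tau i) / r i) ^+ p i.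
Proof.
move=> bY t0 tau0 M0 hM rows p.
pose Z : optuple n H := scale_tuple t Y; rewrite -/Z.
have bX i j : bounded_op (Z i j) by exact: bounded_scale.
have rows' i m (h : seq 'I_(n i) -> H) :
    hn (\sum_(w : m.-tuple 'I_(n i)) (Num.sqrt (bcoef (q i) w))%:C *:
        word_op (Z i) w (h w)) ^+ 2 <=
    (t i ^+ 2 * tau i) ^+ m * \sum_(w : m.-tuple 'I_(n i)) hn (h w) ^+ 2.
  under eq_bigr => w _.
    rewrite /Z /scale_tuple word_scale => [|j]; last exact: bounded_lin.
    rewrite size_tuple fctE scalerA mulrC -scalerA.
    over.
  rewrite -scaler_sumr hnZr exprMn real_normK ?num_real// exprMn -exprM mulnC exprM -mulrA.
  by rewrite ler_wpM2l ?exprn_ge0 ?sqr_ge0// rows.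
have rp : 0 < \prod_i r i ^+ (2 * p i) by apply: prodr_gt0 => i _; rewrite exprn_gt0.
have tp : 0 <= \prod_i (t i ^+ 2 * tau i) ^+ p i.
  by apply: prodr_ge0 => i _; rewrite exprn_ge0// mulr_ge0// sqr_ge0.
have := @tens_sum_bound _ _ _ T (Lambda n p)
  (fun w => \prod_(i < k) bcoef (q i) (words w i)) (fun w => A (words w))
  (fun w => multi_op Z (words w)) (M / (\prod_i r i ^+ (2 * p i)))
  (\prod_i (t i ^+ 2 * tau i) ^+ p i).
move=> h; rewrite (le_trans (h _ _ _ _ _ _ _))//.
- by move=> w; apply: prodr_gt0.
- by rewrite divr_ge0// ltW.
- by move=> w; exact: multi_opW.
- exact: hM.
- move=> g; apply: (@multi_row R k n (fun i => bcoef (q i)) b_gt0 H Z _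
    (fun i => t i ^+ 2 * tau i) _ rows' p g).
  + by move=> i w; apply: bounded_lin; exact: bounded_word.
  + by move=> i; rewrite mulr_ge0// sqr_ge0.
- have -> : M / (\prod_i r i ^+ (2 * p i)) * (\prod_i (t i ^+ 2 * tau i) ^+ p i) =
    (Num.sqrt M * \prod_i (t i * Num.sqrt (tau i) / r i) ^+ p i) ^+ 2.
    rewrite exprMn sqr_sqrtr// -prodrXl -mulrA; congr (_ * _).
    rewrite -prodfV -big_split /=; apply: eq_bigr => i _.
    have -> : ((t i * Num.sqrt (tau i) / r i) ^+ p i) ^+ 2 =
              ((t i * Num.sqrt (tau i) / r i) ^+ 2) ^+ p i by rewrite -!exprM mulnC.
    rewrite exprM -exprVn -exprMn; congr (_ ^+ _).
    by rewrite !exprMn sqr_sqrtr// exprVn mulrC.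
  rewrite sqrtr_sqr ger0_norm// mulr_ge0 ?sqrtr_ge0// prodr_ge0// => i _.
  by rewrite exprn_ge0// divr_ge0 ?mulr_ge0 ?sqrtr_ge0// ltW.
Qed.

Lemma bernoulli (x : R) N : 0 <= x <= 1 -> 1 - N%:R * x <= (1 - x) ^+ N.
Proof.
move=> /andP[x0 x1]; elim: N => [|N IH]; first by rewrite mul0r subr0 expr0.
have : 0 <= (1 - x) ^+ N by rewrite exprn_ge0// subr_ge0.
have N0 : 0 <= N%:R :> R by [].
rewrite exprS -natr1; move: IH; set y := (1 - x) ^+ N; set m := N%:R in N0 *.
have := mulr_ge0 N0 x0; nra.
Qed.

(** By Bernoulli's inequality, [tau = 1 - (1 - rho) / (N + 2)] works; the
    denominator [N + 2] keeps [tau] positive when [rho] is 0. *)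
Lemma pow_majorant (rho : R) N : 0 <= rho < 1 ->
  exists2 tau, 0 < tau < 1 & rho <= tau ^+ N.
Proof.
move=> /andP[rho0 rho1]; pose x := (1 - rho) / N.+2%:R.
have x0 : 0 < x by rewrite divr_gt0// subr_gt0.
have x1 : x < 1.
  rewrite ltr_pdivrMr// mul1r; have : 1 < N.+2%:R :> R by rewrite ltr1n.
  lra.
exists (1 - x); first by apply/andP; split; lra.
apply: le_trans (bernoulli _ _); last by apply/andP; split; lra.
have : N%:R * x <= 1 - rho.
  rewrite /x mulrCA ler_piMr ?subr_ge0 ?(ltW rho1)//.
  by rewrite ler_pdivrMr// mul1r ler_nat; lia.
lra.
Qed.

Lemma summable_bound (M : R) (x : 'I_k -> R) : (forall i, 0 <= x i < 1) -> 0 <= M ->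
  summable_le (fun p : {ffun 'I_k -> nat} => M * \prod_i x i ^+ p i) (M * \prod_i (1 - x i)^-1).
Proof.
move=> x01 M0 J; rewrite /partial_sum -mulr_sumr ler_wpM2l//.
exact: summable_geom x01 J.
Qed.

Lemma opnorm_hom_ge0 (H : hilbertType R) (T : hilbertTensor K H) (X : optuple n H) p :
  (forall i j, bounded_op (X i j)) -> 0 <= opnorm (hom_part A T X p).
Proof.
move=> bX; apply: opnorm_ge0; apply: bounded_sum => w.
by apply: (tensopP T _ _).1 => //; exact: multi_opW.
Qed.

Lemma max_length i : exists N, forall u, u \in finsupp (q i) -> (size u <= N)%N.
Proof.
exists (\max_(u <- finsupp (q i)) size u)%N => u uq.
exact: (@leq_bigmax_seq _ _ xpredT size).
Qed.

(** In the open polydomain the decay comes from the defect: each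
    [Phi_i(1) <= rho_i < 1]. *)
Lemma part_one_open (H : hilbertType R) (T : hilbertTensor K H) (X : optuple n H) :
  bounded_set (coef_norms q A r) -> (scale_tuple r @` Dopen q H) X ->
  cvg (partial_sum (fun p => opnorm (hom_part A T X p)) @ totally).
Proof.
move=> /coef_bound[M M0 hM] [Y DY <-].
have bY : forall i j, bounded_op (Y i j) by case: DY => -[[bY _] _] _.
have /choice[tau htau] : forall i, exists tau, 0 < tau < 1 /\
   forall p (h : seq 'I_(n i) -> H),
    hn (\sum_(w : p.-tuple 'I_(n i)) (Num.sqrt (bcoef (q i) w))%:C *: word_op (Y i) w (h w)) ^+ 2 <=
    tau ^+ p * \sum_(w : p.-tuple 'I_(n i)) hn (h w) ^+ 2.
  move=> i; have [rho /andP[rho0 rho1] hrho] := Dopen_row q_reg i DY.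
  have [N hN] := max_length i.
  have [|tau /andP[t0 t1] ht] := @pow_majorant rho N; first by rewrite rho0.
  exists tau; split; first by rewrite t0.
  apply: (word_row (q_reg i) _ hrho rho0 t0 (ltW t1) hN ht) => u.
  by apply: bounded_lin; exact: bounded_word.
have t01 i : 0 <= Num.sqrt (tau i) < 1.
  have [/andP[t0 t1] _] := htau i.
  by rewrite sqrtr_ge0 -[ltRHS]sqrtr1 ltr_sqrt.
have bX i j : bounded_op ((scale_tuple r Y : optuple n H) i j) by exact: bounded_scale.
have u0 p : 0 <= opnorm (hom_part A T (scale_tuple r Y) p) by exact: opnorm_hom_ge0.
apply/cvg_ex; eexists; apply: possum_cvg u0 _.
move=> J; apply: le_trans (summable_bound t01 (sqrtr_ge0 M) J); apply: psum_le => p.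
rewrite (le_trans (@hom_part_bound H T Y r tau M bY _ _ M0 hM _ p))//.
- by move=> i; rewrite ltW.
- by move=> i; have [/andP[/ltW]] := htau i.
- by move=> i; have [_] := htau i.
rewrite le_eqVlt; apply/orP; left; apply/eqP; congr (_ * _); apply: eq_bigr => i _.
by rewrite mulrAC divff ?mul1r// gt_eqF.
Qed.

(** On the closure only [Phi_i(1) <= 1] is left, uniformly in the tuple; the decay
    comes from [s_i < r_i]. *)
Lemma part_one_uniform (H : hilbertType R) (T : hilbertTensor K H) (s : 'I_k -> R) :
  bounded_set (coef_norms q A r) -> (forall i, 0 <= s i < r i) ->
  {uniform scale_tuple s @` opclosure (Dopen q H),
     (fun J (X : optuple n H) => partial_sum (fun p => opnorm (hom_part A T X p)) J)
       @ totally --> (fun X => possum (fun p => opnorm (hom_part A T X p)))}.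
Proof.
move=> /coef_bound[M M0 hM] sr.
have x01 i : 0 <= s i / r i < 1.
  have /andP[s0 s1] := sr i.
  by rewrite divr_ge0 ?(ltW (r_gt0 i))//= ltr_pdivrMr// mul1r.
apply: (uniform_psum (c := fun p : {ffun 'I_k -> nat} => Num.sqrt M * \prod_i (s i / r i) ^+ p i)
  _ (summable_bound x01 (sqrtr_ge0 M))) => _ p [Y cY <-].
have bY : forall i j, bounded_op (Y i j) by case: cY.
have bX i j : bounded_op ((scale_tuple s Y : optuple n H) i j) by exact: bounded_scale.
rewrite opnorm_hom_ge0//= (le_trans (@hom_part_bound H T Y s (fun=> 1) M bY _ _ M0 hM _ p))//.
- by move=> i; case/andP: (sr i).
- move=> i m h; have [N hN] := max_length i.
  have := @word_row _ _ _ _ (q_reg i) (Y i) _ 1 1 N (@closure_row _ _ _ _ q_reg _ Y i cY) ler01 ltr01 (lexx 1) hN _ m h.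
  apply=> [u|]; last by rewrite expr1n.
  by apply: bounded_lin; exact: bounded_word.
rewrite le_eqVlt; apply/orP; left; apply/eqP; congr (_ * _); apply: eq_bigr => i _.
by rewrite sqrtr1 mulr1.
Qed.

End PartOne.

(** * The scalar field as a Hilbert space *)

Section RealFilters.
Variables (R : realType) (V : normedModType R[i]).

Lemma cauchy_real (F : set_system V) : ProperFilter F -> cauchy F ->
  forall e : R, 0 < e -> exists2 A, F A & forall x y, A x -> A y -> complex.Re `|x - y| < e.
Proof.
move=> FF /cauchy_ballP h e e0.
have /h[[A B] /= [FA FB] AB] : 0 < e%:C by rewrite ltcR.
exists (A `&` B); first exact: filterI.
move=> x y [Ax _] [_ By]; have := AB (x, y) (conj Ax By).
by rewrite /= -ball_normE /= ltcE /= => /andP[].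
Qed.

Lemma cvg_real (F : set_system V) (l : V) : Filter F ->
  (forall e : R, 0 < e -> F [set x | complex.Re `|l - x| < e]) -> F --> l.
Proof.
move=> FF h; apply/cvgrPdist_lt => e; rewrite ltcE /= => /andP[/eqP im0 e0].
apply: filterS (h _ e0) => x /= hx; rewrite ltcE hx andbT.
by rewrite (ger0_Im (normr_ge0 _)) im0.
Qed.

End RealFilters.

(** A copy of the scalar field, which carries its own Hilbert space structure. *)
Definition scalars (R : realType) : Type := R[i].
HB.instance Definition _ (R : realType) := NormedModule.copy (scalars R) (R[i]^o).

Section Scalars.
Variable R : realType.

Lemma norm_i : `|'i : R[i]| = 1.
Proof. by rewrite normc_def /= expr0n expr1n add0r sqrtr1. Qed.

Lemma norm_ReIm (u v : R) : complex.Re `|u +i* v| <= `|u| + `|v|.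
Proof.
have -> : u +i* v = u%:C + 'i * v%:C by rewrite [LHS]complexE.
rewrite -lecR RRe_real ?ger0_real// (le_trans (ler_normD _ _))//.
by rewrite normrM norm_i mul1r !normcR rmorphD.
Qed.

Lemma scalars_complete (F : set_system (scalars R)) :
  ProperFilter F -> cauchy F -> cvg F.
Proof.
move=> FF /cauchy_real cF.
have part (f : R[i] -> R) : (forall x y, f (x - y) = f x - f y) ->
    (forall x, `|f x| <= complex.Re `|x|) -> cvg (f @ F).
  move=> fB fle; apply: cauchy_cvg; apply: cauchy_exP => e e0.
  have [A FA hA] := cF _ e0.
  have [x Ax] := filter_ex FA; exists (f x).
  suff : F [set y | ball (f x) e (f y)] by [].
  apply: filterS FA => y Ay; rewrite /= -ball_normE /= -fB.
  exact: le_lt_trans (fle _) (hA _ _ Ax Ay).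
have Re_le (x : R[i]) : `|complex.Re x| <= complex.Re `|x|.
  by have := normc_ge_Re x; rewrite lecE => /andP[].
have Im_le (x : R[i]) : `|complex.Im x| <= complex.Re `|x|.
  have -> : complex.Im x = - complex.Re ('i * x) by rewrite Re_iM opprK.
  rewrite normrN (le_trans (Re_le _))//.
  by rewrite normrM norm_i mul1r.
have /cvg_ex[a ha] : cvg (@complex.Re R @ F).
  by apply: part => // x y; rewrite ReD ReN.
have /cvg_ex[b hb] : cvg (@complex.Im R @ F).
  by apply: part => // x y; rewrite ImD ImN.
apply/cvg_ex; exists (a +i* b : scalars R); apply: cvg_real => e e0.
have e2 : 0 < e / 2 by rewrite divr_gt0.
move/cvgrPdist_lt : ha => /(_ _ e2) ha; move/cvgrPdist_lt : hb => /(_ _ e2) hb.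
apply: filterS2 ha hb => x /= h1 h2.
have -> : (a +i* b : scalars R) - x = (a - complex.Re x) +i* (b - complex.Im x) :> R[i].
  by case: (x : R[i]).
set u := a - _ in h1 *; set v := b - _ in h2 *.
apply: (le_lt_trans (norm_ReIm u v)); lra.
Qed.

HB.instance Definition _ := Uniform_isComplete.Build (scalars R) scalars_complete.

Definition scalars_dot (x y : scalars R) : R[i] := (x : R[i]) * (y : R[i])^*.

Lemma scalars_dotB x y z : scalars_dot (x - y) z = scalars_dot x z - scalars_dot y z.
Proof. exact: mulrBl. Qed.

Lemma scalars_dotZ (a : R[i]) x z : scalars_dot (a *: x) z = a * scalars_dot x z.
Proof. by rewrite /scalars_dot mulrA. Qed.

Lemma scalars_dotC x y : scalars_dot x y = (scalars_dot y x)^*.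
Proof. rewrite /scalars_dot rmorphM mulrC; congr (_ * _); exact/esym/conjCK. Qed.

Lemma scalars_dot_norm (x : scalars R) : `|x| ^+ 2 = scalars_dot x x.
Proof. exact: sqr_normc. Qed.

End Scalars.

(** Hermitian symmetry transfers linearity to the second variable, and positivity
    comes from the norm. *)
Section MakeDot.
Variables (R : realType) (V : normedModType R[i]) (d : V -> V -> R[i]).
Hypothesis dB : forall x y z, d (x - y) z = d x z - d y z.
Hypothesis dZ : forall a x z, d (a *: x) z = a * d x z.
Hypothesis dC : forall x y, d x y = (d y x)^*.
Hypothesis d_norm : forall x, `|x| ^+ 2 = d x x.

Let dBl z : GRing.zmod_morphism (d^~ z). Proof. by move=> x y; exact: dB. Qed.
Let dBr z : GRing.zmod_morphism (d z).
Proof. by move=> x y; rewrite dC dB rmorphB; congr (_ - _); exact/esym/dC. Qed.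
Let dZl z : GRing.scalable_for *%R (d^~ z). Proof. by move=> a x; exact: dZ. Qed.
Let dZr z : GRing.scalable_for (Num.conj \; *%R) (d z).
Proof. by move=> a x; rewrite dC dZ rmorphM; congr (_ * _); exact/esym/dC. Qed.
Let dH x y : d x y = (-1) ^+ false * Num.conj (d y x).
Proof. by rewrite expr0 mul1r. Qed.
Let dP x : x != 0 -> 0 < d x x.
Proof. by move=> x0; rewrite -d_norm exprn_gt0// normr_gt0. Qed.

Definition make_dot : {dot V for (@Num.conj R[i])} :=
  HB.pack d (isBilinear.Build R[i] V V R[i] *%R (Num.conj \; *%R) d dBl dBr dZl dZr)
    (isHermitianSesquilinear.Build R[i] V false (@Num.conj R[i]) d dH)
    (isDotProduct.Build R[i] V d dP).

End MakeDot.

Definition scalars_hdot (R : realType) :=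
  make_dot (@scalars_dotB R) (@scalars_dotZ R) (@scalars_dotC R) (@scalars_dot_norm R).

HB.instance Definition _ (R : realType) := CompleteNormedModule_isHilbert.Build R (scalars R)
  (@scalars_dot_norm R : forall x, `|x| ^+ 2 = scalars_hdot R x x).

(** * Square-summable families of vectors *)

Section L2.
Variables (R : realType) (I : choiceType) (K : hilbertType R).

Definition sqn (f : I -> K) i := hn (f i) ^+ 2.

Definition square_summable : {pred I -> K} :=
  fun f => `[< exists M, summable_le (sqn f) M >].

Lemma square_summableP (f : I -> K) : reflect (exists M, summable_le (sqn f) M) (f \in square_summable).
Proof. exact: asboolP. Qed.

Lemma sqn_ge0 (f : I -> K) i : 0 <= sqn f i. Proof. exact: sqr_ge0. Qed.
Hint Resolve sqn_ge0 : core.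

Lemma square_summable_closed : submod_closed square_summable.
Proof.
split=> [|a f g /square_summableP[M hM] /square_summableP[N hN]]; apply/square_summableP.
  exists 0 => J; rewrite /partial_sum big1// => i _.
  by rewrite /sqn hn0 expr0n.
have a0 : 0 <= complex.Re `|a| by rewrite -ler0c RRe_real ?ger0_real.
exists (2 * (complex.Re `|a|) ^+ 2 * M + 2 * N) => J.
apply: (@le_trans _ _ (2 * complex.Re `|a| ^+ 2 * partial_sum (sqn f) J + 2 * partial_sum (sqn g) J)); last first.
  by rewrite lerD// ler_wpM2l// mulr_ge0// sqr_ge0.
rewrite /partial_sum !mulr_sumr -big_split; apply: ler_sum => i _.
rewrite /sqn !fctE.
have := hnD (a *: f (val i)) (g (val i)); rewrite hnZ.
have := hn_ge0 (a *: f (val i) + g (val i)).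
have := hn_ge0 (f (val i)); have := hn_ge0 (g (val i)).
set x := hn (_ + _); set y := hn (f _); set z := hn (g _); set c := complex.Re _ in a0 *.
move=> z0 y0 x0 h; have : x ^+ 2 <= (c * y + z) ^+ 2 by rewrite ler_pXn2r ?nnegrE ?addr_ge0 ?mulr_ge0.
have := sqr_ge0 (c * y - z).
rewrite -[X in _ -> _ -> _ <= X]/(2 * c ^+ 2 * y ^+ 2 + 2 * z ^+ 2).
nra.
Qed.

HB.instance Definition _ := GRing.isSubmodClosed.Build _ _ square_summable
  square_summable_closed.

Structure l2 := L2 { l2val :> I -> K; _ : l2val \in square_summable }.
HB.instance Definition _ := [isSub for l2val].
HB.instance Definition _ := [Choice of l2 by <:].
HB.instance Definition _ := [SubChoice_isSubLmodule of l2 by <:].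

Implicit Types f g h : l2.

Lemma l2P f : exists M, summable_le (sqn f) M.
Proof. by case: f => f fP; exact/square_summableP. Qed.

Lemma l2_ext (f g : l2) : (forall i, f i = g i) -> f = g.
Proof. by move=> h; apply/val_inj/funext. Qed.

Lemma l2E (a : R[i]) (f g : l2) i : (a *: f + g : l2) i = a *: f i + g i.
Proof. by []. Qed.
Lemma l2D (f g : l2) i : (f + g : l2) i = f i + g i. Proof. by []. Qed.
Lemma l2B (f g : l2) i : (f - g : l2) i = f i - g i. Proof. by []. Qed.
Lemma l2Z (a : R[i]) (f : l2) i : (a *: f : l2) i = a *: f i. Proof. by []. Qed.
Lemma l20 i : (0 : l2) i = 0. Proof. by []. Qed.

Definition l2n2 (f : l2) : R := possum (sqn f).

Lemma l2n2_cvg f : partial_sum (sqn f) @ totally --> l2n2 f.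
Proof. by have [M hM] := l2P f; exact: possum_cvg hM. Qed.

Lemma l2n2_le f M : (forall J, partial_sum (sqn f) J <= M) -> l2n2 f <= M.
Proof. exact: possum_le. Qed.

Lemma l2n2_ge f J : partial_sum (sqn f) J <= l2n2 f.
Proof. by have [M hM] := l2P f; exact: possum_ge hM. Qed.

Lemma l2n2_ge0 f : 0 <= l2n2 f.
Proof. exact: possum_ge0. Qed.

(** The real part of the inner product, by polarization: this makes its
    convergence a consequence of that of the squared norms. *)
Definition l2rd (f g : l2) : R := (l2n2 (f + g) - l2n2 f - l2n2 g) / 2.

Lemma l2rd_cvg f g : partial_sum (fun i => rdot (f i) (g i)) @ totally --> l2rd f g.
Proof.
have -> : partial_sum (fun i => rdot (f i) (g i)) =
    (fun J => (partial_sum (sqn (f + g : l2)) J - partial_sum (sqn f) J - partial_sum (sqn g) J) / 2).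
  apply/funext => J; rewrite /partial_sum -!sumrB mulr_suml; apply: eq_bigr => i _.
  by rewrite /sqn l2D hn2D; field.
rewrite /l2rd.
exact: (cvgM (cvgB (cvgB (@l2n2_cvg (f + g)) (@l2n2_cvg f)) (@l2n2_cvg g)) (cvg_cst _)).
Qed.

Lemma l2rd_lim f g (u : {fset I} -> R) l :
  (forall J, partial_sum (fun i => rdot (f i) (g i)) J = u J) ->
  u @ totally --> l -> l2rd f g = l.
Proof. by move=> /funext <- h; apply: norm_cvg_unique (@l2rd_cvg f g) h. Qed.

Lemma l2rdC f g : l2rd f g = l2rd g f.
Proof.
apply: l2rd_lim (@l2rd_cvg g f) => J.
by apply: eq_bigr => i _; exact: rdotC.
Qed.

Lemma l2rdDl f g h : l2rd (f + g) h = l2rd f h + l2rd g h.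
Proof.
apply: l2rd_lim (cvgD (@l2rd_cvg f h) (@l2rd_cvg g h)) => J.
rewrite -[RHS]/(partial_sum _ J + partial_sum _ J) -psumD.
by apply: eq_bigr => i _; rewrite l2D rdotDl.
Qed.

Lemma l2rdZl (c : R) f h : l2rd (c%:C *: f) h = c * l2rd f h.
Proof.
apply: l2rd_lim (cvgM (cvg_cst c) (@l2rd_cvg f h)) => J.
rewrite -[RHS]/(c * partial_sum _ J) /partial_sum mulr_sumr.
by apply: eq_bigr => i _; rewrite l2Z rdotZl.
Qed.

Lemma l2rd_i f g : l2rd ('i *: f) g = - l2rd f ('i *: g).
Proof.
apply: l2rd_lim (cvgN (@l2rd_cvg f ('i *: g))) => J.
rewrite -[RHS]/(- partial_sum _ J) -psumN; apply: eq_bigr => i _.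
by rewrite !l2Z /rdot dotZl dotZr; case: (hdot (f _) (g _)) => u v /=; ring.
Qed.

Lemma l2rdNl f g : l2rd (- f) g = - l2rd f g.
Proof.
by have := l2rdZl (-1) f g; rewrite rmorphN rmorph1 scaleN1r mulN1r.
Qed.

Lemma l2rdff f : l2rd f f = l2n2 f.
Proof.
by apply: l2rd_lim (@l2n2_cvg f) => J; apply: eq_bigr => i _; rewrite rdotxx.
Qed.

Lemma l2n2D f g : l2n2 (f + g) = l2n2 f + 2 * l2rd f g + l2n2 g.
Proof. by rewrite -!l2rdff l2rdDl (l2rdC f) (l2rdC g) !l2rdDl (l2rdC g f); ring. Qed.

Lemma l2n2Z a f : l2n2 (a *: f) = complex.Re `|a| ^+ 2 * l2n2 f.
Proof.
rewrite -!l2rdff; apply: l2rd_lim (cvgM (cvg_cst (complex.Re `|a| ^+ 2)) (@l2rd_cvg f f)) => J.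
rewrite -[RHS]/(_ * partial_sum _ J) /partial_sum mulr_sumr; apply: eq_bigr => i _.
by rewrite l2Z !rdotxx hnZ exprMn.
Qed.

Lemma l2n2_eq0 f : l2n2 f = 0 -> f = 0.
Proof.
move=> h; apply: l2_ext => i; rewrite l20; apply: hn_eq0.
have := @l2n2_ge f [fset i]%fset; rewrite psum1 h /sqn => h1.
by apply/eqP; rewrite -sqrf_eq0 eq_le h1 sqr_ge0.
Qed.

Definition l2norm f : R[i] := (Num.sqrt (l2n2 f))%:C.

Lemma l2normD f g : l2norm (f + g) <= l2norm f + l2norm g.
Proof.
rewrite /l2norm -rmorphD lecR -(@ler_pXn2r _ 2) ?nnegrE ?addr_ge0 ?sqrtr_ge0//.
rewrite sqr_sqrtr ?l2n2_ge0// sqrrD !sqr_sqrtr ?l2n2_ge0// l2n2D lerD2r lerD2l.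
rewrite mulr2n mulrDl mul1r.
suff h : l2rd f g <= Num.sqrt (l2n2 f) * Num.sqrt (l2n2 g) by rewrite lerD.
rewrite (le_trans (ler_norm _))// -(@ler_pXn2r _ 2) ?nnegrE ?mulr_ge0 ?sqrtr_ge0//.
rewrite real_normK ?num_real// [leRHS]exprMn !sqr_sqrtr ?l2n2_ge0//.
apply: quad_discr => t; have := l2n2_ge0 (f + t%:C *: g).
by rewrite l2n2D l2rdC l2rdZl (l2rdC g) l2n2Z normcR real_normK ?num_real//; lra.
Qed.

Lemma l2normZ a f : l2norm (a *: f) = `|a| * l2norm f.
Proof.
have ra : `|a| = (complex.Re `|a|)%:C by rewrite RRe_real ?ger0_real.
rewrite /l2norm l2n2Z sqrtrM ?sqr_ge0// rmorphM ra; congr (_ * _).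
by rewrite -ra sqrtr_sqr ger0_norm// -ler0c -ra.
Qed.

Lemma l2norm_eq0 f : l2norm f = 0 -> f = 0.
Proof.
move=> /complexI/eqP; rewrite sqrtr_eq0 => h; apply: l2n2_eq0.
by apply/eqP; rewrite eq_le h l2n2_ge0.
Qed.

HB.instance Definition _ := Lmodule_isNormed.Build R[i] l2 l2normD l2normZ l2norm_eq0.

Lemma l2norm_sqr (f : l2) : complex.Re `|f| ^+ 2 = l2n2 f.
Proof. by rewrite -[LHS]/(Num.sqrt (l2n2 f) ^+ 2) sqr_sqrtr ?l2n2_ge0. Qed.

Lemma l2norm_coord (f : l2) i : hn (f i) <= complex.Re `|f|.
Proof.
have h0 : 0 <= complex.Re `|f| by rewrite -ler0c RRe_real ?ger0_real.
rewrite -(@ler_pXn2r _ 2) ?nnegrE// l2norm_sqr.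
by have := @l2n2_ge f [fset i]%fset; rewrite psum1.
Qed.

Lemma hn_cvg T (F : set_system T) (u : T -> K) (x : K) (y : K) : Filter F ->
  u @ F --> x -> (fun t => hn (y - u t)) @ F --> hn (y - x).
Proof.
move=> FF /cvgrPdist_lt h; apply/cvgrPdist_lt => e e0.
have /h : 0 < e%:C by rewrite ltcR.
apply: filterS => t; rewrite /= normE ltcR => ht.
apply: le_lt_trans ht; rewrite ler_norml.
have := hnB y (u t) x; have := hnB y x (u t); rewrite (hnBC (u t) x); lra.
Qed.

(** Coordinates of a Cauchy filter converge; the bound on the finite partial
    sums of the squared distances passes to the coordinatewise limit. *)
Lemma l2_complete (F : set_system l2) : ProperFilter F -> cauchy F -> cvg F.
Proof.
move=> FF /cauchy_real cF.
have /choice[x hx] : forall i, exists y : K, (fun f : l2 => f i) @ F --> y.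
  move=> i; apply/cvg_ex; apply: cauchy_cvg; apply: cauchy_exP => e.
  rewrite ltcE /= => /andP[/eqP im0 e0].
  have [A FA hA] := cF _ e0; have [f Af] := filter_ex FA; exists (f i).
  suff : F [set g : l2 | ball (f i) e (g i)] by [].
  apply: filterS FA => g Ag; rewrite /= -ball_normE /= ltcE (ger0_Im (normr_ge0 _)) im0 eqxx /=.
  exact: le_lt_trans (@l2norm_coord (f - g) i) (hA _ _ Af Ag).
have close (e : R) : 0 < e -> exists2 A, F A & forall f, A f -> forall J,
    partial_sum (fun i => hn (f i - x i) ^+ 2) J <= e ^+ 2.
  move=> e0; have [A FA hA] := cF _ e0; exists A => // f Af J.
  have lim_J : (fun g : l2 => \sum_(i <- J) hn (f i - g i) ^+ 2) @ F -->
               \sum_(i <- J) hn (f i - x i) ^+ 2.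
    elim: (J : seq I) => [|j s IH].
      rewrite big_nil [X in X @ _ --> _](_ : _ = fun=> 0); first exact: cvg_cst.
      by apply/funext => g; rewrite big_nil.
    rewrite big_cons [X in X @ _ --> _](_ : _ = fun g : l2 => hn (f j - g j) ^+ 2 + \sum_(i <- s) hn (f i - g i) ^+ 2).
      apply: cvgD => //; rewrite expr2; under eq_fun do rewrite expr2.
      by apply: cvgM; exact: hn_cvg (hx j).
    by apply/funext => g; rewrite big_cons.
  rewrite psumE; apply: cvgr_to_le lim_J _; apply: filterS FA => g Ag.
  have := l2n2_ge (f - g) J; rewrite psumE -l2norm_sqr => h; apply: (le_trans h).
  have h0 : 0 <= complex.Re `|f - g| by rewrite -ler0c RRe_real ?ger0_real.
  by rewrite ler_pXn2r ?nnegrE ?(ltW e0)//; exact/ltW/hA.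
have xs : x \in square_summable.
  have [A FA hA] := close 1 ltr01; have [f Af] := filter_ex FA.
  have : (fun i => f i - x i) \in square_summable.
    by apply/square_summableP; exists (1 ^+ 2) => J; exact: hA.
  have : (f : I -> K) \in square_summable by case: (f).
  move=> fs ds; have -> : x = (f : I -> K) - (fun i => f i - x i).
    by apply/funext => i; rewrite !fctE opprB addrC subrK.
  by rewrite rpredB.
apply/cvg_ex; exists (L2 xs); apply: cvg_real => e e0.
have [A FA hA] := close (e / 2) ltac:(by rewrite divr_gt0).
apply: filterS FA => f Af /=.
apply: (@le_lt_trans _ _ (e / 2)); last by rewrite ltr_pdivrMr// ltr_pMr// ltr1n.
have h0 (g : l2) : 0 <= complex.Re `|g| by rewrite -ler0c RRe_real ?ger0_real.
have e20 : 0 <= e / 2 by rewrite divr_ge0 ?(ltW e0).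
rewrite -(@ler_pXn2r _ 2) ?nnegrE// l2norm_sqr.
apply: l2n2_le => J; apply: le_trans (hA f Af J); apply: psum_le => i.
by rewrite /sqn l2B hnBC.
Qed.

HB.instance Definition _ := Uniform_isComplete.Build l2 l2_complete.

(** The real part determines the inner product as in [hdotE]. *)
Definition l2dot (f g : l2) : R[i] := (l2rd f g) +i* (l2rd f ('i *: g)).

Lemma l2dotB f g h : l2dot (f - g) h = l2dot f h - l2dot g h.
Proof. by rewrite /l2dot !l2rdDl !l2rdNl. Qed.

Lemma l2dotZ a f h : l2dot (a *: f) h = a * l2dot f h.
Proof.
have aE : a *: f = (complex.Re a)%:C *: f + (complex.Im a)%:C *: ('i *: f).
  by rewrite scalerA -scalerDl {1}[a]complexE mulrC.
have ii : ('i : R[i]) *: ('i *: h) = - h by rewrite scalerA -expr2 sqr_i scaleN1r.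
rewrite /l2dot aE !l2rdDl !l2rdZl !l2rd_i ii (l2rdC f (- h)) l2rdNl (l2rdC h f).
by case: a {aE} => u v /=; congr (_ +i* _); ring.
Qed.

Lemma l2dotC f g : l2dot f g = (l2dot g f)^*.
Proof. by rewrite /l2dot l2rdC; congr (_ +i* _); rewrite -l2rd_i l2rdC. Qed.

Lemma l2dot_norm (f : l2) : `|f| ^+ 2 = l2dot f f.
Proof.
have im0 : l2rd f ('i *: f) = 0 by have := l2rd_i f f; rewrite l2rdC; lra.
rewrite /l2dot im0 l2rdff -l2norm_sqr; apply/eqP; rewrite -subr_eq0.
have {1}-> : `|f| = (complex.Re `|f|)%:C by rewrite RRe_real ?ger0_real.
by rewrite -rmorphXn subrr.
Qed.

HB.instance Definition _ := CompleteNormedModule_isHilbert.Build R l2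
  (l2dot_norm : forall f, `|f| ^+ 2 = make_dot l2dotB l2dotZ l2dotC l2dot_norm f f).

Lemma l2_hn2 (f : l2) : hn f ^+ 2 = l2n2 f.
Proof. exact: l2norm_sqr. Qed.

Lemma l2_rdot (f g : l2) : rdot f g = l2rd f g.
Proof. by []. Qed.

End L2.

(** * Operators and tensors on square-summable families *)

Section L2Tools.
Variables (R : realType) (I : choiceType) (K : hilbertType R).
Notation E := (l2 I K).

(** Families that are not square-summable are sent to 0, which makes the
    definitions below total; the lemmas that compute coordinates carry the
    summability. *)
Definition mkl2 (g : I -> K) : E := insubd 0 g.

Lemma mkl2E (g : I -> K) M i : summable_le (sqn g) M -> mkl2 g i = g i.
Proof.
move=> h; have gs : g \in @square_summable R I K by apply/square_summableP; exists M.
by rewrite -[LHS]/((val (insubd (0 : E) g)) i) val_insubd gs.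
Qed.

Definition single (b : I) (x : K) : E := mkl2 (fun i => if i == b then x else 0).

Lemma single_summable b (x : K) : summable_le (sqn (fun i : I => if i == b then x else 0)) (hn x ^+ 2).
Proof.
move=> J; rewrite psumE; have [bJ|bJ] := boolP (b \in J).
  rewrite (big_fsetD1 b)//= {1}/sqn eqxx big_seq big1 ?addr0// => i.
  by rewrite !inE => /andP[/negbTE ib _]; rewrite /sqn ib hn0 expr0n.
rewrite big_seq big1 ?sqr_ge0// => i iJ; rewrite /sqn.
case: eqVneq => [ib|_]; last by rewrite hn0 expr0n.
by rewrite -ib iJ in bJ.
Qed.

Lemma singleE b (x : K) i : single b x i = if i == b then x else 0.
Proof. exact: mkl2E (single_summable b x). Qed.

Lemma rdot_single b (x : K) (g : E) : rdot (single b x) g = rdot x (g b).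
Proof.
rewrite l2_rdot; apply: l2rd_lim (fun=> erefl) _.
apply: cvg_near_cst; exists [fset b]%fset => // J /=; rewrite fsub1set => bJ.
rewrite psumE (big_fsetD1 b)//= singleE eqxx big_seq big1 ?addr0// => i.
by rewrite !inE singleE => /andP[/negbTE-> _]; rewrite /rdot dot0l.
Qed.

Lemma hn_single b (x : K) : hn (single b x) = hn x.
Proof.
apply/eqP; rewrite -(@eqrXn2 _ 2)//; apply/eqP.
by rewrite -rdotxx rdot_single singleE eqxx rdotxx.
Qed.

(** Weighted composition operators [f |-> c * (f o s)]; diagonal operators and
    weighted shifts are of this form. *)
Definition wcomp (c : I -> R) (s : I -> I) (f : E) : E := mkl2 (fun i => (c i)%:C *: f (s i)).

Section WComp.
Variables (c : I -> R) (s : I -> I) (C : R).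
Hypothesis C_ge0 : 0 <= C.
Hypothesis c_le : forall i, `|c i| <= C.
Hypothesis s_inj : forall i j, c i != 0 -> c j != 0 -> s i = s j -> i = j.

Lemma wcomp_summable (f : E) :
  summable_le (sqn (fun i => (c i)%:C *: f (s i))) (C ^+ 2 * l2n2 f).
Proof.
move=> J; rewrite psumE (big_fsetID _ (fun i => c i != 0)) /= [X in _ + X]big_seq.
rewrite [X in _ + X]big1 ?addr0 => [|i]; last first.
  by rewrite !inE /= negbK => /andP[_ /eqP ci]; rewrite /sqn ci scale0r hn0 expr0n.
set J' := [fset i in J | c i != 0]%fset.
have cJ' i : i \in J' -> c i != 0 by rewrite !inE => /andP[].
apply: (@le_trans _ _ (C ^+ 2 * \sum_(i <- J') hn (f (s i)) ^+ 2)).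
  rewrite mulr_sumr; apply: ler_sum => i _; rewrite /sqn hnZr exprMn ler_wpM2r ?sqr_ge0//.
  by rewrite ler_pXn2r ?nnegrE.
rewrite ler_wpM2l ?sqr_ge0//; apply: le_trans (l2n2_ge f (s @` J')%fset).
have s_inj' : {in J' &, injective s} by move=> i j iJ jJ; apply: s_inj; exact: cJ'.
by rewrite psumE [leRHS]big_imfset.
Qed.

Lemma wcompE f i : wcomp c s f i = (c i)%:C *: f (s i).
Proof. exact: mkl2E (wcomp_summable f). Qed.

Lemma wcomp_bound f : hn (wcomp c s f) <= C * hn f.
Proof.
apply: hn_sqr_le; first by rewrite mulr_ge0.
rewrite exprMn !l2_hn2; apply: l2n2_le => J; apply: le_trans (wcomp_summable f J).
by apply: psum_le => i; rewrite /sqn wcompE.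
Qed.

Lemma wcomp_bounded : bounded_op (wcomp c s).
Proof.
apply/bounded_opP; split; last by exists C => //; exact: wcomp_bound.
move=> a f g; apply: l2_ext => i; rewrite wcompE !(l2E, wcompE).
by rewrite scalerDr !scalerA mulrC.
Qed.

End WComp.

Lemma rdot_wcomp_id (c : I -> R) C (f : E) : 0 <= C -> (forall i, 0 <= c i <= C) ->
  0 <= rdot (wcomp c id f) f.
Proof.
move=> C0 hc; have cC i : `|c i| <= C by rewrite ger0_norm; case/andP: (hc i).
rewrite l2_rdot; apply: (cvgr_to_ge (@l2rd_cvg _ _ _ (wcomp c id f) f)).
near=> J; rewrite /partial_sum; apply: sumr_ge0 => i _.
rewrite (wcompE C0 cC)// rdotZl rdotxx mulr_ge0 ?sqr_ge0//.
by case/andP: (hc (val i)).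
Unshelve. all: by end_near. Qed.

Lemma op_ge0_wcomp_id (c : I -> R) C : 0 <= C -> (forall i, 0 <= c i <= C) ->
  op_ge0 (wcomp c id).
Proof.
move=> C0 hc f; have cC i : `|c i| <= C by rewrite ger0_norm; case/andP: (hc i).
rewrite hdotE lecE /= (rdot_wcomp_id _ C0)// andbT; apply/eqP.
rewrite l2_rdot; apply: (l2rd_lim (u := fun=> 0)); last exact: cvg_cst.
move=> J; rewrite /partial_sum big1// => i _.
rewrite (wcompE C0 cC)// rdotZl /rdot l2Z dotZr hdotxx /=.
by ring.
Qed.

End L2Tools.

Section L2Tensor.
Variables (R : realType) (I : choiceType) (K : hilbertType R).
Notation E := (l2 I (scalars R)).
Notation F := (l2 I K).

Lemma hn_scalars (a : scalars R) : hn a = complex.Re `|a : R[i]|.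
Proof. by []. Qed.

Lemma tens_summable (x : K) (h : E) :
  summable_le (sqn (fun i => (h i : R[i]) *: x)) (l2n2 h * hn x ^+ 2).
Proof.
move=> J; rewrite /partial_sum /sqn.
under eq_bigr do rewrite hnZ exprMn.
by rewrite -mulr_suml ler_wpM2r ?sqr_ge0//; exact: (l2n2_ge h J).
Qed.

(** The tensor product of [K] with [l2(I)] is realized as [l2(I; K)]. *)
Definition l2tens (x : K) (h : E) : F := mkl2 (fun i => (h i : R[i]) *: x).

Lemma l2tensE x h i : l2tens x h i = (h i : R[i]) *: x.
Proof. exact: mkl2E (tens_summable x h). Qed.

Lemma l2tens_linearl h : linear (l2tens^~ h).
Proof.
move=> a x y; apply: l2_ext => i; rewrite l2E !l2tensE scalerDr !scalerA.
by rewrite mulrC.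
Qed.

Lemma l2tens_linearr x : linear (l2tens x).
Proof.
by move=> a f g; apply: l2_ext => i; rewrite l2E !l2tensE l2E scalerDl scalerA.
Qed.

Lemma l2tens_rdot x x' (h h' : E) : rdot (l2tens x h) (l2tens x' h') =
  complex.Re (hdot x x') * rdot h h' - complex.Im (hdot x x') * rdot h ('i *: h').
Proof.
rewrite !l2_rdot; apply: l2rd_lim (cvgB (cvgM (cvg_cst (complex.Re (hdot x x'))) (@l2rd_cvg _ _ _ h h'))
  (cvgM (cvg_cst (complex.Im (hdot x x'))) (@l2rd_cvg _ _ _ h ('i *: h')))) => J.
rewrite -[RHS]/(_ * partial_sum _ J - _ * partial_sum _ J) /partial_sum !mulr_sumr -sumrB.
apply: eq_bigr => i _; rewrite !l2tensE !l2Z /rdot dotZl dotZr.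
rewrite -![hdot (h _) _]/(scalars_dot _ _) /scalars_dot.
case: (hdot x x') => u v; case: (h (val i) : R[i]) => a b; case: (h' (val i) : R[i]) => a' b' /=.
by ring.
Qed.

Lemma l2tens_dot x x' h h' : hdot (l2tens x h) (l2tens x' h') = hdot x x' * hdot h h'.
Proof.
rewrite hdotE -(linZ (l2tens_linearr x')) !l2tens_rdot (hdotE h h').
have -> : rdot h ('i *: ('i *: h')) = - rdot h h'.
  by rewrite scalerA -expr2 sqr_i scaleN1r rdotNr.
case: (hdot x x') => u v /=; congr (_ +i* _); ring.
Qed.

(** A family is approximated by its restrictions to finite sets [J], which are the
    sums over [i] in [J] of [f_i (x) e_i]. *)
Lemma l2tens_dense :
  dense [set \sum_(z <- s) l2tens z.1 z.2 | s in [set: seq (K * E)]].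
Proof.
move=> O [f Of] oO; have /nbhs_ballP[e /= e0 eO] : nbhs f O by apply: open_nbhs_nbhs.
have re0 : 0 < complex.Re e by move: e0; rewrite ltcE /= => /andP[].
have [M hM] := l2P f.
have e2 : 0 < complex.Re e ^+ 2 by rewrite exprn_gt0.
have [J hJ] := possum_adh hM e2.
pose s := [seq (f i, single i (1 : scalars R)) | i <- J].
exists (\sum_(z <- s) l2tens z.1 z.2); split; last by exists s.
apply: eO; rewrite -ball_normE /= normE.
have -> : e = (complex.Re e)%:C by rewrite RRe_real// gtr0_real.
rewrite ltcR -(@ltr_pXn2r _ 2) ?nnegrE//; last exact: ltW.
have coord i : (\sum_(z <- s) l2tens z.1 z.2 : F) i = if i \in J then f i else 0.
  rewrite big_map.
  have -> : (\sum_(j <- J) l2tens (f j) (single j (1 : scalars R)) : F) i =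
            \sum_(j <- J) (if j == i then f i else 0).
    elim/big_rec2 : _ => // j y z _ <-; rewrite l2D l2tensE singleE eq_sym.
    by case: eqVneq => [->|_]; rewrite ?scale1r// scale0r.
  case: ifP => iJ; last by rewrite big_seq big1// => j jJ; case: eqVneq => // ji; rewrite -ji jJ in iJ.
  rewrite (big_fsetD1 i)//= eqxx big_seq big1 ?addr0// => j; rewrite !inE => /andP[/negbTE->//].
rewrite l2_hn2; apply: (@le_lt_trans _ _ (l2n2 f - partial_sum (sqn f) J)); last first.
  by move: hJ; rewrite -/(l2n2 f); lra.
apply: l2n2_le => J'.
have h1 := l2n2_ge f (J `|` J')%fset.
have h2 : partial_sum (sqn (f - (\sum_(z <- s) l2tens z.1 z.2 : F))) J' <=
   partial_sum (sqn (f - (\sum_(z <- s) l2tens z.1 z.2 : F))) (J `|` J')%fset.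
  by apply: psum_subset; [move=> i; exact: sqn_ge0|exact: fsubsetUr].
apply: (le_trans h2); rewrite lerBrDr; apply: le_trans h1.
have -> : partial_sum (sqn f) J = partial_sum (fun i => if i \in J then sqn f i else 0) (J `|` J')%fset.
  rewrite !psumE -(big_fset_incl _ (fsubsetUl J J')) => [|i _ /negbTE->//].
  by rewrite big_seq [RHS]big_seq; apply: eq_bigr => i ->.
rewrite -psumD; apply: psum_le => i; rewrite /sqn l2B coord.
by case: ifP => _; rewrite ?subrr ?hn0 ?expr0n/= ?add0r// subr0 addr0.
Qed.

Definition l2_tensor : hilbertTensor K E :=
  HilbertTensor l2tens_linearl l2tens_linearr l2tens_dot l2tens_dense.

End L2Tensor.

(** * Weighted shifts on the Fock space of multiwords *)

Lemma adj_unique (R : realType) (H : hilbertType R) (S T : H -> H) : bounded_op S ->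
  (forall x y, rdot (S x) y = rdot x (T y)) -> adj S = T.
Proof.
by move=> bS h; apply/funext => y; apply: dot_inj => x; rewrite -rdot_adj// h.
Qed.

Lemma adj_scale (R : realType) (H : hilbertType R) (S : H -> H) (c : R) : bounded_op S ->
  adj (c%:C *: S) = c%:C *: adj S.
Proof.
move=> bS; apply: adj_unique; first exact: bounded_scale.
by move=> x y; rewrite !fctE rdotZl rdotZr rdot_adj.
Qed.

#[local] Arguments bcoef : simpl never.

Section Shifts.
Variables (R : realType) (k : nat) (n : 'I_k -> nat).
Variable q : forall i, {fsfun seq 'I_(n i) -> R with 0}.
Hypothesis q_reg : forall i, positive_regular (q i).

(** The orthonormal basis of the tensor product of the full Fock spaces. *)
Definition multiword : Type := {dffun forall i : 'I_k, seq 'I_(n i)}.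
HB.instance Definition _ := Choice.on multiword.

Notation b i := (bcoef (q i)).

Let b_gt0 i w : 0 < b i w.
Proof. exact: bcoef_gt0. Qed.

Notation H := (l2 multiword (scalars R)).

(** The weight and the index map of the shift by the word [u] in the [i]-th
    tensor factor: it sends [e_v] to [(b_v / b_(uv))^(1/2) e_(uv)]. *)
Definition wgt i (u : seq 'I_(n i)) (v : multiword) : R :=
  if prefix u (v i) then Num.sqrt (b i (drop (size u) (v i)) / b i (v i)) else 0.

Definition strip i (u : seq 'I_(n i)) (v : multiword) : multiword := upd v (drop (size u) (v i)).

Definition shift i (j : 'I_(n i)) : H -> H := wcomp (wgt [:: j]) (strip [:: j]).

Lemma wgt_inj i (u : seq 'I_(n i)) v v' : wgt u v != 0 -> wgt u v' != 0 ->
  strip u v = strip u v' -> v = v'.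
Proof.
rewrite /wgt; case: ifP => [|_]; last by rewrite eqxx.
case: ifP => [|_ _]; last by rewrite eqxx.
move=> /prefixP[t vt] /prefixP[t' vt'] _ _ h.
have tt : t = t' by have := congr1 (fun x : multiword => x i) h; rewrite !updE vt vt' !drop_size_cat.
rewrite -(upd_id v i) -(upd_id v' i) vt vt' tt -(upd_upd v (drop (size u) (v i))) -/(strip u v) h.
by rewrite upd_upd.
Qed.

(** The shifts are bounded because [b_(jv) >= a_j b_v]. *)
Lemma wgt_le i (j : 'I_(n i)) v : `|wgt [:: j] v| <= Num.sqrt ((q i [:: j])^-1).
Proof.
have [_ _ q1] := q_reg i.
rewrite /wgt; case: ifP => [/prefixP[t ->]|_]; last by rewrite normr0 sqrtr_ge0.
rewrite drop_size_cat// ger0_norm ?sqrtr_ge0// ler_sqrt; last by rewrite invr_ge0 ltW.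
rewrite ler_pdivrMr// mulrC ler_pdivlMr// mulrC.
exact: bcoef_cons.
Qed.

Lemma bounded_shift i (j : 'I_(n i)) : bounded_op (@shift i j).
Proof. exact: wcomp_bounded (sqrtr_ge0 _) (wgt_le j) (@wgt_inj i [:: j]). Qed.

Lemma shiftE i (j : 'I_(n i)) f v : shift j f v = (wgt [:: j] v)%:C *: f (strip [:: j] v).
Proof. exact: wcompE (sqrtr_ge0 _) (wgt_le j) (@wgt_inj i [:: j]) f v. Qed.

Lemma word_shiftE i (u : seq 'I_(n i)) f v :
  word_op (@shift i) u f v = (wgt u v)%:C *: f (strip u v).
Proof.
elim: u v => [|j u IH] v.
  rewrite word_nil /wgt /strip prefix0s drop0 divff ?gt_eqF// sqrtr1 scale1r.
  by rewrite upd_id.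
rewrite word_cons /= shiftE IH scalerA -rmorphM /= /strip updE upd_upd drop_drop addn1.
congr (_%:C *: _); rewrite /wgt updE.
case: (v i) => [|x w] /=; first by rewrite mul0r.
rewrite drop0 prefix0s andbT; case: eqVneq => _ /=; last by rewrite mul0r.
case: ifP => _; last by rewrite mulr0.
rewrite -sqrtrM ?divr_ge0 ?ltW//; congr (Num.sqrt _).
by field; rewrite !gt_eqF.
Qed.

Lemma word_shift_single i (u : seq 'I_(n i)) (v : multiword) (x : scalars R) :
  word_op (@shift i) u (single v x) =
  (Num.sqrt (b i (v i) / b i (u ++ v i)))%:C *: single (upd v (u ++ v i)) x.
Proof.
apply: l2_ext => w; rewrite word_shiftE l2Z !singleE.
have -> : (w == upd v (u ++ v i)) = prefix u (w i) && (strip u w == v).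
  apply/eqP/andP => [->|[/prefixP[t wt] /eqP sv]].
    by rewrite /strip updE prefix_prefix drop_size_cat// upd_upd upd_id.
  have tv : t = v i by rewrite -sv /strip updE wt drop_size_cat.
  by rewrite -tv -wt -sv /strip upd_upd upd_id.
rewrite /wgt; case: ifP => [/prefixP[t wt]|_] /=; last by rewrite scale0r scaler0.
case: eqVneq => [sv|_]; last by rewrite !scaler0.
by rewrite -sv /strip updE wt drop_size_cat.
Qed.

Lemma bounded_wshift i (u : seq 'I_(n i)) : bounded_op (word_op (@shift i) u).
Proof. by apply: bounded_word => j; exact: bounded_shift. Qed.

(** The coordinate at [v] is the inner product with [e_v], whose image under the
    shift is known. *)
Lemma adj_wshiftE i (u : seq 'I_(n i)) f (v : multiword) :
  adj (word_op (@shift i) u) f v =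
  (Num.sqrt (b i (v i) / b i (u ++ v i)))%:C *: f (upd v (u ++ v i)).
Proof.
apply: dot_inj => x; rewrite -rdot_single -rdot_adj; last exact: bounded_wshift.
by rewrite word_shift_single rdotZl rdot_single rdotZr.
Qed.

Lemma l2_sum (J : Type) (r : seq J) (P : pred J) (F : J -> H) v :
  (\sum_(j <- r | P j) F j : H) v = \sum_(j <- r | P j) F j v.
Proof. by elim/big_rec2 : _ => // j y z _ <-. Qed.

Definition shifts : optuple n H := fun i j => @shift i j.

Lemma shift_comm s t (j : 'I_(n s)) (l : 'I_(n t)) : s != t ->
  @shift s j \o @shift t l = @shift t l \o @shift s j.
Proof.
move=> st; apply/funext => f; apply: l2_ext => v /=; rewrite !shiftE !scalerA -!rmorphM /=.
have ts : t != s by rewrite eq_sym.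
congr (_%:C *: f _); last by rewrite /strip updN// updN// upd_comm.
by rewrite mulrC /wgt /strip !updN.
Qed.

Section Dilated.
Variable t : R.
Hypotheses (t_ge0 : 0 <= t) (t_lt1 : t < 1).

Let Wt : optuple n H := scale_tuple (fun=> t) shifts.
Arguments Wt : clear implicits.

Let Wt_bdd i j : bounded_op (Wt i j).
Proof. by apply: bounded_scale; exact: bounded_shift. Qed.

Lemma commuting_dilated : commuting_tuple Wt.
Proof.
split=> [|s u su j l]; first exact: Wt_bdd.
apply/funext => f; rewrite /Wt /scale_tuple /shifts /= !fctE.
rewrite !(linZ (bounded_lin (bounded_shift _))) -![shift _ (shift _ _)]/((_ \o _) _).
by rewrite (shift_comm j l su).
Qed.

Lemma word_dilated i u : word_op (Wt i) u = (t ^+ size u)%:C *: word_op (@shift i) u.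
Proof. by rewrite /Wt word_scale// => j; exact: bounded_lin (bounded_shift j). Qed.

(** The eigenvalue of [Phi_i(1)] at [e_v], for the shifts dilated by [t]; it depends
    on the [i]-th word of [v] only. *)
Definition mass i (v : seq 'I_(n i)) : R :=
  \sum_(u <- finsupp (q i) | prefix u v) q i u * (t ^+ (2 * size u) * (b i (drop (size u) v) / b i v)).

Lemma mass_ge0 i v : 0 <= mass (i := i) v.
Proof.
have [q0 _ _] := q_reg i.
by apply: sumr_ge0 => u _; rewrite !mulr_ge0 ?exprn_ge0 ?invr_ge0 ?(ltW (b_gt0 _)).
Qed.

(** Without the powers of [t] the sum is 1, or 0 for the empty word, by the
    recursion for the coefficients [b]; every word of the support is nonempty
    and contributes a factor of at most [t^2]. *)
Lemma mass_le i v : mass (i := i) v <= t ^+ 2.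
Proof.
have [q0 qnil _] := q_reg i.
have un u : u \in finsupp (q i) -> u != [::].
  by apply: contraTneq => ->; rewrite memNfinsupp qnil.
have [->|v0] := eqVneq v [::].
  rewrite /mass big_seq_cond big1 ?sqr_ge0// => u /andP[/un].
  by rewrite prefixs0 => /negbTE->.
apply: (@le_trans _ _ (t ^+ 2 * \sum_(u <- finsupp (q i) | prefix u v) q i u * b i (drop (size u) v) / b i v)).
  rewrite mulr_sumr /mass big_seq_cond [leRHS]big_seq_cond; apply: ler_sum => u /andP[/un u0 _].
  rewrite mulrCA -mulrA ler_wpM2r ?mulr_ge0 ?invr_ge0 ?(ltW (b_gt0 _))//.
  rewrite ler_wiXn2l ?(ltW t_lt1)//.
  by rewrite -[X in (X <= _)%N]muln1 leq_mul2l /= lt0n size_eq0.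
by rewrite -mulr_suml -bcoef_prefix// divff ?mulr1// gt_eqF.
Qed.

(** [Phi_i] preserves diagonal operators. It multiplies by [mass] those whose
    entries do not depend on the [i]-th word, such as the products that arise
    when the factors of [Delta] are applied one after the other. *)
Lemma Phi_diag i (y : multiword -> R) C f v : 0 <= C -> (forall v, `|y v| <= C) ->
  (forall v w, y (upd (i := i) v w) = y v) ->
  Phi (q i) (Wt i) (wcomp y id) f v = (mass (v i) * y v)%:C *: f v.
Proof.
move=> C0 yC yi; rewrite /Phi ffunS l2_sum.
rewrite /mass mulr_suml rmorph_sum scaler_suml [RHS]big_mkcond; apply: eq_bigr => u _.
rewrite fctE l2Z /= word_dilated adj_scale; last exact: bounded_wshift.
rewrite !fctE l2Z word_shiftE (wcompE C0 yC)// l2Z adj_wshiftE !scalerA -!rmorphM /=.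
rewrite /strip yi upd_upd updE /wgt.
case: ifP => [/prefixP[w vw]|_]; last by rewrite !(mulr0, mul0r) scale0r.
have -> : u ++ drop (size u) (v i) = v i by rewrite vw drop_size_cat.
rewrite upd_id; congr (_%:C *: _).
set x := b i _ / b i _; have x0 : 0 <= x by rewrite divr_ge0 ?ltW.
rewrite -[in RHS](sqr_sqrtr x0) mul2n -addnn exprD; ring.
Qed.

Lemma Delta_diag (p : 'I_k -> bool) (s : seq 'I_k) : uniq s ->
  (\big[comp/idfun]_(i <- s) iter (p i) (fun S => S - Phi (q i) (Wt i) S)) idfun =
  wcomp (fun v : multiword => \prod_(i <- s) (if p i then 1 - mass (v i) else 1)) id.
Proof.
have m01 i v : 0 <= 1 - mass (i := i) v <= 1.
  have := mass_ge0 v; have := mass_le v; have : t ^+ 2 <= 1 by rewrite expr_le1// ltW.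
  by move=> *; apply/andP; split; lra.
have prod_le (s' : seq 'I_k) (v : multiword) :
    `|\prod_(i <- s') (if p i then 1 - mass (v i) else 1)| <= 1.
  rewrite normr_prod; apply: prodr_ile1 => i _; rewrite normr_ge0 /=.
  case: (p i); last by rewrite normr1.
  by have /andP[h1 h2] := m01 i (v i); rewrite ger0_norm.
elim: s => [_|i s IH /= /andP[is_ us]].
  rewrite big_nil; apply/funext => f; apply: l2_ext => v.
  rewrite (wcompE ler01 (C := 1)) => [|w|//]; last by rewrite big_nil normr1.
  by rewrite big_nil scale1r.
rewrite big_cons /= IH//; apply/funext => f; apply: l2_ext => v.
rewrite (wcompE ler01 (prod_le _))// big_cons.
case: (p i) => /=; last by rewrite mul1r (wcompE ler01 (prod_le _)).
rewrite !fctE.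
rewrite (wcompE ler01 (prod_le _))// (Phi_diag _ _ ler01 (prod_le _)).
  by rewrite -scalerBl -rmorphB mulrBl mul1r.
move=> w w'; rewrite big_seq [RHS]big_seq; apply: eq_bigr => j js.
by rewrite updN//; apply: contraNneq is_ => ->.
Qed.

(** All the defect operators are diagonal, with entries between
    [(1 - t^2)^k] and 1. *)
Lemma dilated_Dopen : Dopen q H Wt.
Proof.
have m01 i v : 1 - t ^+ 2 <= 1 - mass (i := i) v <= 1.
  by have := mass_ge0 v; have := mass_le v => *; apply/andP; split; lra.
have t2 : 0 < 1 - t ^+ 2 by rewrite subr_gt0 expr_lt1.
have prod01 p (v : multiword) :
    (1 - t ^+ 2) ^+ k <= \prod_(i < k) (if p i then 1 - mass (v i) else 1) <= 1.
  apply/andP; split.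
    rewrite -{1}(card_ord k) -prodr_const; apply: ler_prod => i _; rewrite (ltW t2) /=.
    by case: (p i); [case/andP: (m01 i (v i))|rewrite gerBl sqr_ge0].
  apply: prodr_ile1 => i _; case: (p i); last by rewrite ler01 lexx.
  by case/andP: (m01 i (v i)) => h1 ->; rewrite andbT (le_trans (ltW t2)).
have c0 : 0 < (1 - t ^+ 2) ^+ k by rewrite exprn_gt0.
have DE p : Delta q p Wt idfun =
    wcomp (fun v : multiword => \prod_(i < k) (if p i then 1 - mass (v i) else 1)) id.
  by rewrite /Delta Delta_diag// index_enum_uniq.
have Dpos p : op_ge0 (Delta q p Wt idfun).
  rewrite DE; apply: (op_ge0_wcomp_id ler01) => v.
  by case/andP: (prod01 p v) => h1 ->; rewrite andbT (le_trans (ltW c0)).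
split; first by split; [exact: commuting_dilated|exact: Dpos].
split; first exact: Dpos.
pose y (v : multiword) := \prod_(i < k) (1 - mass (v i)).
have yE v : (1 - t ^+ 2) ^+ k <= y v <= 1 by have := prod01 (fun=> true) v.
have y0 v : 0 < y v by case/andP: (yE v) => h1 _; exact: lt_le_trans h1.
have y1 v : `|y v| <= 1 by rewrite gtr0_norm//; case/andP: (yE v).
have yV v : `|(y v)^-1| <= ((1 - t ^+ 2) ^+ k)^-1.
  by rewrite gtr0_norm ?invr_gt0// lef_pV2 ?posrE//; case/andP: (yE v).
have cV0 : 0 <= ((1 - t ^+ 2) ^+ k)^-1 by rewrite invr_ge0 ltW.
exists (wcomp (fun v => (y v)^-1) id); rewrite DE -/y; split.
- by apply: (@wcomp_bounded _ _ (scalars R) _ id _ cV0 yV).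
- apply/funext => f; apply: l2_ext => v /=.
  by rewrite (wcompE ler01 y1)// (wcompE cV0 yV)// scalerA -rmorphM divff ?scale1r// gt_eqF.
- apply/funext => f; apply: l2_ext => v /=.
  by rewrite (wcompE cV0 yV)// (wcompE ler01 y1)// scalerA -rmorphM mulVf ?scale1r// gt_eqF.
Qed.

End Dilated.

(** The shifts are the norm limits of their dilations by [1 - x]. *)
Lemma shifts_closure : opclosure (Dopen q H) shifts.
Proof.
split=> [i j|e e0]; first exact: bounded_shift.
pose C := \sum_i \sum_(j < n i) opnorm (@shift i j) + 1.
have le_C i j : opnorm (@shift i j) <= C.
  rewrite /C (bigD1 i)//= (bigD1 j)//= -!addrA lerDl.
  rewrite addr_ge0 ?addr_ge0//; apply: sumr_ge0 => l _; last apply: sumr_ge0 => m _;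
    by rewrite opnorm_ge0//; exact: bounded_shift.
have C0 : 0 < C.
  by rewrite ltr_wpDl//; apply: sumr_ge0 => l _; apply: sumr_ge0 => m _;
    rewrite opnorm_ge0//; exact: bounded_shift.
pose x := Num.min (1 / 2) (e / (2 * C)).
have x0 : 0 < x by rewrite lt_min !divr_gt0// mulr_gt0.
have x1 : x <= 1 / 2 by rewrite ge_min lexx.
exists (scale_tuple (fun=> 1 - x) shifts); first by apply: dilated_Dopen; lra.
move=> i j; have -> : shifts j - scale_tuple (fun=> 1 - x) shifts j = x%:C *: @shift i j.
  by apply/funext => f; rewrite /scale_tuple !fctE rmorphB rmorph1 scalerBl scale1r opprB addrC subrK.
have bS := bounded_shift j.
apply: (@le_lt_trans _ _ (x * opnorm (@shift i j))).
  apply: opnorm_le => [|f]; first by rewrite mulr_ge0 ?opnorm_ge0// ltW.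
  by rewrite fctE hnZr gtr0_norm// -mulrA ler_wpM2l ?(ltW x0)// opnormP.
have xe : x * C <= e / 2.
  have : x <= e / (2 * C) by rewrite ge_min lexx orbT.
  rewrite ler_pdivlMr ?mulr_gt0// => h; lra.
by have := ler_wpM2l (ltW x0) (le_C i j); lra.
Qed.

End Shifts.

(** * Divergence for unbounded coefficients *)

(** Far out in the net, two partial sums that differ in one term are both within
    distance 1 of the limit. *)
Lemma op_summable_bounded (R : realType) (H : hilbertType R) (I : choiceType)
    (u : I -> H -> H) : (forall i, bounded_op (u i)) -> op_summable u ->
  exists M, forall i, opnorm (u i) <= M.
Proof.
move=> bu [S bS /cvgrPdist_lt h]; have [J _ hJ] := h 1 ltr01.
have bP J' : bounded_op (partial_sum u J') by exact: bounded_sum.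
have bPS J' : bounded_op (partial_sum u J' - S) by apply: bounded_add => //; exact: bounded_opp.
have u0 i : 0 <= opnorm (u i) by exact: opnorm_ge0.
exists (2 + partial_sum (fun i => opnorm (u i)) J) => i.
have [iJ|iJ] := boolP (i \in J).
  have := @psum_subset _ _ (fun i => opnorm (u i)) [fset i]%fset J u0.
  by rewrite fsub1set psum1 => /(_ iJ); lra.
have -> : u i = (partial_sum u (i |` J)%fset - S) - (partial_sum u J - S).
  by rewrite psumU1// opprB addrA subrK addrK.
apply: le_trans (opnormD (bPS _) (bounded_opp (bPS _))) _; rewrite opnormN.
have := hJ J (fsubset_refl _); have := hJ (i |` J)%fset (fsubsetUr _ _).
rewrite /= !sub0r !normrN; have := ler_norm (opnorm (partial_sum u (i |` J)%fset - S)).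
have := ler_norm (opnorm (partial_sum u J - S)).
have := psum_ge0 J u0; lra.
Qed.

Section PartTwo.
Variables (R : realType) (k : nat) (n : 'I_k -> nat).
Variable q : forall i, {fsfun seq 'I_(n i) -> R with 0}.
Hypothesis q_reg : forall i, positive_regular (q i).
Variables (K : hilbertType R) (A : (forall i, seq 'I_(n i)) -> K -> K).
Hypothesis A_bdd : forall w, bounded_op (A w).
Variable r : 'I_k -> R.
Hypothesis r_gt0 : forall i, 0 < r i.

Notation b i := (bcoef (q i)).
Let b_gt0 i w : 0 < b i w.
Proof. exact: bcoef_gt0. Qed.

Notation H := (l2 (multiword n) (scalars R)).

Let X : optuple n H := scale_tuple r (shifts q).
Arguments X : clear implicits.

Let X_bdd i j : bounded_op (X i j).
Proof. by apply: bounded_scale; exact: bounded_shift. Qed.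

Definition vacuum : H := single (finfun (fun i => [::] : seq 'I_(n i)) : multiword n) (1 : scalars R).

(** The coefficient of [e_w] in [X_w e_0], for the scaled shifts [X]. *)
Definition weight (w : forall i, seq 'I_(n i)) : R :=
  \prod_i (r i ^+ size (w i) / Num.sqrt (b i (w i))).

Lemma multi_op_vacuum (w : forall i, seq 'I_(n i)) :
  multi_op X w vacuum = (weight w)%:C *: single (finfun w : multiword n) (1 : scalars R).
Proof.
pose mw (s : seq 'I_k) : multiword n := finfun (fun j => if j \in s then w j else [::]).
have key s : uniq s -> (\big[comp/idfun]_(i <- s) word_op (X i) (w i)) vacuum =
    (\prod_(i <- s) (r i ^+ size (w i) / Num.sqrt (b i (w i))))%:C *: single (mw s) (1 : scalars R).
  elim: s => [_|i s IH /= /andP[is_ us]].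
    by rewrite !big_nil scale1r; congr (single _ _); apply/ffunP => j; rewrite !ffunE.
  rewrite !big_cons /= IH//.
  rewrite (linZ (bounded_lin (bounded_word (w i) (@X_bdd i)))).
  rewrite /X word_scale => [|j]; last exact: bounded_lin (bounded_shift q_reg j).
  have mwi : mw s i = [::] by rewrite ffunE (negbTE is_).
  rewrite fctE /shifts word_shift_single// mwi cats0 bcoef_nil !scalerA -!rmorphM /=.
  rewrite sqrtrM ?ler01// sqrtr1 mul1r sqrtrV ?ltW//.
  congr (_%:C *: single _ _).
  by rewrite -mulrA mulrC.
  apply/ffunP => j; have [<-|ij] := eqVneq i j; first by rewrite updE !ffunE inE eqxx.
  by rewrite updN// !ffunE inE eq_sym (negbTE ij).
rewrite /multi_op key ?index_enum_uniq//; congr (_ *: single _ _).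
by apply/ffunP => j; rewrite !ffunE mem_index_enum.
Qed.

Lemma hn_scalars1 : hn (1 : scalars R) = 1.
Proof. by rewrite hn_scalars normr1. Qed.

Let T := l2_tensor (multiword n) K.

(** Distinct words send the vacuum to orthogonal vectors, so that no cancellation
    takes place on [x (x) e_0]. *)
Lemma hom_part_vacuum (p : {ffun 'I_k -> nat}) (x : K) :
  hn (hom_part A T X p (tens T x vacuum)) ^+ 2 =
  \sum_(w : Lambda n p) weight (words w) ^+ 2 * hn (A (words w) x) ^+ 2.
Proof.
rewrite /hom_part ffunS.
under eq_bigr => w _.
  rewrite (tensopP T (A_bdd _) (multi_opW _ X_bdd)).2 multi_op_vacuum.
  over.
rewrite hn_pyth => [|w w' ww'].
  apply: eq_bigr => w _; rewrite hn_tens hnZr hn_single exprMn exprMn real_normK ?num_real//.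
  by rewrite hn_scalars1 expr1n mulr1 mulrC.
rewrite tens_dot dotZl dotZr; set e := hdot (single _ _) _.
suff -> : e = 0 by rewrite !mulr0.
have neq : (finfun (words w) : multiword n) != finfun (words w').
  apply: contra_neq ww' => /ffunP h; apply/ffunP => j; apply/val_inj.
  by have := h j; rewrite !ffunE.
by rewrite /e hdotE !rdot_single l2Z !singleE (negbTE neq) scaler0 /rdot dot0r.
Qed.

Lemma weightE (p : {ffun 'I_k -> nat}) (w : Lambda n p) :
  weight (words w) ^+ 2 = \prod_i r i ^+ (2 * p i) * (\prod_i b i (words w i))^-1.
Proof.
rewrite /weight -prodrXl -prodfV -big_split; apply: eq_bigr => i _.
by rewrite exprMn exprVn sqr_sqrtr ?ltW// size_tuple -exprM mulnC.
Qed.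

(** [hom_part_vacuum] bounds the columns of the [weight w A_w] by [L]. The
    coefficient operator is the product of the adjoint of such a column with the
    column, so that its norm is at most [L^2]. *)
Lemma coef_norms_bounded (L : R) :
  (forall p, opnorm (hom_part A T X p) <= L) -> bounded_set (coef_norms q A r).
Proof.
move=> hL.
have bhom p : bounded_op (hom_part A T X p).
  by apply: bounded_sum => w; apply: (tensopP T _ _).1 => //; exact: multi_opW.
have L0 : 0 <= L by apply: le_trans (hL [ffun=> 0%N]); exact: opnorm_ge0.
have vac1 : hn vacuum = 1 by rewrite hn_single hn_scalars1.
have key p x : \sum_(w : Lambda n p) weight (words w) ^+ 2 * hn (A (words w) x) ^+ 2 <= (L * hn x) ^+ 2.
  rewrite -hom_part_vacuum ler_pXn2r ?nnegrE ?mulr_ge0//.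
  rewrite (le_trans (opnormP _ (bhom p)))// hn_tens vac1 mulr1 ler_wpM2r//.
suff h (p : {ffun 'I_k -> nat}) : opnorm ((\prod_(i < k) r i ^+ (2 * p i))%:C *: coef_op q A p) <= L ^+ 2.
  exists (L ^+ 2); split; first exact: num_real.
  move=> M LM _ [p _ <-] /=; rewrite ger0_norm; first exact: le_trans (h p) (ltW LM).
  by apply: opnorm_ge0; apply: bounded_scale; exact: bounded_coef_op.
apply: opnorm_le => [|x]; first exact: sqr_ge0.
set Q := _ *: _; set y := Q x.
have Qdot : hn y ^+ 2 = \sum_(w : Lambda n p) rdot ((weight (words w))%:C *: A (words w) x)
    ((weight (words w))%:C *: A (words w) y).
  rewrite -rdotxx {1}/y /Q fctE rdotZl rdot_coef_op// mulr_sumr; apply: eq_bigr => w _.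
  by rewrite rdotZl rdotZr !mulrA -expr2 weightE.
have := @cs_sum _ _ _ (index_enum (Lambda n p)) (fun w => (weight (words w))%:C *: A (words w) x)
  (fun w => (weight (words w))%:C *: A (words w) y).
rewrite -Qdot.
have E z : \sum_(w : Lambda n p) hn ((weight (words w))%:C *: A (words w) z) ^+ 2 =
    \sum_(w : Lambda n p) weight (words w) ^+ 2 * hn (A (words w) z) ^+ 2.
  by apply: eq_bigr => w _; rewrite hnZr exprMn real_normK ?num_real.
rewrite !E => cs.
have {}cs : (hn y ^+ 2) ^+ 2 <= (L * hn x) ^+ 2 * (L * hn y) ^+ 2.
  apply: le_trans cs _; apply: ler_pM => //; apply: sumr_ge0 => w _; rewrite mulr_ge0 ?sqr_ge0//.
have [y0|y0] := eqVneq (hn y) 0; first by rewrite y0 mulr_ge0 ?sqr_ge0.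
have yp : 0 < hn y by rewrite lt_def y0 hn_ge0.
rewrite -(ler_pM2l yp) -expr2 -(@ler_pXn2r _ 2) ?nnegrE ?mulr_ge0 ?sqr_ge0//.
by apply: le_trans cs _; rewrite le_eqVlt; apply/orP; left; apply/eqP; ring.
Qed.

Lemma part_two : ~ bounded_set (coef_norms q A r) ->
  [/\ (scale_tuple r @` opclosure (Dopen q H)) X,
      ~ cvg (partial_sum (fun p => opnorm (hom_part A T X p)) @ totally)
    & ~ op_summable (hom_part A T X)].
Proof.
move=> nb.
have bhom p : bounded_op (hom_part A T X p).
  by apply: bounded_sum => w; apply: (tensopP T _ _).1 => //; exact: multi_opW.
split.
- by exists (shifts q) => //; exact: shifts_closure.
- move=> /cvg_psum_bounded[p|M hM]; first exact: opnorm_ge0.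
  by apply: nb; exact: (@coef_norms_bounded M).
- move=> /(op_summable_bounded bhom)[M hM].
  by apply: nb; exact: (@coef_norms_bounded M).
Qed.

End PartTwo.

Theorem theorem2p3 (R : realType) (k : nat) (k_gt0 : (0 < k)%N)
    (n : 'I_k -> nat) (n_gt0 : forall i, (0 < n i)%N)
    (q : forall i, {fsfun seq 'I_(n i) -> R with 0})
    (q_reg : forall i, positive_regular (q i))
    (K : hilbertType R) (A : (forall i, seq 'I_(n i)) -> K -> K)
    (A_bounded : forall w, bounded_op (A w))
    (r : 'I_k -> R) (r_gt0 : forall i, 0 < r i) :
  (bounded_set (coef_norms q A r) ->
     forall (H : hilbertType R) (T : hilbertTensor K H),
       (forall X : optuple n H, (scale_tuple r @` Dopen q H) X ->
          cvg (partial_sum (fun p => opnorm (hom_part A T X p)) @ totally)) /\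
       (forall s : 'I_k -> R, (forall i, 0 <= s i < r i) ->
          exists g : optuple n H -> R,
            {uniform scale_tuple s @` opclosure (Dopen q H),
               (fun J (X : optuple n H) =>
                  partial_sum (fun p => opnorm (hom_part A T X p)) J)
                 @ totally --> g})) /\
  (~ bounded_set (coef_norms q A r) ->
     exists (H : hilbertType R) (T : hilbertTensor K H) (X : optuple n H),
       [/\ (scale_tuple r @` opclosure (Dopen q H)) X,
           ~ cvg (partial_sum (fun p => opnorm (hom_part A T X p)) @ totally)
         & ~ op_summable (hom_part A T X)]).
Proof.
split=> [bA H T|nbA].
  split=> [X rX|s sr]; first exact: (part_one_open q_reg A_bounded r_gt0).
  eexists; exact: (part_one_uniform q_reg A_bounded r_gt0).
exists (l2 (multiword n) (scalars R)), (l2_tensor (multiword n) K), (scale_tuple r (shifts q)).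
exact: (part_two q_reg A_bounded nbA).
Qed.
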